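(* Let $\alpha>0$ and $1\le p<\infty$. Then $C_0^\infty(\mathbb{R})$ is dense in ${}^{\pm}W^{\alpha,p}(\mathbb{R})$. Hence ${}^{\pm}\overline{W}^{\alpha,p}(\mathbb{R})={}^{\pm}\overline{W}^{\alpha,p}_0(\mathbb{R})={}^{\pm}W^{\alpha,p}(\mathbb{R})$. (Both assertions hold for each of the signs $-$ and $+$.)
   Context: For $\alpha>0$ let $[\alpha]$ be its integer part and $n=[\alpha]+1$. For $\varphi\in C_0^\infty(\mathbb{R})$: ${}^{-}D^{\alpha}\varphi(x)=\frac{1}{\Gamma(n-\alpha)}\frac{d^n}{dx^n}\int_{-\infty}^x\frac{\varphi(y)}{(x-y)^{\alpha-n+1}}dy$ and ${}^{+}D^{\alpha}\varphi(x)=\frac{(-1)^n}{\Gamma(n-\alpha)}\frac{d^n}{dx^n}\int_x^{\infty}\frac{\varphi(y)}{(y-x)^{\alpha-n+1}}dy$. Weak derivatives on $\mathbb{R}$: for $u\in L^1(\mathbb{R})$ (or, with the same identity, $u\in L^p(\mathbb{R})$), $v\in L^1_{loc}(\mathbb{R})$ is the left (resp. right) weak fractional derivative of $u$, $v={}^{-}\mathcal{D}^{\alpha}u$ (resp. ${}^{+}\mathcal{D}^{\alpha}u$), if $\int_{\mathbb{R}} v\varphi\,dx=(-1)^{[\alpha]}\int_{\mathbb{R}} u\,{}^{+}D^{\alpha}\varphi\,dx$ (resp. with ${}^{-}D^{\alpha}\varphi$) for all $\varphi\in C_0^\infty(\mathbb{R})$. With $m=[\alpha]$, ${}^{\pm}W^{\alpha,p}(\mathbb{R})=\{u\in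 W^{m,p}(\mathbb{R}): {}^{\pm}\mathcal{D}^{\alpha}u\in L^p(\mathbb{R})\}$ with norm $(\|u\|_{W^{m,p}}^p+\|{}^{\pm}\mathcal{D}^{\alpha}u\|_{L^p}^p)^{1/p}$. One-side supported spaces: ${}^{-}C_0^\infty(\mathbb{R})=\{\varphi\in C^\infty(\mathbb{R}):\exists c\in\mathbb{R},\ \varphi(x)=0\ \forall x>c\}$ and ${}^{+}C_0^\infty(\mathbb{R})=\{\varphi\in C^\infty(\mathbb{R}):\exists c\in\mathbb{R},\ \varphi(x)=0\ \forall x<c\}$. ${}^{\pm}\overline{W}^{\alpha,p}(\mathbb{R})$ and ${}^{\pm}\overline{W}^{\alpha,p}_0(\mathbb{R})$ are the completions, in the norm of ${}^{\pm}W^{\alpha,p}(\mathbb{R})$, of (the finite-norm elements of) $C^\infty(\mathbb{R})$ and ${}^{\pm}C_0^\infty(\mathbb{R})$ respectively. *)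

(* Defs.v *)
From HB Require Import structures.
From mathcomp Require Import all_boot all_order all_algebra.
From mathcomp Require Import all_classical all_reals all_analysis.

Set Implicit Arguments.
Unset Strict Implicit.
Unset Printing Implicit Defensive.

Import Order.TTheory GRing.Theory Num.Theory.
Import numFieldNormedType.Exports.

Local Open Scope classical_set_scope.
Local Open Scope ring_scope.

(* [left] is the sign "-" (integration over ]-oo, x]), [right] is the sign "+"
   (integration over [x, +oo[). *)
Variant side := left_side | right_side.

Definition opposite (s : side) : side :=
  if s is left_side then right_side else left_side.

Section function_spaces.
Context {R : realType}.
Implicit Types (f g u v phi : R -> R) (s : side) (a p : R) (k m : nat).

Local Notation mu := (@lebesgue_measure R).

Definition Cinf : set (R -> R) :=
  [set f | forall k x, derivable (derive1n k f) x 1].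

Definition C0inf : set (R -> R) :=
  [set f | Cinf f /\ compact (closure [set x | f x != 0])].

Definition C0inf_side s : set (R -> R) :=
  [set f | Cinf f /\
    match s with
    | left_side => exists c, forall x, c < x -> f x = 0
    | right_side => exists c, forall x, x < c -> f x = 0
    end].

Definition Gamma_fun (z : R) : R :=
  \int[mu]_(t in `]0, +oo[) (t `^ (z - 1) * expR (- t)).

Definition frac_deriv s a phi : R -> R :=
  let n := (Num.truncn a).+1 in
  match s with
  | left_side =>
      let I x := \int[mu]_(y in `]-oo, x]) (phi y / (x - y) `^ (a - n%:R + 1)) in
      fun x => (Gamma_fun (n%:R - a))^-1 * derive1n n I x
  | right_side =>
      let I x := \int[mu]_(y in `[x, +oo[) (phi y / (y - x) `^ (a - n%:R + 1)) in
      fun x => (-1) ^+ n / Gamma_fun (n%:R - a) * derive1n n I x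
  end.

Definition is_weak_deriv k u v : Prop :=
  locally_integrable setT v /\
  forall phi, C0inf phi ->
    \int[mu]_x (v x * phi x) = (-1) ^+ k * \int[mu]_x (u x * derive1n k phi x).

Definition is_weak_frac_deriv s a u v : Prop :=
  locally_integrable setT v /\
  forall phi, C0inf phi ->
    \int[mu]_x (v x * phi x) =
    (-1) ^+ Num.truncn a *
      \int[mu]_x (u x * frac_deriv (opposite s) a phi x).

(* Weak derivatives are unique up to a.e. equality, so any choice is as good
   as any other; the value is meaningful only if a weak derivative exists. *)
Definition weak_deriv k u : R -> R :=
  xget (cst 0) [set v | is_weak_deriv k u v].

Definition weak_frac_deriv s a u : R -> R :=
  xget (cst 0) [set v | is_weak_frac_deriv s a u v].

Definition Lp p : set (R -> R) := [set u | u \in Lfun mu p%:E].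

Definition Lp_norm p u : \bar R := ('N[mu]_p%:E[EFin \o u])%E.

Definition Sobolev m p : set (R -> R) :=
  [set u | Lp p u /\
    forall k, (k <= m)%N -> exists2 v, is_weak_deriv k u v & Lp p v].

Definition Sobolev_norm m p u : \bar R :=
  ((\sum_(k < m.+1) Lp_norm p (weak_deriv k u) `^ p) `^ p^-1)%E.

Definition frac_Sobolev s a p : set (R -> R) :=
  [set u | Sobolev (Num.truncn a) p u /\
    exists2 v, is_weak_frac_deriv s a u v & Lp p v].

Definition frac_Sobolev_norm s a p u : \bar R :=
  ((Sobolev_norm (Num.truncn a) p u `^ p +
    Lp_norm p (weak_frac_deriv s a u) `^ p) `^ p^-1)%E.

Section completion.
Variables (N : (R -> R) -> \bar R) (X : set (R -> R)).
Implicit Types (S : set (R -> R)) (F G : nat -> R -> R).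

Definition dense_in S : Prop :=
  S `<=` X /\
  forall u, X u -> forall e : R, 0 < e ->
    exists2 f, S f & (N (u \- f)%R < e%:E)%E.

Definition cauchy_in S F : Prop :=
  (forall k, S (F k)) /\
  forall e : R, 0 < e -> exists K, forall j k, (K <= j)%N -> (K <= k)%N ->
    (N (F j \- F k)%R < e%:E)%E.

(* A point of the completion of X is a class of N-Cauchy sequences of X modulo
   sequences tending to 0 in N. As N only sees functions up to a.e. equality,
   this includes the passage to a.e. classes. *)
Definition cauchy_class F : set (nat -> R -> R) :=
  [set G | cauchy_in X G /\ (fun k => N (F k \- G k)) @ \oo --> 0%E].

(* The completion of a subspace S of X, as a subset of the completion of X: the
   classes which contain a Cauchy sequence of elements of S. *)
Definition completion S : set (set (nat -> R -> R)) :=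
  [set cauchy_class F | F in cauchy_in S].

(* X itself, as a subset of its completion. *)
Definition canonical_copy : set (set (nat -> R -> R)) :=
  [set cauchy_class (fun _ => u) | u in X].

End completion.

Definition frac_Sobolev_bar s a p : set (set (nat -> R -> R)) :=
  completion (frac_Sobolev_norm s a p) (frac_Sobolev s a p)
    (Cinf `&` frac_Sobolev s a p).

Definition frac_Sobolev_bar0 s a p : set (set (nat -> R -> R)) :=
  completion (frac_Sobolev_norm s a p) (frac_Sobolev s a p)
    (C0inf_side s `&` frac_Sobolev s a p).

End function_spaces.

(* Main.v *)
Require Import Defs.
From HB Require Import structures.
From mathcomp Require Import all_boot all_order all_algebra.
From mathcomp Require Import all_classical all_reals all_analysis.
From mathcomp Require Import measurable_realfun.
From mathcomp Require Import ring lra.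

Set Implicit Arguments.
Unset Strict Implicit.
Unset Printing Implicit Defensive.

Import Order.TTheory GRing.Theory Num.Theory.
Import numFieldNormedType.Exports.

Local Open Scope classical_set_scope.
Local Open Scope ring_scope.

(** Let m be the integer part of a. Splitting the kernel t^(m-a) into an
integrable head and a tail with integrable derivative, and integrating by parts
against the tail, turns the fractional derivative of a test function phi into
k1 * phi^(m+1) + k2 * phi^(m) with k1, k2 in L^1. By duality, a function with
weak derivatives of orders m and m+1 in L^p has a weak fractional derivative in
L^p, controlled by these two.

Mollification commutes with every weak derivative involved, hence converges in
the norm of the space; the mollified function is smooth with all its derivatives
in L^p, and multiplying it by chi(x/j) gives test functions converging to it in
W^(m+1,p), hence in the norm of the space by the bound above. Weak derivatives
are closed under L^p limits, so the space is complete and coincides with the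
completion of any subspace containing the test functions. *)

(** * Changes of variables *)

Section change_of_variables.
Context {R : realType}.
Local Notation mu := (@lebesgue_measure R).
Local Open Scope ereal_scope.

(** Fractional derivatives are nonlocal: they do not respect supports, so a cutoff cannot be moved
    past them by a Leibniz rule. The truncation is therefore estimated entirely on classical
    derivatives, at the price of one order more than the space provides, which only the mollified
    function supplies. The kernel itself is not integrable at infinity; its splitting is what makes
    the pairing of a fractional derivative of a test function with an arbitrary L^p function
    converge.

    Since [Rintegral] returns 0 on divergent integrals, every exchange of integrals has to be backed
    by absolute convergence. The class [dual] supplies it in the same way for all p, including p =
    1.

    The norm refers to weak derivatives selected by [xget]. Estimates are therefore stated through
    [controlled], which asks for some weak derivative with a bound, and almost everywhere uniqueness
    transfers them to the norm.

    Mollifications and cutoffs converge in L^p by one and the same criterion: convergence almost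
    everywhere, with norms not exceeding that of the limit. *)

Lemma lebesgue_measure_shift (a : R) (A : set R) : measurable A ->
  mu ((fun x => a + x)%R @^-1` A) = mu A.
Proof.
have mh : measurable_fun [set: measurableTypeR R]
    ((fun x : R => a + x)%R : _ -> measurableTypeR R).
  exact: measurable_funD.
pose h : {mfun measurableTypeR R >-> measurableTypeR R} :=
  HB.pack ((fun x : R => a + x)%R : measurableTypeR R -> measurableTypeR R)
    (isMeasurableFun.Build _ _ _ _ _ mh).
move=> mA; apply/esym.
(* Half-open intervals determine the measure, so only their translates have to be measured. *)
apply: (@lebesgue_measure_unique R (pushforward mu h)) => // X.
move=> [[i j] /= _ <-]; rewrite /pushforward.
rewrite (_ : _ @^-1` _ = `](i - a)%R, (j - a)%R]%classic); last first.
  by apply/seteqP; split => x /=; rewrite !in_itv/= => /andP[? ?]; apply/andP;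
    split; lra.
rewrite !lebesgue_measure_itv/= !lte_fin ltrD2r; case: ifPn => // _.
by rewrite -!EFinB opprB addrA subrK.
Qed.

Lemma ge0_integral_shift (a : R) (f : R -> \bar R) : measurable_fun setT f ->
  (forall x, 0 <= f x) -> \int[mu]_x f (a + x)%R = \int[mu]_x f x.
Proof.
move=> mf f0.
have mh : measurable_fun [set: measurableTypeR R]
    ((fun x : R => a + x)%R : _ -> measurableTypeR R).
  exact: measurable_funD.
rewrite -[LHS](@ge0_integral_pushforward _ _ _ _ _ _ mh lebesgue_measure setT f)//.
by apply: eq_measure_integral => A mA _; exact: (lebesgue_measure_shift a mA).
Qed.

Lemma ge0_integral_reflect (a : R) (f : R -> \bar R) : measurable_fun setT f ->
  (forall x, 0 <= f x) -> \int[mu]_x f (a - x)%R = \int[mu]_x f x.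
Proof.
move=> mf f0.
rewrite -[RHS](ge0_integral_shift a)//.
have mh : measurable_fun [set: measurableTypeR R]
    ((fun x : R => - x)%R : _ -> measurableTypeR R).
  exact: oppr_measurable.
have mfa : measurable_fun setT (fun x : R => f (a + x)%R).
  by apply: (measurableT_comp mf); exact: measurable_funD.
transitivity (\int[pushforward mu (-%R : _ -> measurableTypeR R)]_x f (a + x)%R).
  rewrite (@ge0_integral_pushforward _ _ _ _ _ _ mh lebesgue_measure setT (fun x => f (a + x)%R))//.
by apply: eq_measure_integral => A mA _; exact: lebesgue_measureN.
Qed.

(** Positive and negative parts keep their integrals separately, so the identity persists when one
    or both of them are infinite. *)
Lemma integral_shift (a : R) (f : R -> \bar R) : measurable_fun setT f ->
  \int[mu]_x f (a + x)%R = \int[mu]_x f x.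
Proof.
move=> mf; rewrite integralE [RHS]integralE; congr (_ - _).
- rewrite -[RHS](ge0_integral_shift a)//; last exact: measurable_funepos.
  by apply: eq_integral => x _; rewrite !funeposE.
- rewrite -[RHS](ge0_integral_shift a)//; last exact: measurable_funeneg.
  by apply: eq_integral => x _; rewrite !funenegE.
Qed.

Lemma integral_reflect (a : R) (f : R -> \bar R) : measurable_fun setT f ->
  \int[mu]_x f (a - x)%R = \int[mu]_x f x.
Proof.
move=> mf; rewrite integralE [RHS]integralE; congr (_ - _).
- rewrite -[RHS](ge0_integral_reflect a)//; last exact: measurable_funepos.
  by apply: eq_integral => x _; rewrite !funeposE.
- rewrite -[RHS](ge0_integral_reflect a)//; last exact: measurable_funeneg.
  by apply: eq_integral => x _; rewrite !funenegE.
Qed.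

Lemma Rintegral_shift (a : R) (f : R -> R) : measurable_fun setT f ->
  (\int[mu]_x f (a + x) = \int[mu]_x f x)%R.
Proof.
by move=> mf; congr fine; rewrite (integral_shift a (f := EFin \o f))//;
  exact/measurable_EFinP.
Qed.

Lemma Rintegral_reflect (a : R) (f : R -> R) : measurable_fun setT f ->
  (\int[mu]_x f (a - x) = \int[mu]_x f x)%R.
Proof.
by move=> mf; congr fine; rewrite (integral_reflect a (f := EFin \o f))//;
  exact/measurable_EFinP.
Qed.

End change_of_variables.

(** * Real-valued integrals and Fubini's theorem *)

Section Rintegral_facts.
Context {R : realType}.
Local Notation mu := (@lebesgue_measure R).
Local Open Scope ereal_scope.

Lemma ae_imply (P Q : R -> Prop) : (forall x, P x -> Q x) ->
  {ae mu, forall x, P x} -> {ae mu, forall x, Q x}.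
Proof. by move=> PQ; exact: (@filterS _ (almost_everywhere mu) (ae_filter_ringOfSetsType mu)). Qed.

Lemma integrable_absP (h : R -> R) : measurable_fun setT h ->
  \int[mu]_x `|h x|%:E < +oo -> mu.-integrable setT (EFin \o h).
Proof.
by move=> mh ?; apply/integrableP; split => //; exact/measurable_EFinP.
Qed.

Lemma integrable_abs_lty (h : R -> R) :
  mu.-integrable setT (EFin \o h) -> \int[mu]_x `|h x|%:E < +oo.
Proof. by move=> /integrableP[]. Qed.

Lemma integrable_measurable (h : R -> R) :
  mu.-integrable setT (EFin \o h) -> measurable_fun setT h.
Proof. by move=> /measurable_int/measurable_EFinP. Qed.

(** A finite extended integral has finite positive and negative parts, which makes [h] integrable;
    in all other cases [fine] returns 0. *)
Lemma Rintegral_not_integrable (h : R -> R) : measurable_fun setT h ->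
  ~ mu.-integrable setT (EFin \o h) -> (\int[mu]_x h x)%R = 0%R.
Proof.
move=> mh nh; rewrite /Rintegral.
have mEh : measurable_fun setT (EFin \o h) by exact/measurable_EFinP.
case: (boolP (\int[mu]_x (h x)%:E \is a fin_num)); last by rewrite fin_numEn => /orP[] /eqP ->.
rewrite integralE fin_numB => /andP[fp fn]; exfalso; apply: nh.
apply/integrableP; split => //.
rewrite -[fun x => _]/(abse \o (EFin \o h)) fune_abse ge0_integralD//.
- by rewrite lte_add_pinfty// ltey_eq ?fp ?fn.
- exact: measurable_funepos.
- exact: measurable_funeneg.
Qed.

(** The default value 0 makes homogeneity total: for nonzero [c], either both integrands are
    integrable or both integrals are 0. *)
Lemma RintegralMr (h : R -> R) (c : R) : measurable_fun setT h ->
  (\int[mu]_x (h x * c) = \int[mu]_x h x * c)%R.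
Proof.
move=> mh; have [->|c0] := eqVneq c 0%R.
  rewrite mulr0; under eq_Rintegral do rewrite mulr0.
  by rewrite /Rintegral integral0.
have [ih|ih] := pselect (mu.-integrable setT (EFin \o h)); first exact: RintegralZr.
rewrite !Rintegral_not_integrable ?mul0r//; first exact: measurable_funM.
move=> /(integrableZr measurableT c^-1) hc; apply: ih.
by apply: eq_integrable hc => // x _ /=; rewrite -EFinM mulfK.
Qed.

Lemma RintegralMl (h : R -> R) (c : R) : measurable_fun setT h ->
  (\int[mu]_x (c * h x) = c * \int[mu]_x h x)%R.
Proof.
by move=> mh; rewrite mulrC -RintegralMr//; under eq_Rintegral do rewrite mulrC.
Qed.

Lemma abs_Rintegral_le (h : R -> R) : measurable_fun setT h ->
  (`|\int[mu]_x h x|%R)%:E <= \int[mu]_x `|h x|%:E.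
Proof.
move=> mh.
have mEh : measurable_fun setT (EFin \o h) by exact/measurable_EFinP.
apply: le_trans (le_abse_integral mu measurableT mEh).
by rewrite /Rintegral; case: (\int[mu]_x _) => [r||]//=; rewrite normr0 leey.
Qed.

(** The inner real integrals take a default value on non-integrable slices. These slices form a null
    set, so the extended-real theorem carries over. *)
Lemma Rintegral_Fubini (f : R -> R -> R) :
  measurable_fun setT (fun z : R * R => f z.1 z.2) ->
  \int[mu]_y \int[mu]_x `|f x y|%:E < +oo ->
  (\int[mu]_x \int[mu]_y f x y = \int[mu]_y \int[mu]_x f x y)%R.
Proof.
move=> mf fy.
have mEf : measurable_fun setT (fun z : measurableTypeR R * measurableTypeR R =>
  (f z.1 z.2)%:E) by exact/measurable_EFinP.
have If : (mu \x mu).-integrable setT (fun z => (f z.1 z.2)%:E).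
  exact: (@integrable21ltyP _ _ _ _ R mu mu _ mEf).2.
congr fine; transitivity (\int[mu]_x \int[mu]_y (f x y)%:E).
  apply: ae_eq_integral => //.
  - apply/measurable_EFinP/measurableT_comp; first exact: fine_measurable.
    exact: (measurable_fubini_F If).
  - exact: (measurable_fubini_F If).
  - have := ae_integrable1 If; apply: filterS => x /= Ix _.
    by rewrite /Rintegral fineK//; exact: integrable_fin_num.
rewrite (Fubini If)/=; apply: ae_eq_integral => //.
- exact: (measurable_fubini_G If).
- apply/measurable_EFinP/measurableT_comp; first exact: fine_measurable.
  exact: (measurable_fubini_G If).
- have := ae_integrable2 If; apply: filterS => x /= Ix _.
  by rewrite /Rintegral fineK//; exact: integrable_fin_num.
Qed.

Lemma measurable_Rintegral2 (f : R -> R -> R) :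
  measurable_fun setT (fun z : R * R => f z.1 z.2) ->
  measurable_fun setT (fun x => \int[mu]_y f x y)%R.
Proof.
move=> mf.
have mEf : measurable_fun setT (fun z : measurableTypeR R * measurableTypeR R =>
  (f z.1 z.2)%:E) by exact/measurable_EFinP.
apply: measurableT_comp; first exact: fine_measurable.
rewrite [X in measurable_fun _ X](_ : _ = (fun x =>
  (\int[mu]_y (fun z => (f z.1 z.2)%:E)^\+ (x, y)) -
  (\int[mu]_y (fun z => (f z.1 z.2)%:E)^\- (x, y)))); last first.
  apply/funext => x; rewrite integralE; congr (_ - _).
    by apply: eq_integral => y _; rewrite !funeposE.
  by apply: eq_integral => y _; rewrite !funenegE.
apply: emeasurable_funB.
- apply: (@measurable_fun_fubini_tonelli_F _ _ _ _ _ mu) => //.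
  exact: measurable_funepos.
- apply: (@measurable_fun_fubini_tonelli_F _ _ _ _ _ mu) => //.
  exact: measurable_funeneg.
Qed.

Lemma measurable_diff2 d (T : measurableType d) (f : R -> T) :
  measurable_fun setT f -> measurable_fun setT (fun z : R * R => f (z.1 - z.2)%R).
Proof.
move=> mf; apply: (measurableT_comp mf).
by apply: measurable_funB.
Qed.

End Rintegral_facts.

(** * Elementary properties of the L^p norm *)

Section Lp_facts.
Context {R : realType}.
Variable p : R.
Hypothesis p1 : 1 <= p.
Local Notation mu := (@lebesgue_measure R).
Local Open Scope ereal_scope.
Implicit Types f g : R -> R.

Let p0 : (0 < p)%R. Proof. exact: lt_le_trans p1. Qed.
Let pn0 : p != 0%R. Proof. by rewrite gt_eqF. Qed.

Lemma LpP f : Lp p f <-> measurable_fun setT f /\ Lp_norm p f < +oo.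
Proof.
rewrite /Lp /Lp_norm/=; split.
  by move=> /andP[]; rewrite inE/= => mf; rewrite inE.
by move=> [mf fy]; apply/andP; split; rewrite inE.
Qed.

Lemma Lp_measurable f : Lp p f -> measurable_fun setT f.
Proof. by case/LpP. Qed.

Lemma Lp_norm_ge0 f : 0 <= Lp_norm p f.
Proof. exact: Lnorm_ge0. Qed.

Lemma Lp_norm_pow f : Lp_norm p f `^ p = \int[mu]_x (`|f x| `^ p)%:E.
Proof. by rewrite /Lp_norm poweR_Lnorm. Qed.

Lemma Lp_normE f : Lp_norm p f = (\int[mu]_x (`|f x| `^ p)%:E) `^ p^-1.
Proof.
rewrite -Lp_norm_pow -poweRrM mulfV// poweRe1//; exact: Lp_norm_ge0.
Qed.

Lemma poweR_lt_pinfty (x : \bar R) (r : R) : (0 < r)%R -> 0 <= x ->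
  (x `^ r < +oo) = (x < +oo).
Proof.
move=> r0; case: x => [x|//|//]; first by rewrite poweR_EFin !ltry.
by rewrite poweRyr// gt_eqF.
Qed.

Lemma Lp_intP f : Lp p f <->
  measurable_fun setT f /\ \int[mu]_x (`|f x| `^ p)%:E < +oo.
Proof.
by rewrite LpP -Lp_norm_pow poweR_lt_pinfty//; exact: Lp_norm_ge0.
Qed.

Lemma measurable_powR_abs d (T : measurableType d) (f : T -> R) : measurable_fun setT f ->
  measurable_fun setT (fun x => `|f x| `^ p)%R.
Proof.
move=> mf; apply: (@measurableT_comp _ _ _ _ _ _ (@powR R ^~ p)) => //.
exact: measurableT_comp.
Qed.

Lemma measurable_EFin_powR_abs f : measurable_fun setT f ->
  measurable_fun setT (fun x => (`|f x| `^ p)%:E).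
Proof. by move=> mf; exact/measurable_EFinP/measurable_powR_abs. Qed.

Lemma ae_eq_Lp_norm f g : measurable_fun setT f -> measurable_fun setT g ->
  {ae mu, forall x, f x = g x} -> Lp_norm p f = Lp_norm p g.
Proof.
move=> mf mg fg; rewrite !Lp_normE; apply: (congr1 (fun z => z `^ p^-1)).
apply: ae_eq_integral => //;
  [exact: measurable_EFin_powR_abs..|].
by apply: ae_imply fg => x /= ->.
Qed.

Lemma Lp_norm0 : Lp_norm p (cst 0%R) = 0.
Proof. by rewrite /Lp_norm Lnorm0// gt_eqF// lte_fin. Qed.

Lemma Lp_normD f g : measurable_fun setT f -> measurable_fun setT g ->
  Lp_norm p (f \+ g)%R <= Lp_norm p f + Lp_norm p g.
Proof. by move=> mf mg; exact: minkowski_EFin. Qed.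

Lemma Lp_normN f : Lp_norm p (\- f)%R = Lp_norm p f.
Proof.
by rewrite /Lp_norm -[in RHS]oppe_Lnorm.
Qed.

Lemma Lp_normB f g : measurable_fun setT f -> measurable_fun setT g ->
  Lp_norm p (f \- g)%R <= Lp_norm p f + Lp_norm p g.
Proof.
move=> mf mg; rewrite -(Lp_normN g); apply: (Lp_normD (g := \- g)%R) => //.
exact: measurableT_comp.
Qed.

Lemma Lp_normZ (c : R) f : measurable_fun setT f ->
  Lp_norm p (fun x => c * f x)%R = `|c|%:E * Lp_norm p f.
Proof.
move=> mf; rewrite !Lp_normE.
under eq_integral do rewrite normrM powRM// EFinM.
rewrite ge0_integralZl_EFin ?powR_ge0//; last first.
  exact: measurable_EFin_powR_abs.
rewrite poweRM ?integral_ge0//= ?lee_fin ?powR_ge0//.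
by rewrite -powRrM mulfV// powRr1.
Qed.

Lemma LpD f g : Lp p f -> Lp p g -> Lp p (f \+ g)%R.
Proof.
move=> /LpP[mf fy] /LpP[mg gy]; apply/LpP; split; first exact: measurable_funD.
by apply: le_lt_trans (Lp_normD mf mg) _; rewrite lte_add_pinfty.
Qed.

Lemma LpZ (c : R) f : Lp p f -> Lp p (fun x => c * f x)%R.
Proof.
move=> /LpP[mf fy]; apply/LpP; split; first exact: measurable_funM.
by rewrite Lp_normZ// lte_mul_pinfty// lee_fin.
Qed.

Lemma LpN f : Lp p f -> Lp p (\- f)%R.
Proof.
move=> /LpP[mf fy]; apply/LpP; split; first exact: measurableT_comp.
by rewrite Lp_normN.
Qed.

Lemma LpB f g : Lp p f -> Lp p g -> Lp p (f \- g)%R.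
Proof. by move=> fp gp; apply: (LpD (g := \- g)%R) => //; exact: LpN. Qed.

Lemma le_Lp_norm f g : measurable_fun setT f -> measurable_fun setT g ->
  (forall x, `|f x| <= `|g x|)%R -> Lp_norm p f <= Lp_norm p g.
Proof.
move=> mf mg fg; rewrite !Lp_normE.
apply: gt0_ler_poweR; rewrite ?invr_ge0 ?(ltW p0)//.
- by rewrite in_itv/= leey andbT integral_ge0// => x _; rewrite lee_fin powR_ge0.
- by rewrite in_itv/= leey andbT integral_ge0// => x _; rewrite lee_fin powR_ge0.
apply: ge0_le_integral => //.
- exact: measurable_EFin_powR_abs.
- exact: measurable_EFin_powR_abs.
by move=> x _; rewrite lee_fin ge0_ler_powR// ?nnegrE// ltW.
Qed.

Lemma Lp_norm_shift f (t : R) : measurable_fun setT f ->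
  Lp_norm p (fun x => f (x - t))%R = Lp_norm p f.
Proof.
move=> mf; rewrite !Lp_normE; apply: (congr1 (fun z => z `^ p^-1)).
have mF : measurable_fun setT (fun x => (`|f x| `^ p)%:E).
  exact: measurable_EFin_powR_abs.
apply: etrans (ge0_integral_shift (- t)%R mF _) => [|x]; last by rewrite lee_fin powR_ge0.
by apply: eq_integral => x _; rewrite addrC.
Qed.

Lemma Lp_shift f (t : R) : Lp p f -> Lp p (fun x => f (x - t))%R.
Proof.
move=> /LpP[mf fy]; apply/LpP; split; last by rewrite Lp_norm_shift.
by apply: (measurableT_comp mf); exact: measurable_funB.
Qed.

End Lp_facts.

(** * Convolution and duality *)

Section convolution.
Context {R : realType}.
Local Notation mu := (@lebesgue_measure R).
Local Open Scope ereal_scope.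
Implicit Types f g h k : R -> R.

Definition conv k f (x : R) : R := (\int[mu]_t (k t * f (x - t)))%R.

Local Notation L1 k := (mu.-integrable setT (EFin \o k)).

Definition L1norm k : R := (\int[mu]_t `|k t|)%R.

Lemma L1norm_ge0 k : (0 <= L1norm k)%R.
Proof. by apply: Rintegral_ge0. Qed.

Lemma L1normE k : L1 k -> \int[mu]_t `|k t|%:E = (L1norm k)%:E.
Proof.
move=> ik; rewrite /L1norm /Rintegral fineK//.
by rewrite ge0_fin_numE ?integral_ge0//; exact: integrable_abs_lty.
Qed.

Lemma measurable_conv_integrand k f : measurable_fun setT k ->
  measurable_fun setT f ->
  measurable_fun setT (fun z : R * R => k z.2 * f (z.1 - z.2))%R.
Proof.
move=> mk mf; apply: measurable_funM; last exact: measurable_diff2.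
exact: (measurableT_comp mk).
Qed.

Lemma measurable_slice f (x : R) : measurable_fun setT f ->
  measurable_fun setT (fun t : R => f (x - t)%R).
Proof.
by move=> mf; apply: (measurableT_comp mf); exact: measurable_funB.
Qed.

Lemma measurable_conv k f : measurable_fun setT k -> measurable_fun setT f ->
  measurable_fun setT (conv k f).
Proof.
by move=> mk mf; apply: measurable_Rintegral2; exact: measurable_conv_integrand.
Qed.

Lemma ge0_integral_conv k f : measurable_fun setT k -> measurable_fun setT f ->
  (forall t, 0 <= k t)%R -> (forall t, 0 <= f t)%R ->
  \int[mu]_x \int[mu]_t (k t * f (x - t))%:E =
  (\int[mu]_t (k t)%:E) * (\int[mu]_x (f x)%:E).
Proof.
move=> mk mf k0 f0.
rewrite (@fubini_tonelli _ _ _ _ _ mu mu (fun z => (k z.2 * f (z.1 - z.2))%:E))//=; first last.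
- by move=> z; rewrite lee_fin mulr_ge0.
- by apply/measurable_EFinP; exact: measurable_conv_integrand.
have mEk : measurable_fun setT (EFin \o k) by exact/measurable_EFinP.
have mEf : measurable_fun setT (EFin \o f) by exact/measurable_EFinP.
rewrite -ge0_integralZr//; first last.
- by apply: integral_ge0 => x _; rewrite lee_fin.
- by move=> x _; rewrite lee_fin.
apply: eq_integral => t _.
rewrite (_ : \int[mu]_x _ = \int[mu]_x ((k t)%:E * (f (- t + x)%R)%:E)); last first.
  by apply: eq_integral => x _; rewrite EFinM addrC.
rewrite ge0_integralZl_EFin//; [|by move=> x _; rewrite lee_fin|].
  congr (_ * _).
  by apply: (@ge0_integral_shift R (- t)%R (EFin \o f)) => // x; rewrite lee_fin.
by apply: (measurableT_comp mEf); exact: measurable_funD.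
Qed.

Lemma abs_conv_le k f (x : R) : measurable_fun setT k -> measurable_fun setT f ->
  `|conv k f x|%:E <= \int[mu]_t (`|k t| * `|f (x - t)|)%:E.
Proof.
move=> mk mf; apply: le_trans (abs_Rintegral_le _) _.
  by apply: measurable_funM => //; exact: measurable_slice.
by under eq_integral do rewrite normrM.
Qed.

Section weighted_powers.
Variable p : R.
Hypothesis p1 : (1 <= p)%R.

Let p0 : (0 < p)%R. Proof. exact: lt_le_trans p1. Qed.
Let pn0 : p != 0%R. Proof. by rewrite gt_eqF. Qed.

(** Jensen's inequality for the measure of density [k] and mass [A], proved by Hölder with the
    splitting of k h into k^(1/p) h and k^(1/q). For p = 1, where q would be infinite, both sides
    agree. *)
Lemma weighted_power_mean k h (A : R) : measurable_fun setT k ->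
  measurable_fun setT h -> (forall t, 0 <= k t)%R -> (forall t, 0 <= h t)%R ->
  \int[mu]_t (k t)%:E = A%:E ->
  (\int[mu]_t (k t * h t)%:E) `^ p <=
  (A `^ (p - 1))%:E * \int[mu]_t (k t * h t `^ p)%:E.
Proof.
move=> mk mh k0 h0 kA.
have A0 : (0 <= A)%R by rewrite -lee_fin -kA integral_ge0// => x _; rewrite lee_fin.
move: (p1); rewrite le_eqVlt => /predU1P[<-|pgt1].
  rewrite subrr powRr0 mul1e poweRe1; last first.
    by apply: integral_ge0 => x _; rewrite lee_fin mulr_ge0.
  by under [leRHS]eq_integral do rewrite powRr1//.
pose q := (p / (p - 1))%R.
have pm1 : (0 < p - 1)%R by rewrite subr_gt0.
have q0 : (0 < q)%R by rewrite divr_gt0.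
have pq : (p^-1 + q^-1 = 1)%R by rewrite /q invf_div; field; rewrite pn0.
have mkp r : measurable_fun setT (fun t => k t `^ r)%R.
  exact: (@measurableT_comp _ _ _ _ _ _ (@powR R ^~ r)).
have := @hoelder _ _ _ mu (fun t => k t `^ p^-1 * h t)%R (fun t => k t `^ q^-1)%R p q
  (measurable_funM (mkp _) mh) (mkp _) p0 q0 pq.
rewrite Lnorm1 => H.
have {}H : (\int[mu]_t (k t * h t)%:E) <=
  'N[mu]_p%:E[EFin \o (fun t => k t `^ p^-1 * h t)%R] *
  'N[mu]_q%:E[EFin \o (fun t => k t `^ q^-1)%R].
  apply: le_trans H; apply: ge0_le_integral => //.
  - by move=> t _; rewrite lee_fin mulr_ge0.
  - by apply/measurable_EFinP; exact: measurable_funM.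
  - apply: measurableT_comp => //; apply/measurable_EFinP.
    exact: (measurable_funM (measurable_funM (mkp _) mh) (mkp _)).
  move=> t _ /=; rewrite lee_fin mulrAC -powRD ?pq ?oner_eq0// powRr1//.
  exact: ler_norm.
have kh0 : 0 <= \int[mu]_t (k t * h t)%:E.
  by apply: integral_ge0 => t _; rewrite lee_fin mulr_ge0.
have := gt0_ler_poweR (ltW p0) _ _ H; rewrite !in_itv/= !leey !andbT.
move=> /(_ kh0 (mule_ge0 (Lnorm_ge0 _ _ _) (Lnorm_ge0 _ _ _))) /le_trans; apply.
rewrite poweRM ?Lnorm_ge0// muleC.
(* Raised to the power p = q (p - 1), the Hölder factor with exponent [q] becomes the mass [A] to
   the power p - 1. *)
have pE : p = (q * (p - 1))%R by rewrite /q -mulrA mulVf ?mulr1// gt_eqF.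
rewrite [X in _ `^ X * _]pE poweRrM !poweR_Lnorm ?gt_eqF//.
rewrite (_ : \int[mu]_x (`|(EFin \o (fun t => k t `^ q^-1)%R) x| `^ q) = A%:E); last first.
  rewrite -kA; apply: eq_integral => t _.
  by rewrite /= ger0_norm ?powR_ge0// -powRrM mulVf ?gt_eqF// powRr1.
rewrite poweR_EFin lee_wpmul2l ?lee_fin ?powR_ge0//.
rewrite le_eqVlt; apply/orP; left; apply/eqP; apply: eq_integral => t _ /=.
by rewrite ger0_norm ?mulr_ge0 ?powR_ge0// powRM ?powR_ge0// -powRrM mulVf// powRr1.
Qed.

(** Young's inequality: Jensen with weight [|k|] bounds [|conv k f|^p] pointwise, at the cost of p -
    1 powers of the L^1 norm of [k]; Tonelli contributes one more power, and a p-th root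
    concludes. *)
Lemma Lp_conv k f : L1 k -> Lp p f ->
  Lp p (conv k f) /\ Lp_norm p (conv k f) <= (L1norm k)%:E * Lp_norm p f.
Proof.
move=> ik /LpP[mf fy].
have mk := integrable_measurable ik.
have mak : measurable_fun setT (fun t => `|k t|)%R by exact: measurableT_comp.
have maf : measurable_fun setT (fun t => `|f t|)%R by exact: measurableT_comp.
have mafp := measurable_powR_abs p mf.
have mc : measurable_fun setT (conv k f) by exact: measurable_conv.
have A0 := L1norm_ge0 k.
have le_int : \int[mu]_x (`|conv k f x| `^ p)%:E <=
    ((L1norm k)%:E * Lp_norm p f) `^ p.
  apply: (@le_trans _ _ (\int[mu]_x ((L1norm k `^ (p - 1))%:E *
      \int[mu]_t (`|k t| * `|f (x - t)| `^ p)%:E))).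
    apply: ge0_le_integral => //.
    - exact: measurable_EFin_powR_abs.
    - apply: measurable_funeM.
      apply: (@measurable_fun_fubini_tonelli_F _ _ _ _ _ mu
        (fun z : R * R => (`|k z.2| * `|f (z.1 - z.2)| `^ p)%:E)).
        by apply/measurable_EFinP; exact: (measurable_conv_integrand mak mafp).
      by move=> z; rewrite lee_fin mulr_ge0// powR_ge0.
    move=> x _; rewrite -poweR_EFin.
    apply: le_trans (weighted_power_mean mak (measurable_slice x maf) _ _ (L1normE ik)) => //.
    apply: gt0_ler_poweR; rewrite ?in_itv/= ?leey ?andbT ?lee_fin ?(ltW p0)//.
    - by apply: integral_ge0 => t _; rewrite lee_fin mulr_ge0.
    - exact: abs_conv_le.
  rewrite ge0_integralZl_EFin ?powR_ge0//; first last.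
  - apply: (@measurable_fun_fubini_tonelli_F _ _ _ _ _ mu
        (fun z : R * R => (`|k z.2| * `|f (z.1 - z.2)| `^ p)%:E)).
      by apply/measurable_EFinP; exact: (measurable_conv_integrand mak mafp).
    by move=> z; rewrite lee_fin mulr_ge0// powR_ge0.
  - by move=> x _; apply: integral_ge0 => t _; rewrite lee_fin mulr_ge0// powR_ge0.
  rewrite (ge0_integral_conv mak mafp)//.
  rewrite L1normE// poweRM ?Lp_norm_ge0// Lp_norm_pow// muleA -EFinM.
  by rewrite (mulrC (powR _ _)) mulr_powRB1// poweR_EFin.
have le_norm : Lp_norm p (conv k f) <= (L1norm k)%:E * Lp_norm p f.
  rewrite Lp_normE//.
  have := gt0_ler_poweR _ _ _ le_int => /(_ p^-1%R).
  rewrite !in_itv/= !leey !andbT invr_ge0 (ltW p0) poweR_ge0 -poweRrM mulfV// poweRe1.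
    by apply => //; apply: integral_ge0 => x _; rewrite lee_fin powR_ge0.
  by rewrite mule_ge0// Lp_norm_ge0.
split => //; apply/LpP; split => //.
by apply: le_lt_trans le_norm _; rewrite lte_mul_pinfty// lee_fin.
Qed.

End weighted_powers.

End convolution.

(** * Duality pairings and adjoints of convolutions *)

Section pairing.
Context {R : realType}.
Local Notation mu := (@lebesgue_measure R).
Local Open Scope ereal_scope.
Implicit Types f g h k : R -> R.
Local Notation L1 k := (mu.-integrable setT (EFin \o k)).

Lemma convC k f : measurable_fun setT k -> measurable_fun setT f ->
  conv k f = conv f k.
Proof.
move=> mk mf; apply/funext => x; rewrite /conv.
rewrite -[RHS](Rintegral_reflect x); last first.
  by apply: measurable_funM => //; exact: measurable_slice.
by apply: eq_Rintegral => t _; rewrite mulrC subKr.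
Qed.

Variable p : R.
Hypothesis p1 : (1 <= p)%R.

(** The absolute value stands inside the integral, so that the bound also yields integrability of
    the product and can be fed to Tonelli. *)
Definition dual_bound (C : R) g := (0 <= C)%R /\
  forall f, Lp p f -> \int[mu]_x `|f x * g x|%:E <= C%:E * Lp_norm p f.

(* A substitute for membership in the dual exponent class, for which p = 1 needs no
   special treatment. *)
Definition dual g := measurable_fun setT g /\ exists C, dual_bound C g.

Lemma dual_integrable f g : Lp p f -> dual g -> L1 (fun x => f x * g x)%R.
Proof.
move=> fp [mg [C [C0 Cg]]]; have /LpP[mf fy] := fp.
apply: integrable_absP; first exact: measurable_funM.
by apply: le_lt_trans (Cg _ fp) _; rewrite lte_mul_pinfty// ?lee_fin.
Qed.

Lemma integral_shift_pairing f g (t : R) : measurable_fun setT f ->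
  measurable_fun setT g ->
  \int[mu]_x `|f x * g (x - t)|%:E = \int[mu]_x `|f (x - - t) * g x|%:E.
Proof.
move=> mf mg.
have mF : measurable_fun setT (fun x : R => `|f x * g (x - t)|%:E).
  apply: measurableT_comp => //; apply: measurableT_comp => //.
  by apply: measurable_funM => //; apply: (measurableT_comp mg); exact: measurable_funB.
apply/esym; apply: etrans (ge0_integral_shift t mF _) => //.
by apply: eq_integral => x _; rewrite opprK (addrC t) addrK.
Qed.

Lemma Rintegral_shift_pairing f g (t : R) : measurable_fun setT f ->
  measurable_fun setT g ->
  (\int[mu]_x (f x * g (x - t)) = \int[mu]_x (f (x - - t) * g x))%R.
Proof.
move=> mf mg.
have mF : measurable_fun setT (fun x : R => f x * g (x - t))%R.
  by apply: measurable_funM => //; apply: (measurableT_comp mg); exact: measurable_funB.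
apply/esym; apply: etrans (Rintegral_shift t mF) => //.
by apply: eq_Rintegral => x _; rewrite opprK (addrC t) addrK.
Qed.

Lemma dual_shift_bound g C (t : R) : measurable_fun setT g -> dual_bound C g ->
  dual_bound C (fun x => g (x - t)%R).
Proof.
move=> mg [C0 Cg]; split => // f fp; have mf := Lp_measurable fp.
rewrite integral_shift_pairing// -(Lp_norm_shift p1 (- t) mf).
by apply: Cg; exact: Lp_shift.
Qed.

Lemma dualD g h : dual g -> dual h -> dual (g \+ h)%R.
Proof.
move=> [mg [C [C0 Cg]]] [mh [D [D0 Dh]]]; split; first exact: measurable_funD.
exists (C + D)%R; split; first exact: addr_ge0.
move=> f fp; have mf := Lp_measurable fp.
rewrite EFinD ge0_muleDl ?lee_fin//.
apply: le_trans (leeD (Cg _ fp) (Dh _ fp)); rewrite -ge0_integralD//; first last.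
- by do 2 apply: measurableT_comp => //; exact: measurable_funM.
- by do 2 apply: measurableT_comp => //; exact: measurable_funM.
apply: ge0_le_integral => //.
- by do 2 apply: measurableT_comp => //; apply: measurable_funM => //; exact: measurable_funD.
- by apply: emeasurable_funD; do 2 apply: measurableT_comp => //; exact: measurable_funM.
- by move=> x _; rewrite -EFinD lee_fin mulrDr ler_normD.
Qed.

Lemma dualZ (c : R) g : dual g -> dual (fun x => c * g x)%R.
Proof.
move=> [mg [C [C0 Cg]]]; split; first exact: measurable_funM.
exists (`|c| * C)%R; split; first exact: mulr_ge0.
move=> f fp; have mf := Lp_measurable fp.
under eq_integral do rewrite mulrCA normrM EFinM.
rewrite ge0_integralZl_EFin//; last first.
  by do 2 apply: measurableT_comp => //; exact: measurable_funM.
by rewrite EFinM -muleA lee_wpmul2l// ?lee_fin// Cg.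
Qed.

Lemma measurable_triple k f g : measurable_fun setT k ->
  measurable_fun setT f -> measurable_fun setT g ->
  measurable_fun setT (fun z : R * R => k z.2 * (f z.1 * g (z.1 - z.2)))%R.
Proof.
move=> mk mf mg; apply: measurable_funM; first exact: (measurableT_comp mk).
by apply: measurable_funM; [exact: (measurableT_comp mf)|exact: measurable_diff2].
Qed.

(** Moving a translation from [g] onto [f] leaves the norm of [f] unchanged, so the inner integral
    is bounded uniformly up to the weight [|k t|]. This is the absolute convergence behind the
    exchange of integrals in [pairing_conv]. *)
Lemma triple_le k f g C : L1 k -> Lp p f -> measurable_fun setT g ->
  dual_bound C g ->
  \int[mu]_t \int[mu]_x `|k t * (f x * g (x - t))|%:E <=
  (L1norm k * C)%:E * Lp_norm p f.
Proof.
move=> ik fp mg Cg; have mf := Lp_measurable fp.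
have mk := integrable_measurable ik.
have [C0 _] := Cg.
have f0 := Lp_norm_ge0 p f.
apply: (@le_trans _ _ (\int[mu]_t (`|k t|%:E * (C%:E * Lp_norm p f)))).
  apply: ge0_le_integral => //.
  - by move=> t _; exact: integral_ge0.
  - apply: (@measurable_fun_fubini_tonelli_G _ _ _ _ _ mu
        (fun z : R * R => `|k z.2 * (f z.1 * g (z.1 - z.2))|%:E)) => //.
    by do 2 apply: measurableT_comp => //; exact: measurable_triple.
  - apply: emeasurable_funM => //.
    by do 2 apply: measurableT_comp => //.
  move=> t _; under eq_integral do rewrite normrM EFinM.
  rewrite ge0_integralZl_EFin//; last first.
    do 2 apply: measurableT_comp => //; apply: measurable_funM => //.
    by apply: (measurableT_comp mg); exact: measurable_funB.
  rewrite lee_wpmul2l ?lee_fin//.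
  by have [_] := dual_shift_bound t mg Cg; apply.
rewrite ge0_integralZr//; last 2 first.
- by do 2 apply: measurableT_comp => //.
- by rewrite mule_ge0// ?lee_fin.
by rewrite L1normE// EFinM muleA.
Qed.

Lemma triple_lty k f g : L1 k -> Lp p f -> dual g ->
  \int[mu]_t \int[mu]_x `|k t * (f x * g (x - t))|%:E < +oo.
Proof.
move=> ik fp [mg [C Cg]]; apply: le_lt_trans (triple_le ik fp mg Cg) _.
have [C0 _] := Cg; have /LpP[_ fy] := fp.
by rewrite lte_mul_pinfty// lee_fin mulr_ge0// L1norm_ge0.
Qed.

(** The analogue of Young's inequality for the dual class: Tonelli reduces it to the bound that is
    uniform over translates of [g]. *)
Lemma dual_conv k g : L1 k -> dual g -> dual (conv k g).
Proof.
move=> ik [mg [C Cg]]; have mk := integrable_measurable ik.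
split; first exact: measurable_conv.
have [C0 _] := Cg; exists (L1norm k * C)%R; split.
  by rewrite mulr_ge0// L1norm_ge0.
move=> f fp; apply: le_trans (triple_le ik fp mg Cg); have mf := Lp_measurable fp.
have mF : measurable_fun setT (fun z : R * R => `|k z.2 * (f z.1 * g (z.1 - z.2))|%:E).
  by do 2 apply: measurableT_comp => //; exact: measurable_triple.
rewrite -(@fubini_tonelli _ _ _ _ _ mu mu (fun z => `|k z.2 * (f z.1 * g (z.1 - z.2))|%:E))//=.
apply: ge0_le_integral => //.
- by do 2 apply: measurableT_comp => //; apply: measurable_funM => //; exact: measurable_conv.
- exact: (@measurable_fun_fubini_tonelli_F _ _ _ _ _ mu
    (fun z : R * R => `|k z.2 * (f z.1 * g (z.1 - z.2))|%:E)).
move=> x _; rewrite normrM EFinM.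
apply: le_trans (lee_wpmul2l _ (abs_conv_le x mk mg)) _; first by rewrite lee_fin.
rewrite -ge0_integralZl_EFin//; last first.
  apply/measurable_EFinP; apply: measurable_funM; first exact: measurableT_comp.
  by apply: measurableT_comp => //; exact: measurable_slice.
by under eq_integral do rewrite -EFinM mulrCA -!normrM.
Qed.

Lemma pairing_conv k f g : L1 k -> Lp p f -> dual g ->
  (\int[mu]_x (f x * conv k g x) =
   \int[mu]_t (k t * \int[mu]_x (f x * g (x - t))))%R.
Proof.
move=> ik fp dg; have [mg _] := dg; have mf := Lp_measurable fp.
have mk := integrable_measurable ik.
transitivity (\int[mu]_x \int[mu]_t (k t * (f x * g (x - t))))%R.
  apply: eq_Rintegral => x _; rewrite /conv -RintegralMl; last first.
    by apply: measurable_funM => //; exact: measurable_slice.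
  by apply: eq_Rintegral => t _; rewrite mulrCA.
rewrite (Rintegral_Fubini (measurable_triple mk mf mg) (triple_lty ik fp dg)).
apply: eq_Rintegral => t _; rewrite RintegralMl//.
by apply: measurable_funM => //; apply: (measurableT_comp mg); exact: measurable_funB.
Qed.

(** The translation has the opposite sign to the one in [pairing_conv]; comparing the two formulas
    identifies the adjoint of a convolution as the convolution with the reflected kernel. *)
Lemma conv_pairing k f g : L1 k -> Lp p f -> dual g ->
  (\int[mu]_x (conv k f x * g x) =
   \int[mu]_t (k t * \int[mu]_x (f x * g (x - - t))))%R.
Proof.
move=> ik fp dg; have [mg [C Cg]] := dg; have mf := Lp_measurable fp.
have mk := integrable_measurable ik.
have mF : measurable_fun setT (fun z : R * R => k z.2 * (f (z.1 - z.2) * g z.1))%R.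
  apply: measurable_funM; first exact: (measurableT_comp mk).
  by apply: measurable_funM; [exact: measurable_diff2|exact: (measurableT_comp mg)].
transitivity (\int[mu]_x \int[mu]_t (k t * (f (x - t) * g x)))%R.
  apply: eq_Rintegral => x _; rewrite /conv -RintegralMr; last first.
    by apply: measurable_funM => //; exact: measurable_slice.
  by apply: eq_Rintegral => t _; rewrite mulrA.
rewrite (Rintegral_Fubini mF).
  apply: eq_Rintegral => t _; rewrite RintegralMl; last first.
    apply: measurable_funM => //; apply: (measurableT_comp mf); exact: measurable_funB.
  by rewrite Rintegral_shift_pairing// opprK.
have /LpP[_ fy] := fp.
have [C0 Cgf] := Cg; apply: (@le_lt_trans _ _ (\int[mu]_t (`|k t|%:E * (C%:E * Lp_norm p f)))).
  apply: ge0_le_integral => //.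
  - by move=> t _; exact: integral_ge0.
  - apply: (@measurable_fun_fubini_tonelli_G _ _ _ _ _ mu
        (fun z : R * R => `|k z.2 * (f (z.1 - z.2) * g z.1)|%:E)) => //.
    by do 2 apply: measurableT_comp => //.
  - apply: emeasurable_funM => //.
    by do 2 apply: measurableT_comp => //.
  move=> t _; under eq_integral do rewrite normrM EFinM.
  rewrite ge0_integralZl_EFin//; last first.
    do 2 apply: measurableT_comp => //; apply: measurable_funM => //.
    by apply: (measurableT_comp mf); exact: measurable_funB.
  rewrite lee_wpmul2l ?lee_fin// -(Lp_norm_shift p1 t mf).
  by apply: Cgf; exact: Lp_shift.
rewrite ge0_integralZr//; last 2 first.
- by do 2 apply: measurableT_comp => //.
- by rewrite mule_ge0// ?lee_fin// Lp_norm_ge0.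
by rewrite L1normE// lte_mul_pinfty// ?lee_fin ?L1norm_ge0// lte_mul_pinfty// lee_fin.
Qed.

End pairing.

(** * Smooth functions *)

Section smooth_functions.
Context {R : realType}.
Implicit Types (f g : R -> R) (a b x : R) (j k m : nat).

Lemma is_derive_derive1 f x : derivable f x 1 -> is_derive x 1 f ((derive1 f) x).
Proof. by move=> df; rewrite derive1E; exact: derivableP. Qed.

Lemma is_derive_derive1E f x a : is_derive x 1 f a -> (derive1 f) x = a.
Proof. by move=> [df <-]; rewrite derive1E. Qed.

Lemma is_derive_derivable f x a : is_derive x 1 f a -> derivable f x 1.
Proof. by case. Qed.

Lemma derive1n_derive1n f j k : derive1n k (derive1n j f) = (derive1n (k + j) f).
Proof. by rewrite /derive1n iterD. Qed.

(** Order [k] is included, so members have k + 1 derivatives and [Ck 0] is differentiability. The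
    finite order provides the induction for products and affine substitutions. *)
Variant Ck k f : Prop :=
  Ck_intro of forall j, (j <= k)%N -> forall x, derivable (derive1n j f) x 1.

Lemma CkE k f : Ck k f -> forall j, (j <= k)%N ->
  forall x, derivable (derive1n j f) x 1.
Proof. by case. Qed.

Lemma Cinf_Ck f : Cinf f <-> forall k, Ck k f.
Proof.
split => [cf k|cf k x]; first by split => j _ x; exact: cf.
exact: (CkE (cf k) (leqnn k)).
Qed.

Lemma Ck_derivable k f : Ck k f -> forall x, derivable f x 1.
Proof. by move=> cf x; exact: (CkE cf (leq0n k)). Qed.

Lemma Ck0 f : Ck 0 f <-> forall x, derivable f x 1.
Proof.
split=> [|df]; first exact: Ck_derivable.
by split => j; rewrite leqn0 => /eqP ->.
Qed.

Lemma CkS k f : Ck k.+1 f <-> (forall x, derivable f x 1) /\ Ck k (derive1 f).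
Proof.
split => [cf|[df cf]].
  split; first exact: Ck_derivable cf.
  by split => j jk x; rewrite -derive1Sn; exact: (CkE cf).
split => -[_ x|j jk x]; first exact: df.
by rewrite derive1Sn; exact: (CkE cf).
Qed.

Lemma CkW k f : Ck k.+1 f -> Ck k f.
Proof. by move=> cf; split => j jk x; apply: (CkE cf); exact: leqW. Qed.

Lemma derive1D f g : (forall x, derivable f x 1) -> (forall x, derivable g x 1) ->
  derive1 (f \+ g) = (derive1 f) \+ (derive1 g).
Proof.
by move=> df dg; apply/funext => x; rewrite /= !derive1E deriveD.
Qed.

Lemma derive1_mul f g : (forall x, derivable f x 1) -> (forall x, derivable g x 1) ->
  derive1 (f \* g) = ((derive1 f) \* g) \+ (f \* (derive1 g)).
Proof.
move=> df dg; apply/funext => x.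
by rewrite /= !derive1E deriveM// addrC mulrC.
Qed.

Lemma derive1_scale c f : (forall x, derivable f x 1) ->
  derive1 (fun x => c * f x) = (fun x => c * (derive1 f) x).
Proof.
move=> df; apply/funext => x.
by apply: is_derive_derive1E; apply: is_deriveZ; exact: is_derive_derive1.
Qed.

Lemma derive1_cst0 c : derive1 (cst c) = cst 0 :> (R -> R).
Proof. by apply/funext => x; exact: derive1_cst. Qed.

Lemma Ck_cst k c : Ck k (cst c).
Proof.
elim: k c => [c|k ih c]; first by apply/Ck0 => x; exact: derivable_cst.
apply/CkS; split; first by move=> x; exact: derivable_cst.
by rewrite derive1_cst0; exact: ih.
Qed.

Lemma CkD k f g : Ck k f -> Ck k g -> Ck k (f \+ g).
Proof.
elim: k f g => [f g /Ck0 df /Ck0 dg|k ih f g /CkS[df cf] /CkS[dg cg]].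
  by apply/Ck0 => x; exact: derivableD.
apply/CkS; split; first by move=> x; exact: derivableD.
by rewrite (derive1D df dg); exact: (ih _ _ cf cg).
Qed.

Lemma CkM k f g : Ck k f -> Ck k g -> Ck k (f \* g).
Proof.
elim: k f g => [f g /Ck0 df /Ck0 dg|k ih f g cf cg].
  by apply/Ck0 => x; exact: derivableM.
have /CkS[df cf1] := cf; have /CkS[dg cg1] := cg.
apply/CkS; split; first by move=> x; exact: derivableM.
by rewrite (derive1_mul df dg); exact: CkD (ih _ _ cf1 (CkW cg)) (ih _ _ (CkW cf) cg1).
Qed.

Lemma derivable_affine f a b x : derivable f (a * x + b) 1 ->
  is_derive x 1 (fun x => f (a * x + b)) (a * (derive1 f) (a * x + b)).
Proof.
move=> df.
have h : is_derive x 1 (fun x => a * x + b) a.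
  have : is_derive x (1 : R) ((a \*: (@id R)) + cst b) (a *: 1 + 0) by exact: is_deriveD.
  by rewrite addr0 /GRing.scale/= mulr1.
have fd := is_derive_derive1 df.
rewrite mulrC; exact: (@is_derive1_comp _ f _ x _ _ fd h).
Qed.

Lemma Ck_affine k f a b : Ck k f -> Ck k (fun x => f (a * x + b)).
Proof.
elim: k f => [f /Ck0 df|k ih f /CkS[df cf]].
  by apply/Ck0 => x; exact: is_derive_derivable (derivable_affine _).
apply/CkS; split; first by move=> x; exact: is_derive_derivable (derivable_affine _).
rewrite (_ : derive1 _ = (cst a \* (fun x => (derive1 f) (a * x + b)))).
  by apply: CkM; [exact: Ck_cst|exact: (ih _ cf)].
by apply/funext => x; exact: is_derive_derive1E (derivable_affine _).
Qed.

Lemma derive1_affine f a b : (forall x, derivable f x 1) ->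
  derive1 (fun x => f (a * x + b)) = (fun x => a * derive1 f (a * x + b)).
Proof.
by move=> df; apply/funext => x; exact: is_derive_derive1E (derivable_affine _).
Qed.

Lemma CinfS f : Cinf f <-> (forall x, derivable f x 1) /\ Cinf (derive1 f).
Proof.
rewrite !Cinf_Ck; split => [cf|[df cf] [|k]].
- split => [x|k]; first exact: (Ck_derivable (cf 0)).
  by have /CkS[] := cf k.+1.
- exact/Ck0.
- exact/CkS.
Qed.

Lemma Cinf_derivable f : Cinf f -> forall x, derivable f x 1.
Proof. by move=> /CinfS[]. Qed.

Lemma Cinf_derive1n k f : Cinf f -> Cinf (derive1n k f).
Proof. by move=> cf j x; rewrite derive1n_derive1n; exact: cf. Qed.

Lemma CinfM f g : Cinf f -> Cinf g -> Cinf (f \* g).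
Proof. by move=> /Cinf_Ck cf /Cinf_Ck cg; apply/Cinf_Ck => k; exact: CkM. Qed.

Lemma Cinf_cst c : Cinf (cst c : R -> R).
Proof. by apply/Cinf_Ck => k; exact: Ck_cst. Qed.

Lemma CinfZ c f : Cinf f -> Cinf (fun x => c * f x).
Proof. by move=> cf; apply: (CinfM _ cf); exact: Cinf_cst. Qed.

Lemma Cinf_affine f a b : Cinf f -> Cinf (fun x => f (a * x + b)).
Proof. by move=> /Cinf_Ck cf; apply/Cinf_Ck => k; exact: Ck_affine. Qed.

Lemma derive1nD k f g : Cinf f -> Cinf g ->
  derive1n k (f \+ g) = derive1n k f \+ derive1n k g.
Proof.
move=> cf cg; elim: k => [|k ih]; first by [].
by rewrite !derive1nS ih derive1D.
Qed.

Lemma derive1nZ k c f : Cinf f ->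
  derive1n k (fun x => c * f x) = (fun x => c * derive1n k f x).
Proof.
move=> cf; elim: k => [|k ih]; first by [].
by rewrite derive1nS ih derive1_scale.
Qed.

Lemma derive1n_affine k f a b : Cinf f ->
  derive1n k (fun x => f (a * x + b)) = (fun x => a ^+ k * derive1n k f (a * x + b)).
Proof.
move=> cf; elim: k => [|k ih].
  by apply/funext => x; rewrite expr0 mul1r.
rewrite derive1nS ih derive1_scale; last first.
  by apply: Cinf_derivable; apply: Cinf_affine; exact: Cinf_derive1n.
by rewrite derive1_affine//; apply/funext => x; rewrite exprSr mulrA.
Qed.

Lemma Cinf_continuous f : Cinf f -> continuous f.
Proof.
move=> cf x; apply: differentiable_continuous; apply/derivable1_diffP.
exact: Cinf_derivable.
Qed.

Lemma Cinf_measurable f : Cinf f -> measurable_fun setT f.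
Proof. by move=> cf; apply: continuous_measurable_fun; exact: Cinf_continuous. Qed.

Definition supp_bound f (B : R) := forall x, B <= `|x| -> f x = 0.

Lemma C0infP f : C0inf f <-> Cinf f /\ exists2 B, 0 < B & supp_bound f B.
Proof.
split => [[cf cpt]|[cf [B B0 fB]]]; split => //.
  have [M [Mr MB]] := compact_bounded cpt.
  exists (`|M| + 1) => [|x Mx]; first by rewrite ltr_wpDl.
  apply: contrapT => /eqP fx.
  have /= := MB (`|M| + 2^-1) _ x (@subset_closure _ [set x | f x != 0] x fx).
  have : M <= `|M| by exact: ler_norm.
  move=> MM; have -> : (M < `|M| + 2^-1) by lra.
  by move=> /(_ isT) xM; move: Mx xM; lra.
apply: (subclosed_compact _ (@segment_compact _ (- B) B)); first exact: closed_closure.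
rewrite [X in _ `<=` X](_ : _ = closure `[- B, B]); last first.
  by apply/closure_id; exact: itv_closed.
apply: closureS => x /= fx.
rewrite in_itv/= -ler_norml leNgt; apply/negP => Bx.
by move: fx; rewrite fB ?eqxx// ltW.
Qed.

(** The margin 1 gives each such point a unit ball on which [f] vanishes, so the derivative is that
    of a constant. *)
Lemma supp_bound_derive1 f B : supp_bound f B -> supp_bound (derive1 f) (B + 1).
Proof.
move=> fB x Bx; apply: is_derive_derive1E.
have nz : \forall y \near x, cst 0 y = f y.
  near=> y; rewrite fB//=.
  have : `|x - y| < 1 by near: y; exact: (@nbhsx_ballx _ _ x 1 ltr01).
  by have := ler_distD y x 0; rewrite !subr0; lra.
exact: (near_eq_is_derive nz (is_derive_cst _ _ _)).
Unshelve. all: by end_near.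
Qed.

Lemma C0inf_derive1n k f : C0inf f -> C0inf (derive1n k f).
Proof.
move=> /C0infP[cf [B B0 fB]]; apply/C0infP; split; first exact: Cinf_derive1n.
exists (B + k%:R); first by rewrite ltr_wpDr.
elim: k => [|k ih]; first by rewrite addr0.
by rewrite derive1nS -natr1 addrA; exact: supp_bound_derive1.
Qed.

Lemma C0infM f g : C0inf f -> Cinf g -> C0inf (f \* g).
Proof.
move=> /C0infP[cf [B B0 fB]] cg; apply/C0infP; split; first exact: CinfM.
by exists B => // x /fB /= ->; rewrite mul0r.
Qed.

Lemma C0infZ c f : C0inf f -> C0inf (fun x => c * f x).
Proof.
move=> /C0infP[cf [B B0 fB]]; apply/C0infP; split; first exact: CinfZ.
by exists B => // x /fB /= ->; rewrite mulr0.
Qed.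

Lemma C0inf_affine f a b : a != 0 -> C0inf f -> C0inf (fun x => f (a * x + b)).
Proof.
move=> a0 /C0infP[cf [B B0 fB]]; apply/C0infP; split; first exact: Cinf_affine.
have na0 : 0 < `|a| by rewrite normr_gt0.
exists ((B + `|b|) / `|a|) => [|x]; first by rewrite divr_gt0// ltr_wpDr.
rewrite ler_pdivrMr// -normrM => h; apply: fB.
by have := ler_normB (x * a + b) b; rewrite addrK (mulrC a); lra.
Qed.

Lemma C0inf_shift f (t : R) : C0inf f -> C0inf (fun x => f (x - t)).
Proof.
move=> cf; rewrite (_ : (fun x => _) = (fun x => f (1 * x + (- t)))).
  by apply: C0inf_affine => //; exact: oner_neq0.
by apply/funext => x; rewrite mul1r.
Qed.

Lemma derive1n_shift k f (t : R) : Cinf f ->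
  derive1n k (fun x => f (x - t)) = (fun x => derive1n k f (x - t)).
Proof.
move=> cf; rewrite (_ : (fun x => _) = (fun x => f (1 * x + (- t)))).
  by rewrite derive1n_affine//; apply/funext => x; rewrite expr1n !mul1r.
by apply/funext => x; rewrite mul1r.
Qed.

Lemma C0inf_Cinf f : C0inf f -> Cinf f.
Proof. by case. Qed.

Lemma continuous_supp_bounded f B : continuous f -> supp_bound f B ->
  exists2 M, 0 <= M & forall x, `|f x| <= M.
Proof.
move=> cf fB; have [M [Mr MB]] : [bounded f x | x in `[- B, B]].
  have := @compact_bounded _ _ (f @` `[- B, B]).
  have cK : compact (f @` `[- B, B]).
    by apply: continuous_compact; [exact: continuous_subspaceT|exact: segment_compact].
  move=> /(_ cK)[M [Mr MB]]; exists M; split => // N MN x xB.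
  by apply: (MB N MN); exists x.
exists (`|M| + 1) => [|x]; first by rewrite ltW// ltr_wpDl.
have [Bx|xB] := leP B `|x|; first by rewrite fB// normr0 ltW// ltr_wpDl.
apply: MB; first by have := ler_norm M; lra.
by rewrite /= in_itv/= -ler_norml ltW.
Qed.

Lemma C0inf_bounded f : C0inf f -> exists2 M, 0 <= M & forall x, `|f x| <= M.
Proof.
move=> /C0infP[cf [B _ fB]]; apply: continuous_supp_bounded fB.
exact: Cinf_continuous.
Qed.

End smooth_functions.

(** * A bump function *)

Section flat_functions.
Context {R : realType}.
Implicit Types (q : {poly R}) (x y h : R).

(** Carrying a polynomial in 1/x makes the family of flat functions stable under differentiation,
    which replaces [q] by X^2 (q - q'). *)
Definition flat q x : R := if 0 < x then q.[x^-1] * expR (- x^-1) else 0.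

Lemma flat_le0 q x : x <= 0 -> flat q x = 0.
Proof. by rewrite /flat ltNge => ->. Qed.

Lemma horner_norm_le q y : 1 <= y ->
  `|q.[y]| <= (\sum_(i < size q) `|q`_i|) * y ^+ size q.
Proof.
move=> y1; rewrite horner_coef (le_trans (ler_norm_sum _ _ _))// mulr_suml.
apply: ler_sum => i _; rewrite normrM ler_wpM2l// ger0_norm; last first.
  by rewrite exprn_ge0// (le_trans _ y1).
by rewrite ler_weXn2l// ltnW.
Qed.

Lemma flat_quadratic q : exists2 M, 0 <= M & forall h, `|h| <= 1 -> `|flat q h| <= M * h ^+ 2.
Proof.
pose s : R := \sum_(i < size q) `|q`_i|.
have s0 : 0 <= s by exact: sumr_ge0.
pose n := size q; exists (s * n.+2`!%:R) => [|h h1]; first exact: mulr_ge0.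
have [h0|h0] := ltP 0 h; last first.
  by rewrite flat_le0// normr0; apply: mulr_ge0; [exact: mulr_ge0|exact: sqr_ge0].
rewrite /flat h0; set y := h^-1.
have y1 : 1 <= y by rewrite /y invf_ge1// (le_trans (ler_norm _)).
have y0 : 0 < y by rewrite (lt_le_trans _ y1).
rewrite normrM (ger0_norm (expR_ge0 _)).
(* The term of degree n + 2 of the exponential series beats the growth y^n of [q] with two powers to
   spare; these become h^2. *)
have le1 : expR (- y) <= n.+2`!%:R * y ^- n.+2.
  rewrite expRN -[leRHS]invrK lef_pV2 ?posrE ?expR_gt0//; last first.
    by rewrite invr_gt0 mulr_gt0 ?ltr0n ?fact_gt0// invr_gt0 exprn_gt0.
  rewrite invfM invrK mulrC; apply: le_trans (expR_ge1Dxn n.+1 (ltW y0)).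
  by rewrite lerDr.
apply: le_trans (ler_pM (normr_ge0 _) (expR_ge0 _) (horner_norm_le q y1) le1) _.
have hy : h = y^-1 by rewrite /y invrK.
have -> : h ^+ 2 = y ^- 2 by rewrite hy exprVn.
rewrite -/s -/n -[n.+2]addn2 exprD le_eqVlt; apply/orP; left; apply/eqP.
have yn0 : y != 0 by rewrite gt_eqF.
move: (expf_neq0 n yn0) (expf_neq0 2 yn0).
move: (y ^+ n) (y ^+ 2) (_%:R) => Y Z F Y0 Z0.
by rewrite invfM mulrACA -!mulrA (mulrC _ Z^-1) (mulrCA Y) mulfV// mulr1.
Qed.

Lemma is_derive_quadratic (f : R -> R) (M : R) : 0 <= M ->
  (forall h, `|h| <= 1 -> `|f h| <= M * h ^+ 2) -> is_derive (0 : R) 1 f 0.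
Proof.
move=> M0 fM.
have f00 : f 0 = 0.
  by apply/eqP; rewrite -normr_le0 (le_trans (fM _ _))// ?normr0// expr0n mulr0.
have cv : (h^-1 *: ((f \o shift 0) (h *: 1) - f 0)) @[h --> (0:R)^'] --> (0:R).
  apply/cvgrPdist_le => /= e e0; near=> h.
  rewrite sub0r normrN f00 subr0 addr0 /GRing.scale/= mulr1 normrM normfV.
  have hn0 : h != 0 by near: h; exact: nbhs_dnbhs_neq.
  have h1 : `|h| <= 1 by near: h; exact: dnbhs0_le.
  have he : `|h| <= e / (M + 1).
    by near: h; apply: dnbhs0_le; rewrite divr_gt0// ltr_wpDl.
  rewrite ler_pdivrMl ?normr_gt0//; apply: le_trans (fM _ h1) _.
  rewrite -(real_normK (num_real h)) expr2 mulrCA ler_wpM2l//.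
  move: he; rewrite ler_pdivlMr ?ltr_wpDl// => he.
  have : 0 <= `|h| by []. lra.
apply: DeriveDef; first by apply/cvg_ex; exists 0.
exact/cvg_lim.
Unshelve. all: by end_near.
Qed.

(** Away from 0 this is local constancy or the chain rule; at 0 the quadratic bound forces the
    derivative to be 0. *)
Lemma is_derive_flat q x : is_derive x 1 (flat q) (flat ('X ^+ 2 * (q - q^`())) x).
Proof.
have [x0|x0|->] := ltgtP x 0.
- rewrite flat_le0 ?ltW//.
  have nz : \forall y \near x, cst 0 y = flat q y.
    by near=> y; rewrite flat_le0// ltW//; near: y; exact: lt_nbhsl.
  exact: (near_eq_is_derive nz (is_derive_cst _ _ _)).
- have nz : \forall y \near x, q.[y^-1] * expR (- y^-1) = flat q y.
    near=> y; rewrite /flat ifT//; near: y; exact: lt_nbhsr.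
  apply: (near_eq_is_derive nz).
  have xn0 : x != 0 by rewrite gt_eqF.
  have dV : is_derive x (1 : R) (fun y : R => y^-1) (- x ^- 2).
    have dx : derivable (@id R) x 1 by exact: derivable_id.
    apply: DeriveDef; first exact: derivableV.
    by rewrite deriveV// derive_id /GRing.scale/= mulr1.
  have dq := is_derive1_comp (is_derive_poly q x^-1) dV.
  have de := @is_derive1_comp _ expR (fun y => - y^-1) x _ _ (is_derive_expR _) (is_deriveN dV).
  apply: (is_derive_eq (is_deriveM dq de)).
  rewrite /flat x0 /= !hornerE /GRing.scale/= exprVn; ring.
- rewrite flat_le0//.
  have [M M0 fM] := flat_quadratic q; exact: is_derive_quadratic fM.
Unshelve. all: by end_near.
Qed.

Lemma Cinf_flat q : Cinf (flat q).
Proof.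
apply/Cinf_Ck => k; elim: k q => [|k ih] q.
  by apply/Ck0 => x; exact: is_derive_derivable (is_derive_flat q x).
apply/CkS; split; first by move=> x; exact: is_derive_derivable (is_derive_flat q x).
rewrite (_ : derive1 _ = flat ('X ^+ 2 * (q - q^`()))); first exact: ih.
by apply/funext => x; exact: is_derive_derive1E (is_derive_flat q x).
Qed.

Definition bump x : R := flat 1 (1 + x) * flat 1 (1 - x).

Lemma flat1_ge0 x : 0 <= flat 1 x.
Proof. by rewrite /flat; case: ifP => // _; rewrite hornerC mul1r expR_ge0. Qed.

Lemma flat1_le1 x : flat 1 x <= 1.
Proof.
rewrite /flat; case: ifP => // x0; rewrite hornerC mul1r expR_le1 oppr_le0.
by rewrite invr_ge0 ltW.
Qed.

Lemma bump_ge0 x : 0 <= bump x.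
Proof. by rewrite mulr_ge0// flat1_ge0. Qed.

Lemma bump_le1 x : bump x <= 1.
Proof. by rewrite mulr_ile1 ?flat1_ge0 ?flat1_le1. Qed.

Lemma supp_bound_bump : supp_bound bump 1.
Proof.
move=> x; rewrite ler_normr => /orP[] h; rewrite /bump.
  by rewrite (@flat_le0 _ (1 - x)) ?mulr0//; lra.
by rewrite (@flat_le0 _ (1 + x)) ?mul0r//; lra.
Qed.

Lemma Cinf_bump : Cinf bump.
Proof.
rewrite (_ : bump = (fun x => flat 1 (1 * x + 1)) \* (fun x => flat 1 (- 1 * x + 1))).
  by apply: CinfM; apply: Cinf_affine; exact: Cinf_flat.
by apply/funext => x; rewrite /= mul1r mulN1r /bump (addrC x) (addrC (- x)).
Qed.

Lemma C0inf_bump : C0inf bump.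
Proof.
by apply/C0infP; split; [exact: Cinf_bump|exists 1 => //; exact: supp_bound_bump].
Qed.

(** Both 1 + x and 1 - x are at least 1/2, where each factor is at least e^(-2). The bound serves to
    keep the mass of the dilated bumps from being too small. *)
Lemma bump_lower x : `|x| <= 2^-1 -> expR (- 4) <= bump x.
Proof.
have le y : 2^-1 <= y -> expR (- 2) <= flat 1 y.
  move=> hy; have y0 : 0 < y by rewrite (lt_le_trans _ hy).
  rewrite /flat y0 hornerC mul1r ler_expR lerN2 -[leRHS]invrK.
  by rewrite lef_pV2 ?posrE// invr_gt0.
rewrite ler_norml => /andP[x1 x2].
have -> : (- 4 : R) = - 2 + - 2 by lra.
rewrite expRD; apply: ler_pM; rewrite ?expR_ge0//; apply: le; lra.
Qed.

End flat_functions.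

(** * Limits in Lp *)

Section limits_of_integrals.
Context {R : realType}.
Local Notation mu := (@lebesgue_measure R).
Local Open Scope ereal_scope.

(** A bound on the integrals at arbitrarily late indices already bounds their lower limit; this form
    suits arguments by contradiction, where the bound holds only infinitely often. *)
Lemma ae_fatou (h : nat -> R -> \bar R) (h' : R -> \bar R) (M : \bar R) :
  (forall j, measurable_fun setT (h j)) -> (forall j x, 0 <= h j x) ->
  measurable_fun setT h' ->
  {ae mu, forall x, h j x @[j --> \oo] --> h' x} ->
  (forall N, exists2 j, (N <= j)%N & \int[mu]_x h j x <= M) ->
  \int[mu]_x h' x <= M.
Proof.
move=> mh h0 mh' hh' often.
have -> : \int[mu]_x h' x = \int[mu]_x limn_einf (h ^~ x).
  apply: ae_eq_integral => //.
    rewrite /limn_einf; apply: measurableT_comp => //.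
    apply: measurable_fun_limn_esup => j.
    by apply: (measurableT_comp _ (mh j)); exact: oppe_measurable.
  by apply: ae_imply hh' => x /cvg_limn_einf_sup[-> _] _.
apply: (le_trans (fatou mu measurableT mh (fun j x _ => h0 j x))).
rewrite limn_einf_lim; apply: lime_le; first exact: is_cvg_einfs.
apply: nearW => N; have [j Nj jM] := often N.
by apply: le_trans jM; apply: ereal_inf_lbound; exists j.
Qed.

End limits_of_integrals.

Section Lp_limits.
Context {R : realType}.
Variable p : R.
Hypothesis p1 : 1 <= p.
Local Notation mu := (@lebesgue_measure R).
Implicit Types f g : R -> R.

Let p0 : 0 < p. Proof. exact: lt_le_trans p1. Qed.
Let pn0 : p != 0. Proof. by rewrite gt_eqF. Qed.

(** Convexity of t^p at the midpoint of 2a and 2b. *)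
Lemma powR_convex_bound (a b : R) : 0 <= a -> 0 <= b ->
  (a + b) `^ p <= 2 `^ (p - 1) * (a `^ p + b `^ p).
Proof.
move=> a0 b0.
have h : 2^-1 <= 1 :> R by lra.
have h0 : 0 <= 2^-1 :> R by lra.
have := @convex_powR R p p1 (Itv01 h0 h) (2 * a) (2 * b).
rewrite !inE/= !in_itv/= !mulr_ge0//= => /(_ isT isT).
rewrite convRE [X in X `^ _ <= _ -> _]convRE/= /unstable.onem.
have -> : (1 - 2^-1 : R) = 2^-1 by lra.
rewrite !mulrA mulVf ?pnatr_eq0// !mul1r => /le_trans; apply.
rewrite !powRM// !mulrA -mulrDr -(mulr_powRB1 (_ : 0 <= 2) p0)// mulKf//.
Qed.

Lemma continuous_powR_norm : continuous (fun y : R => `|y| `^ p).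
Proof.
move=> y; have [->|y0] := eqVneq y 0.
  have cv0 : (`|z| `^ p) @[z --> (0 : R)] --> (0 : R).
    apply/cvgrPdist_le => /= e e0; near=> z.
    rewrite sub0r normrN ger0_norm ?powR_ge0//.
    have z1 : `|z| <= 1.
      by near: z; exists 1 => //= x; rewrite /= sub0r normrN; exact: ltW.
    have ze : `|z| <= e.
      by near: z; exists e => //= x; rewrite /= sub0r normrN; exact: ltW.
    have [->|z0] := eqVneq z 0; first by rewrite normr0 powR0// ltW.
    by rewrite (le_trans _ ze)// ge1r_powR// normr_gt0 z0.
  by move: cv0; rewrite /continuous_at normr0 powR0.
apply: (@continuous_comp _ _ _ (fun z : R => `|z|) (fun z : R => z `^ p));
  first exact: norm_continuous.
apply: differentiable_continuous; apply/derivable1_diffP; apply: derivable_powR.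
by rewrite in_itv/= andbT normr_gt0.
Unshelve. all: by end_near.
Qed.

Definition Lp_cvg (F : nat -> R -> R) f := forall e : R, 0 < e ->
  exists N, forall j, (N <= j)%N -> (Lp_norm p (F j \- f)%R <= e%:E)%E.

(* Fatou applied to 2^(p-1)(|F_j|^p + |f|^p) - |F_j - f|^p, as in Scheffe's lemma *)
Lemma Lp_cvg_ae_contraction (F : nat -> R -> R) f :
  (forall j, Lp p (F j)) -> Lp p f ->
  (forall j, Lp_norm p (F j) <= Lp_norm p f)%E ->
  {ae mu, forall x, F j x @[j --> \oo] --> f x} -> Lp_cvg F f.
Proof.
move=> LF Lf Ff cFf e e0; apply: contrapT => nN.
have /(Lp_intP p1)[mf fy] := Lf.
have mF j : measurable_fun setT (F j) by exact: Lp_measurable.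
pose I : R := fine (\int[mu]_x (`|f x| `^ p)%:E).
have IE : (\int[mu]_x (`|f x| `^ p)%:E)%E = I%:E.
  by rewrite /I fineK// ge0_fin_numE// integral_ge0// => x _; rewrite lee_fin powR_ge0.
have leF j : (\int[mu]_x (`|F j x| `^ p)%:E <= I%:E)%E.
  rewrite -IE -!(Lp_norm_pow p1).
  by apply: gt0_ler_poweR (Ff j); rewrite ?(ltW p0)// in_itv/= leey andbT Lp_norm_ge0.
pose c : R := 2 `^ (p - 1).
have c0 : 0 <= c by exact: powR_ge0.
pose h j x := c * (`|F j x| `^ p + `|f x| `^ p) - `|F j x - f x| `^ p.
have h0 j x : 0 <= h j x.
  rewrite subr_ge0; apply: le_trans (powR_convex_bound (normr_ge0 _) (normr_ge0 _)).
  by apply: ge0_ler_powR; rewrite ?nnegrE ?(ltW p0)// ler_normB.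
have m1 j : measurable_fun setT (fun x => `|F j x| `^ p) by exact: measurable_powR_abs.
have m2 : measurable_fun setT (fun x => `|f x| `^ p) by exact: measurable_powR_abs.
have m3 j : measurable_fun setT (fun x => `|F j x - f x| `^ p).
  by apply: measurable_powR_abs; exact: measurable_funB.
have mh j : measurable_fun setT (h j).
  apply: measurable_funB => //; apply: measurable_funM => //; exact: measurable_funD.
pose h' x := c * (`|f x| `^ p + `|f x| `^ p) - `|f x - f x| `^ p.
have mh' : measurable_fun setT h'.
  apply: measurable_funB; first by apply: measurable_funM => //; exact: measurable_funD.
  by apply: measurable_powR_abs; exact: measurable_funB.
have h'E x : h' x = 2 * c * `|f x| `^ p.
  by rewrite /h' subrr normr0 powR0// subr0; ring.
have cvh : {ae mu, forall x, (h j x)%:E @[j --> \oo] --> (h' x)%:E}.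
  apply: ae_imply cFf => x cx; apply: cvg_EFin; first exact: nearW.
  apply: cvgB; last first.
    apply: (continuous_cvg _ (@continuous_powR_norm (f x - f x))).
    by apply: cvgB => //; exact: cvg_cst.
  apply: cvgMr; apply: cvgD; last exact: cvg_cst.
  exact: (continuous_cvg _ (@continuous_powR_norm (f x))).
have ep0 : 0 < e `^ p by rewrite powR_gt0.
(* Were the distance to exceed [e] infinitely often, the integrals of [h j] would drop to 2 c I -
   e^p at those indices, because the norms of [F j] do not exceed that of [f]; Fatou then
   contradicts the limit value 2 c I. *)
have often N : exists2 j, (N <= j)%N &
    (\int[mu]_x (h j x)%:E <= (2 * c * I - e `^ p)%:E)%E.
  apply: contrapT => nj; apply: nN; exists N => j Nj.
  rewrite leNgt; apply/negP => ej; apply: nj; exists j => //.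
  rewrite EFinB leeBrDr//.
  have ejp : ((e `^ p)%:E <= \int[mu]_x (`|F j x - f x| `^ p)%:E)%E.
    rewrite -(Lp_norm_pow p1 (F j \- f)) -poweR_EFin.
    by apply: gt0_ler_poweR (ltW ej);
      rewrite ?(ltW p0)// in_itv/= leey andbT ?Lp_norm_ge0// lee_fin ltW.
  apply: le_trans (leeD2l _ ejp) _.
  rewrite -ge0_integralD//; first last.
  - by apply/measurable_EFinP; exact: m3.
  - by apply/measurable_EFinP; exact: mh.
  - by move=> x _; rewrite lee_fin.
  under eq_integral do rewrite -EFinD subrK EFinM EFinD.
  rewrite ge0_integralZl_EFin//; first last.
  - by apply: emeasurable_funD; apply/measurable_EFinP; [exact: m1|exact: m2].
  - by move=> x _; rewrite -EFinD lee_fin addr_ge0// powR_ge0.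
  rewrite ge0_integralD//; first last.
  - by apply/measurable_EFinP; exact: m2.
  - by apply/measurable_EFinP; exact: m1.
  rewrite IE (_ : 2 * c * I = c * (I + I)); last by ring.
  by rewrite EFinM lee_wpmul2l ?lee_fin// EFinD leeD2r.
have := @ae_fatou _ (fun j x => (h j x)%:E) (fun x => (h' x)%:E) (2 * c * I - e `^ p)%:E.
move=> /(_ (fun j => (measurable_EFinP _ _).2 (mh j)) (fun j x => _)) H.
have {H} := H _ ((measurable_EFinP _ _).2 mh') cvh often.
have -> : (\int[mu]_x (h' x)%:E = (2 * c * I)%:E)%E.
  under eq_integral do rewrite h'E EFinM.
  rewrite ge0_integralZl_EFin ?IE ?EFinM ?mulr_ge0//.
  - exact/measurable_EFinP.
move=> H; have {H} : (2 * c * I <= 2 * c * I - e `^ p)%R.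
  by rewrite -lee_fin; apply: H => j x; rewrite lee_fin.
by move: ep0; lra.
Qed.

End Lp_limits.

(** * Mollification *)

Section compact_support.
Context {R : realType}.
Local Notation mu := (@lebesgue_measure R).
Local Notation L1 k := (mu.-integrable setT (EFin \o k)).
Implicit Types (f g : R -> R) (B M p : R).

Lemma integral_supp_bound f B : supp_bound f B ->
  (\int[mu]_x `|f x|%:E = \int[mu]_(x in `[(- B)%R, B]) `|f x|%:E)%E.
Proof.
move=> fB; rewrite [RHS]integral_mkcond; apply: eq_integral => x _.
rewrite patchE; case: ifPn => //; rewrite notin_setE/= in_itv/= -ler_norml => /negP.
by rewrite -ltNge => Bx; rewrite fB ?normr0// ltW.
Qed.

Lemma measure_segment_lty B : (mu `[(- B)%R, B]%classic < +oo)%E.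
Proof. by apply: compact_finite_measure; exact: segment_compact. Qed.

Lemma bounded_supp_L1 g B M : measurable_fun setT g -> supp_bound g B ->
  (forall x, `|g x| <= M) -> L1 g.
Proof.
move=> mg gB gM; apply: integrable_absP => //.
have M0 : 0 <= M by apply: le_trans (gM 0).
rewrite (integral_supp_bound gB).
apply: (@le_lt_trans _ _ (\int[mu]_(x in `[(- B)%R, B]) (cst M%:E x))%E).
  apply: ge0_le_integral => //=.
  - apply: measurable_funTS; apply: measurableT_comp => //; exact: measurableT_comp.
  - by move=> x _; rewrite lee_fin.
rewrite integral_cst//; apply: lte_mul_pinfty => //.
exact: measure_segment_lty.
Qed.

Lemma L1_weight f : (forall t, 0 <= f t) -> L1 f ->
  (\int[mu]_t (f t)%:E = (L1norm f)%:E)%E.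
Proof.
move=> f0 /L1normE <-; apply: eq_integral => t _.
by rewrite ger0_norm.
Qed.

(** The power mean inequality, with the indicator of [-B, B] as weight, takes the place of Hölder
    with the conjugate exponent and so treats p = 1 on the same footing. *)
Lemma bounded_supp_dual p g B M : 1 <= p -> measurable_fun setT g ->
  supp_bound g B -> (forall x, `|g x| <= M) -> dual p g.
Proof.
move=> p1 mg gB gM; split => //.
have p0 : 0 < p by exact: lt_le_trans p1.
have M0 : 0 <= M by apply: le_trans (gM 0).
pose k : R -> R := \1_(`[(- B)%R, B]%classic).
have mk : measurable_fun setT k by exact: measurable_indic.
have k0 t : 0 <= k t by rewrite /k indicE.
have k1 t : `|k t| <= 1 by rewrite /k indicE normr_nat lern1; case: (_ \in _).
have kB : supp_bound k (B + 1).
  move=> x Bx; rewrite /k indicE memNset// /= in_itv/= -ler_norml; apply/negP.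
  by rewrite -ltNge; lra.
have Lk : L1 k by exact: (bounded_supp_L1 mk kB k1).
have kA := L1_weight k0 Lk.
exists (M * (L1norm k `^ (p - 1)) `^ p^-1); split.
  by rewrite mulr_ge0// powR_ge0.
move=> f fp; have mf := Lp_measurable fp.
have maf : measurable_fun setT (fun x => `|f x|) by exact: measurableT_comp.
apply: (@le_trans _ _ (M%:E * \int[mu]_x (k x * `|f x|)%:E)%E).
  rewrite -ge0_integralZl_EFin//; first last.
  - by apply/measurable_EFinP; exact: measurable_funM.
  - by move=> x _; rewrite lee_fin mulr_ge0.
  apply: ge0_le_integral => //.
  - by do 2 apply: measurableT_comp => //; exact: measurable_funM.
  - by apply: measurable_funeM; apply/measurable_EFinP; exact: measurable_funM.
  move=> x _; rewrite -EFinM lee_fin normrM /k indicE.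
  have [xB|xB] := boolP (x \in `[(- B)%R, B]%classic).
    by rewrite mul1r mulrC ler_wpM2r.
  rewrite gB; first by rewrite normr0 !mulr0 mul0r mulr0.
  by move: xB; rewrite notin_setE/= in_itv/= -ler_norml => /negP; rewrite -ltNge => /ltW.
rewrite EFinM -muleA lee_wpmul2l ?lee_fin//.
have := weighted_power_mean p1 mk maf k0 (fun t => normr_ge0 _) kA => H.
set J := (\int[mu]_x _)%E in H *.
have J0 : (0 <= J)%E by apply: integral_ge0 => x _; rewrite lee_fin mulr_ge0.
have H2 : (J `^ p <= ((L1norm k `^ (p - 1))%:E * Lp_norm p f `^ p))%E.
  apply: le_trans H _; rewrite Lp_norm_pow// lee_wpmul2l ?lee_fin ?powR_ge0//.
  apply: ge0_le_integral => //.
  - by move=> x _; rewrite lee_fin mulr_ge0// powR_ge0.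
  - by apply/measurable_EFinP; apply: measurable_funM => //; exact: measurable_powR_abs.
  - exact: measurable_EFin_powR_abs.
  by move=> x _; rewrite lee_fin ler_piMl ?powR_ge0//; have := k1 x; rewrite ger0_norm.
have := gt0_ler_poweR (r := p^-1) _ _ _ H2.
rewrite !in_itv/= !leey !andbT invr_ge0 (ltW p0) poweR_ge0 -poweRrM mulfV ?gt_eqF// poweRe1//.
move=> /(_ isT isT); rewrite mule_ge0 ?lee_fin ?powR_ge0 ?poweR_ge0// => /(_ isT) /le_trans; apply.
by rewrite poweRM ?lee_fin ?powR_ge0 ?poweR_ge0// -poweRrM mulfV ?gt_eqF// poweRe1// Lp_norm_ge0.
Qed.

Lemma C0inf_L1 g : C0inf g -> L1 g.
Proof.
move=> cg; have [M M0 gM] := C0inf_bounded cg.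
have /C0infP[ig [B B0 gB]] := cg.
exact: bounded_supp_L1 (Cinf_measurable ig) gB gM.
Qed.

Lemma C0inf_dual p g : 1 <= p -> C0inf g -> dual p g.
Proof.
move=> p1 cg; have [M M0 gM] := C0inf_bounded cg.
have /C0infP[ig [B B0 gB]] := cg.
exact: bounded_supp_dual p1 (Cinf_measurable ig) gB gM.
Qed.

Lemma C0inf_measurable g : C0inf g -> measurable_fun setT g.
Proof. by move=> /C0inf_Cinf; exact: Cinf_measurable. Qed.

Lemma compact_norm_bound (K : set R) : compact K -> exists2 B, 0 < B & K `<=` `[(- B)%R, B].
Proof.
move=> /compact_bounded[M [Mr MK]]; exists (`|M| + 1); first by rewrite ltr_wpDl.
move=> x Kx /=; rewrite in_itv/= -ler_norml; apply: MK => //.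
by have := ler_norm M; lra.
Qed.

Lemma Lp_locally_integrable p f : 1 <= p -> Lp p f -> locally_integrable setT f.
Proof.
move=> p1 fp; have /LpP[mf fy] := fp; split => //; first exact: openT.
move=> K _ cK; have [B B0 KB] := compact_norm_bound cK.
have mK : measurable K by exact: compact_measurable.
have mk : measurable_fun setT (\1_K : R -> R) by exact: measurable_indic.
have kB : supp_bound (\1_K : R -> R) (B + 1).
  move=> x Bx; rewrite indicE memNset// => /KB /=; rewrite in_itv/= -ler_norml.
  by move: Bx; lra.
have k1 t : `|\1_K t : R| <= 1 by rewrite indicE normr_nat lern1; case: (_ \in _).
have [_ [C [C0 /(_ _ fp) Cf]]] := bounded_supp_dual p1 mk kB k1.
rewrite integral_mkcond; apply: (@le_lt_trans _ _ (C%:E * Lp_norm p f)%E); last first.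
  by rewrite lte_mul_pinfty// lee_fin.
apply: le_trans Cf; rewrite le_eqVlt; apply/orP; left; apply/eqP.
apply: eq_integral => x _; rewrite patchE indicE; case: ifP => _.
  by rewrite mulr1.
by rewrite mulr0 normr0.
Qed.

Lemma locally_integrable_mul f g B M : locally_integrable setT f ->
  measurable_fun setT g -> supp_bound g B -> (forall x, `|g x| <= M) ->
  L1 (fun x => f x * g x).
Proof.
move=> [mf _ lf] mg gB gM; have mfg : measurable_fun setT (fun x => f x * g x).
  exact: measurable_funM.
have M0 : 0 <= M by apply: le_trans (gM 0).
apply: integrable_absP => //.
rewrite (@integral_supp_bound _ B); last by move=> x /gB ->; rewrite mulr0.
have fB := lf `[(- B)%R, B]%classic (@subsetT _ _) (@segment_compact _ _ _).
apply: (@le_lt_trans _ _ (M%:E * \int[mu]_(x in `[(- B)%R, B]) `|f x|%:E)%E).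
  rewrite -ge0_integralZl_EFin//; last first.
    by apply: measurable_funTS; do 2 apply: measurableT_comp => //.
  apply: ge0_le_integral => //.
  - by apply: measurable_funTS; do 2 apply: measurableT_comp => //.
  - apply: measurable_funeM; apply: measurable_funTS.
    by do 2 apply: measurableT_comp => //.
  by move=> x _; rewrite -EFinM lee_fin normrM mulrC ler_wpM2r.
by rewrite lte_mul_pinfty// lee_fin.
Qed.

End compact_support.

(** * Mollifiers and their convergence *)

Section mollifier.
Context {R : realType}.
Local Notation mu := (@lebesgue_measure R).
Local Notation L1 k := (mu.-integrable setT (EFin \o k)).
Implicit Types (f g : R -> R) (j : nat).

(** The summand 0 keeps the shape a x + b of the affine substitution lemmas. *)
Definition dilated_bump j (x : R) : R := bump (j.+1%:R * x + 0).

Definition mollifier j (x : R) : R := (\int[mu]_x dilated_bump j x)^-1 * dilated_bump j x.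

Let j0 j : 0 < j.+1%:R :> R. Proof. by rewrite ltr0n. Qed.

Lemma C0inf_dilated_bump j : C0inf (dilated_bump j).
Proof. by apply: C0inf_affine; [rewrite pnatr_eq0|exact: C0inf_bump]. Qed.

Lemma C0inf_mollifier j : C0inf (mollifier j).
Proof. exact: C0infZ (C0inf_dilated_bump j). Qed.

(** The dilated bump is at least e^(-4) on an interval of length 1 / (j + 1). Since it never exceeds
    1, the normalized function is at most e^4 (j + 1), comparable to the inverse width of its
    support. *)
Lemma dilated_bump_mass j :
  expR (- 4) / j.+1%:R <= (\int[mu]_x dilated_bump j x)%R.
Proof.
have d0 x : 0 <= dilated_bump j x by exact: bump_ge0.
have Ld := C0inf_L1 (C0inf_dilated_bump j).
have := L1_weight d0 Ld.
rewrite /Rintegral => ->; rewrite /= -lee_fin -(L1_weight d0 Ld).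
pose r : R := 2^-1 / j.+1%:R.
have r0 : 0 < r by rewrite divr_gt0.
apply: (@le_trans _ _ (\int[mu]_(x in `[(- r)%R, r]) (cst (expR (- 4))%:E x))%E).
  rewrite integral_cst//= lebesgue_measure_itv/= lte_fin ifT; last by lra.
  rewrite -EFinB opprK -EFinM lee_fin ler_wpM2l ?expR_ge0//.
  by rewrite /r; have := j0 j; rewrite -mulrDl (_ : 2^-1 + 2^-1 = 1) ?mul1r//; lra.
have md := C0inf_measurable (C0inf_dilated_bump j).
apply: (@le_trans _ _ (\int[mu]_(x in `[(- r)%R, r]) (dilated_bump j x)%:E)%E).
  apply: ge0_le_integral => //.
  - by move=> x _; rewrite lee_fin expR_ge0.
  - by apply: measurable_funTS; exact/measurable_EFinP.
  move=> x /=; rewrite in_itv/= -ler_norml lee_fin => xr; apply: bump_lower.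
  by rewrite addr0 normrM ger0_norm ?ler0n// mulrC -ler_pdivlMr.
apply: ge0_subset_integral => //; first exact/measurable_EFinP.
by move=> x _; rewrite lee_fin.
Qed.

Lemma dilated_bump_mass_gt0 j : 0 < \int[mu]_x dilated_bump j x.
Proof. by apply: lt_le_trans (dilated_bump_mass j); rewrite divr_gt0// expR_gt0. Qed.

Lemma mollifier_ge0 j x : 0 <= mollifier j x.
Proof. by rewrite mulr_ge0 ?bump_ge0// invr_ge0 ltW// dilated_bump_mass_gt0. Qed.

Lemma mollifier_L1 j : L1 (mollifier j).
Proof. exact: C0inf_L1 (C0inf_mollifier j). Qed.

Lemma mollifier_mass j : \int[mu]_x mollifier j x = 1.
Proof.
rewrite RintegralMl; last exact: C0inf_measurable (C0inf_dilated_bump j).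
by rewrite mulVf// gt_eqF// dilated_bump_mass_gt0.
Qed.

Lemma mollifier_L1norm j : L1norm (mollifier j) = 1.
Proof.
rewrite -(mollifier_mass j) /L1norm; apply: eq_Rintegral => x _.
by rewrite ger0_norm// mollifier_ge0.
Qed.

Lemma mollifier_le j x : mollifier j x <= expR 4 * j.+1%:R.
Proof.
have := dilated_bump_mass j; have := dilated_bump_mass_gt0 j.
rewrite /mollifier; set Z := Rintegral _ _ _ => Z0 ZJ.
apply: (@le_trans _ _ Z^-1).
  by rewrite ler_piMr ?bump_le1// invr_ge0 ltW.
have := ZJ; rewrite -lef_pV2 ?posrE ?divr_gt0 ?expR_gt0//.
by rewrite invfM invrK -expRN opprK.
Qed.

Lemma supp_bound_mollifier j : supp_bound (mollifier j) j.+1%:R^-1.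
Proof.
move=> x h; rewrite /mollifier /dilated_bump supp_bound_bump ?mulr0//.
by rewrite addr0 normrM ger0_norm ?ler0n// mulrC -ler_pdivrMr ?div1r.
Qed.

(** Unit mass allows f(x) to be taken inside the integral. The mollifier is at most e^4 / r and
    vanishes outside the ball of radius r = 1 / (j + 1), whose measure is 2 r; hence the factor 2
    e^4 in front of the mean deviation. *)
Lemma conv_mollifier_davg f j x : locally_integrable setT f ->
  (`|conv (mollifier j) f x - f x|%:E <=
   (2 * expR 4)%:E * davg f x j.+1%:R^-1)%E.
Proof.
move=> lf; have [mf _ _] := lf.
have mm : measurable_fun setT (mollifier j) := C0inf_measurable (C0inf_mollifier j).
have jn0 : j.+1%:R != 0 :> R by rewrite pnatr_eq0.
pose m y := mollifier j (x - y).
have mE : m = (fun y => mollifier j (- 1 * y + x)).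
  by apply/funext => y; rewrite /m mulN1r addrC.
have cm : C0inf m by rewrite mE; apply: C0inf_affine; [rewrite oppr_eq0 oner_eq0|
  exact: C0inf_mollifier].
have mmm := C0inf_measurable cm.
have Lm := C0inf_L1 cm.
have [M M0 mM] := C0inf_bounded cm.
have /C0infP[_ [B B0 mB]] := cm.
have Lfm := locally_integrable_mul lf mmm mB mM.
have m1 : \int[mu]_y m y = 1 by rewrite /m Rintegral_reflect// mollifier_mass.
have -> : conv (mollifier j) f x - f x = \int[mu]_y ((f y - f x) * m y).
  rewrite (convC mm mf) /conv -[X in _ - X]mulr1 -m1 -RintegralMl//.
  rewrite -RintegralB//; first by apply: eq_Rintegral => y _; rewrite mulrBl.
  exact: (integrableZl measurableT (f x) Lm).
have mfm : measurable_fun setT (fun y => (f y - f x) * m y).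
  by apply: measurable_funM => //; exact: measurable_funB.
apply: le_trans (abs_Rintegral_le mfm) _.
set r : R := j.+1%:R^-1.
have r0 : 0 < r by rewrite invr_gt0.
rewrite /davg /iavg lebesgue_measure_ball; last exact: ltW.
have -> : ((r *+ 2)%:E^-1 = ((2 * r)^-1)%:E)%E.
  by rewrite mulr_natl inver mulrn_eq0/= gt_eqF.
rewrite muleA -EFinM.
have -> : 2 * expR 4 / (2 * r) = expR 4 * j.+1%:R.
  by rewrite invfM mulrACA mulfV ?pnatr_eq0// mul1r /r invrK.
have mb : measurable (ball x r) by exact: measurable_ball.
have mcf : measurable_fun setT (fun y => `|f x - f y|).
  by apply: measurableT_comp => //; exact: measurable_funB.
rewrite [X in (_ <= _ * X)%E]integral_mkcond -ge0_integralZl_EFin//; first last.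
- apply/(measurable_restrictT _ _).1 => //; apply: measurable_funTS.
  apply/measurable_EFinP; apply: measurableT_comp => //.
  exact: measurable_funB.
- by move=> y _; apply: erestrict_ge0.
apply: ge0_le_integral => //.
- by do 2 apply: measurableT_comp => //.
- apply: measurable_funeM; apply/(measurable_restrictT _ _).1 => //; apply: measurable_funTS.
  apply/measurable_EFinP; apply: measurableT_comp => //.
  exact: measurable_funB.
move=> y _; rewrite patchE; case: ifPn => [_|].
  rewrite -EFinM lee_fin normrM mulrC ler_pM//.
  by rewrite /m ger0_norm ?mollifier_ge0// mollifier_le.
rewrite notin_setE/= /ball/= => /negP; rewrite -leNgt => ry.
by rewrite (_ : point = 0%E)// mule0 /m supp_bound_mollifier ?mulr0 ?normr0.
Qed.

(** Lebesgue's differentiation theorem sends the mean deviation [davg] to 0 almost everywhere, here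
    along the radii 1 / (j + 1). *)
Lemma conv_mollifier_cvg_ae f : locally_integrable setT f ->
  {ae mu, forall x, conv (mollifier j) f x @[j --> \oo] --> f x}.
Proof.
move=> lf; apply: ae_imply (lebesgue_differentiation lf) => x lx.
have h : (j.+1%:R^-1 : R) @[j --> \oo] --> (0 : R)^'+.
  move=> P [e /= e0 Pe].
  have /cvgrPdist_lt /(_ e e0)[N _ NP] := @cvg_harmonic R.
  exists N => // j Nj /=; apply: Pe; first exact: NP.
  by rewrite invr_gt0.
have lxj := cvg_comp _ _ h lx.
have lxj2 : ((2 * expR 4)%:E * davg f x j.+1%:R^-1)%E @[j --> \oo] --> 0%E.
  by rewrite -(mule0 (2 * expR 4)%:E); apply: cvgeZl => //; exact: lxj.
apply/subr_cvg0; apply: norm_cvg0.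
have h3 : (`|conv (mollifier j) f x - f x|%:E)%E @[j --> \oo] --> 0%E.
  apply: (squeeze_cvge _ (cvg_cst 0%E) lxj2); apply: nearW => j.
  by rewrite lee_fin normr_ge0/=; exact: conv_mollifier_davg.
by move/fine_cvgP : h3 => [_ ].
Qed.

(** The value of the mollified function at [x] is the pairing of [f] with a reflected and translated
    mollifier, hence 0, and these values converge to [f] almost everywhere. *)
Lemma locally_integrable_eq0 f : locally_integrable setT f ->
  (forall phi, C0inf phi -> \int[mu]_x (f x * phi x) = 0) ->
  {ae mu, forall x, f x = 0}.
Proof.
move=> lf f0; apply: ae_imply (conv_mollifier_cvg_ae lf) => x.
have [mf _ _] := lf.
have E j : conv (mollifier j) f x = 0.
  rewrite (convC (C0inf_measurable (C0inf_mollifier j)) mf).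
  rewrite -[RHS](f0 (fun y => mollifier j (- 1 * y + x))).
    by apply: eq_Rintegral => y _; rewrite mulN1r addrC.
  apply: C0inf_affine; first by rewrite oppr_eq0 oner_eq0.
  exact: C0inf_mollifier.
under eq_fun do rewrite E.
move=> h; exact: (cvg_unique (@Rhausdorff R) h (cvg_cst 0)).
Qed.

Variable p : R.
Hypothesis p1 : 1 <= p.

Lemma Lp_conv_mollifier j f : Lp p f ->
  Lp p (conv (mollifier j) f) /\
  (Lp_norm p (conv (mollifier j) f) <= Lp_norm p f)%E.
Proof.
by move=> /(Lp_conv p1 (mollifier_L1 j)); rewrite mollifier_L1norm mul1e.
Qed.

Lemma conv_mollifier_cvg f : Lp p f -> Lp_cvg p (fun j => conv (mollifier j) f) f.
Proof.
move=> fp; apply: Lp_cvg_ae_contraction => //.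
- by move=> j; have [] := Lp_conv_mollifier j fp.
- by move=> j; have [] := Lp_conv_mollifier j fp.
- exact: conv_mollifier_cvg_ae (Lp_locally_integrable p1 fp).
Qed.

End mollifier.

(** * Smoothness of convolutions with test functions *)

Section smooth_convolution.
Context {R : realType}.
Local Notation mu := (@lebesgue_measure R).
Local Notation L1 k := (mu.-integrable setT (EFin \o k)).
Implicit Types (K phi : R -> R) (x a : R).

Lemma C0inf_reflect phi x : C0inf phi -> C0inf (fun t => phi (x - t)).
Proof.
move=> cphi; rewrite (_ : (fun t => _) = (fun t => phi (- 1 * t + x))).
  by apply: C0inf_affine => //; rewrite oppr_eq0 oner_eq0.
by apply/funext => t; rewrite mulN1r addrC.
Qed.

Lemma locally_integrable_mul_C0inf K phi : locally_integrable setT K -> C0inf phi ->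
  L1 (fun t => K t * phi t).
Proof.
move=> lK cphi; have [M M0 gM] := C0inf_bounded cphi.
have /C0infP[ig [B B0 gB]] := cphi.
exact: locally_integrable_mul lK (Cinf_measurable ig) gB gM.
Qed.

Lemma is_derive_conv K phi a : locally_integrable setT K -> C0inf phi ->
  is_derive a 1 (conv K phi) (conv K (derive1 phi) a).
Proof.
move=> lK cphi.
have /C0infP[ig [B B0 gB]] := cphi.
have cphi' : C0inf (derive1 phi) by exact: (C0inf_derive1n 1 cphi).
have /C0infP[ig' [B' B'0 gB']] := cphi'.
have [M M0 gM] := C0inf_bounded cphi'.
pose f x t := K t * phi (x - t).
have df x t : is_derive x (1 : R) (f^~ t) (K t * derive1 phi (x - t)).
  have h : is_derive x (1 : R) (fun x : R => phi (1 * x + - t)) (1 * derive1 phi (1 * x + - t)).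
    by apply: derivable_affine; exact: Cinf_derivable.
  have := is_deriveZ (K t) h; rewrite /f /GRing.scale/= !mul1r.
  by under [in X in X -> _]eq_fun do rewrite mul1r.
(* For every x within 1 of [a], the translate of [derive1 phi] vanishes once [|t|] exceeds [D]; one
   indicator therefore dominates on the whole neighbourhood. *)
pose D := B' + `|a| + 1.
pose g : R -> R := fun t => M * \1_(`[(- D), D]%classic) t.
have mg : measurable_fun setT g.
  by apply: measurable_funM => //; exact: measurable_indic.
have gD : supp_bound g (D + 1).
  move=> t Dt; rewrite /g indicE memNset ?mulr0//= in_itv/= -ler_norml; apply/negP.
  by rewrite -ltNge; move: Dt; lra.
have gMt t : `|g t| <= M.
  by rewrite /g indicE normrM (ger0_norm M0) normr_nat; case: (_ \in _); rewrite ?mulr1 ?mulr0.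
have LG : L1 (fun t => `|K t * g t|).
  have := locally_integrable_mul lK mg gD gMt.
  by move=> /integrable_abse.
have Ia : `](a - 1), (a + 1)[%classic a by rewrite /= in_itv/=; apply/andP; split; lra.
have intf x : `](a - 1), (a + 1)[%classic x -> L1 (f x).
  by move=> _; exact: (locally_integrable_mul_C0inf lK (C0inf_reflect x cphi)).
have dd x t : `](a - 1), (a + 1)[%classic x -> setT t -> derivable (f ^~ t) x 1.
  by move=> _ _; exact: is_derive_derivable (df x t).
have Gub x t : `](a - 1), (a + 1)[%classic x -> setT t ->
    `|partial1of2 f x t| <= `|K t * g t|.
  move=> xa _; rewrite /partial1of2 (is_derive_derive1E (df x t)) (normrM (K t)) (normrM
    (K t)) ler_wpM2l//.
  have [tD|tD] := leP `|t| D.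
    rewrite /g indicE mem_set/=; last by rewrite in_itv/= -ler_norml.
    by rewrite normrM normr1 mulr1 (ger0_norm M0).
  rewrite gB' ?normr0//; move: xa; rewrite /= in_itv/= => xa.
  have xa1 : `|x| <= `|a| + 1.
    have := ler_normD a (x - a); rewrite addrC subrK => h; apply: (le_trans h).
    by rewrite lerD2l ler_norml; move: xa => /andP[] *; apply/andP; split; lra.
  have := lerB_dist t x; rewrite distrC; move: tD xa1; rewrite /D; lra.
have G0 t : 0 <= `|K t * g t| by [].
have := @derivable_under_integral _ _ _ mu f setT measurableT a (a - 1) (a + 1) Ia
  intf dd _ G0 LG Gub.
have := @differentiation_under_integral _ _ _ mu f setT measurableT a (a - 1) (a + 1) Ia
  intf dd _ G0 LG Gub.
rewrite -/(conv K phi) => e d.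
have -> : conv K (derive1 phi) a = derive1 (conv K phi) a.
  rewrite e; apply: eq_Rintegral => t _.
  by rewrite /partial1of2 (is_derive_derive1E (df a t)).
exact: is_derive_derive1.
Qed.

Lemma derive1n_conv k K phi : locally_integrable setT K -> C0inf phi ->
  derive1n k (conv K phi) = conv K (derive1n k phi).
Proof.
move=> lK cphi; elim: k => [//|k ih]; rewrite !derive1nS ih.
apply/funext => x; apply: is_derive_derive1E; apply: is_derive_conv => //.
exact: C0inf_derive1n.
Qed.

Lemma Cinf_conv K phi : locally_integrable setT K -> C0inf phi ->
  Cinf (conv K phi).
Proof.
move=> lK cphi k x; rewrite derive1n_conv//.
by apply: is_derive_derivable; apply: is_derive_conv => //; exact: C0inf_derive1n.
Qed.

End smooth_convolution.

(** * Weak operators *)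

Section weak_operators.
Context {R : realType}.
Variable p : R.
Hypothesis p1 : 1 <= p.
Local Notation mu := (@lebesgue_measure R).
Local Notation L1 k := (mu.-integrable setT (EFin \o k)).
Implicit Types (T : (R -> R) -> R -> R) (u v f g phi : R -> R) (k m : nat).

(** [T] is the formal adjoint with its sign included, so that one theory serves classical and
    fractional weak derivatives alike. *)
Definition weak_op T u v := locally_integrable setT v /\
  forall phi, C0inf phi -> \int[mu]_x (v x * phi x) = \int[mu]_x (u x * T phi x).

(** The first property makes pairings with L^p functions converge and depend continuously on them;
    commutation with translations is what lets convolutions pass through. *)
Definition admissible T :=
  (forall phi, C0inf phi -> dual p (T phi)) /\
  (forall phi t, C0inf phi -> T (fun x => phi (x - t)) = (fun x => T phi (x - t))).

Lemma locally_integrable_ae_eq v v' : locally_integrable setT v ->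
  locally_integrable setT v' ->
  (forall phi, C0inf phi -> \int[mu]_x (v x * phi x) = \int[mu]_x (v' x * phi x)) ->
  {ae mu, forall x, v x = v' x}.
Proof.
move=> lv lv' vv'.
have lvv : locally_integrable setT (v \- v') by exact: locally_integrableB.
have : {ae mu, forall x, (v \- v') x = 0}.
  apply: (locally_integrable_eq0 lvv) => phi cphi.
  under eq_Rintegral do rewrite mulrBl.
  rewrite RintegralB//; [by rewrite vv' ?subrr|exact: locally_integrable_mul_C0inf..].
by apply: ae_imply => x /eqP; rewrite subr_eq0 => /eqP.
Qed.

Lemma weak_op_ae_unique T u v v' : weak_op T u v -> weak_op T u v' ->
  {ae mu, forall x, v x = v' x}.
Proof.
move=> [lv uv] [lv' uv']; apply: locally_integrable_ae_eq => // phi cphi.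
by rewrite uv// uv'.
Qed.

Lemma weak_opD T u v u' v' : (forall phi, C0inf phi -> dual p (T phi)) ->
  Lp p u -> Lp p u' -> weak_op T u v -> weak_op T u' v' ->
  weak_op T (u \+ u') (v \+ v').
Proof.
move=> dT pu pu' [lv uv] [lv' uv']; split; first exact: locally_integrableD.
move=> phi cphi; have d := dT _ cphi.
under eq_Rintegral do rewrite mulrDl.
under [RHS]eq_Rintegral do rewrite mulrDl.
rewrite !RintegralD ?uv ?uv'//; try exact: (dual_integrable _ d).
all: exact: locally_integrable_mul_C0inf.
Qed.

Lemma weak_opZ T (c : R) u v : (forall phi, C0inf phi -> dual p (T phi)) ->
  Lp p u -> weak_op T u v -> weak_op T (fun x => c * u x) (fun x => c * v x).
Proof.
move=> dT pu [lv uv]; split.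
  have [mv _ fv] := lv; split; [exact: measurable_funM|exact: openT|].
  move=> K KT cK; under eq_integral do rewrite normrM EFinM.
  rewrite ge0_integralZl_EFin//; first by rewrite lte_mul_pinfty ?lee_fin// fv.
  - exact: compact_measurable.
  - by apply: measurable_funTS; do 2 apply: measurableT_comp => //.
move=> phi cphi; have d := dT _ cphi.
have [mv _ _] := lv; have mu_ := Lp_measurable pu; have [mT _] := d.
under eq_Rintegral do rewrite -mulrA.
under [RHS]eq_Rintegral do rewrite -mulrA.
rewrite !RintegralMl ?uv//; first exact: measurable_funM.
by apply: measurable_funM => //; exact: C0inf_measurable.
Qed.

Lemma weak_opB T u v u' v' : (forall phi, C0inf phi -> dual p (T phi)) ->
  Lp p u -> Lp p u' -> weak_op T u v -> weak_op T u' v' ->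
  weak_op T (u \- u') (v \- v').
Proof.
move=> dT pu pu' w w'.
have := weak_opD dT pu (LpZ p1 (-1) pu') w (weak_opZ (-1) dT pu' w').
by congr weak_op; apply/funext => x /=; rewrite mulN1r.
Qed.

(** Both pairings become averages, with weight [k], of pairings against translates of [phi]. These
    are again test functions, so the identity for [u] and [v] applies under the integral. *)
Lemma weak_op_conv T (k : R -> R) u v : admissible T -> L1 k -> Lp p u -> Lp p v ->
  weak_op T u v -> weak_op T (conv k u) (conv k v).
Proof.
move=> [dT sT] Lk pu pv [lv uv]; split.
  by have [pkv _] := Lp_conv p1 Lk pv; exact: Lp_locally_integrable pkv.
move=> phi cphi; have d := dT _ cphi.
rewrite (conv_pairing p1 Lk pv (C0inf_dual p1 cphi)) (conv_pairing p1 Lk pu d).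
apply: eq_Rintegral => t _; congr (_ * _).
by rewrite (uv _ (C0inf_shift (- t) cphi)) sT.
Qed.

Lemma abs_pairing_le f g (C : R) : Lp p f -> measurable_fun setT g -> dual_bound p C g ->
  (`|\int[mu]_x (f x * g x)|%:E <= C%:E * Lp_norm p f)%E.
Proof.
move=> pf mg [C0 Cg]; apply: le_trans (Cg _ pf); apply: abs_Rintegral_le.
exact: (measurable_funM (Lp_measurable pf) mg).
Qed.

Lemma Lp_cvg_pairing (F : nat -> R -> R) f g : (forall j, Lp p (F j)) -> Lp p f ->
  Lp_cvg p F f -> dual p g ->
  (\int[mu]_x (F j x * g x)) @[j --> \oo] --> \int[mu]_x (f x * g x).
Proof.
move=> pF pf Ff dg; have [mg [C Cg]] := dg; have [C0 _] := Cg.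
apply/cvgrPdist_le => e e0.
have e0' : 0 < e / (C + 1) by rewrite divr_gt0// ltr_wpDl.
have [N NF] := Ff _ e0'; exists N => // j /= Nj; have jF := NF _ Nj.
rewrite distrC -RintegralB//; [|exact: dual_integrable dg..].
under eq_Rintegral do rewrite -mulrBl.
rewrite -lee_fin; apply: le_trans (abs_pairing_le (LpB p1 (pF j) pf) mg Cg) _.
apply: le_trans (lee_wpmul2l _ jF) _; first by rewrite lee_fin.
by rewrite -EFinM lee_fin mulrCA ger_pMr// ler_pdivrMr ?ltr_wpDl// mul1r lerDl.
Qed.

(** For a fixed test function both sides of the defining identity are continuous in L^p, as [phi]
    and [T phi] lie in the dual class. *)
Lemma weak_op_closed T (U V : nat -> R -> R) u v :
  (forall phi, C0inf phi -> dual p (T phi)) ->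
  (forall j, Lp p (U j)) -> (forall j, Lp p (V j)) -> Lp p u -> Lp p v ->
  Lp_cvg p U u -> Lp_cvg p V v ->
  (forall j, weak_op T (U j) (V j)) -> weak_op T u v.
Proof.
move=> dT pU pV pu pv Uu Vv w; split; first exact: Lp_locally_integrable pv.
move=> phi cphi.
have c1 := Lp_cvg_pairing pV pv Vv (C0inf_dual p1 cphi).
have c2 := Lp_cvg_pairing pU pu Uu (dT _ cphi).
apply: (cvg_unique (@Rhausdorff R) c1).
have E : (fun j => \int[mu]_x (V j x * phi x)) = (fun j => \int[mu]_x (U j x * T phi x)).
  by apply/funext => j; exact: (w j).2.
by rewrite E.
Qed.

Definition deriv_op k phi (x : R) : R := (-1) ^+ k * derive1n k phi x.

Lemma deriv_op_admissible k : admissible (deriv_op k).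
Proof.
split => [phi cphi|phi t cphi].
  by apply: dualZ; apply: C0inf_dual => //; exact: C0inf_derive1n.
by apply/funext => x; rewrite /deriv_op derive1n_shift//; exact: C0inf_Cinf.
Qed.

Lemma is_weak_derivE k u v : measurable_fun setT u ->
  is_weak_deriv k u v <-> weak_op (deriv_op k) u v.
Proof.
move=> mu_; rewrite /is_weak_deriv /weak_op.
have E phi : C0inf phi -> (-1) ^+ k * \int[mu]_x (u x * derive1n k phi x) =
    \int[mu]_x (u x * deriv_op k phi x).
  move=> cphi; rewrite -RintegralMl.
    by apply: eq_Rintegral => x _; rewrite /deriv_op mulrCA.
  by apply: measurable_funM => //; apply: C0inf_measurable; exact: C0inf_derive1n.
by split => -[lv uv]; split => // phi cphi; rewrite uv// E.
Qed.

End weak_operators.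

(** * Power kernels *)

Section power_kernels.
Context {R : realType}.
Local Notation mu := (@lebesgue_measure R).
Local Notation L1 k := (mu.-integrable setT (EFin \o k)).
Implicit Types (f phi : R -> R) (x t u v c : R).

(** Improper integrals: antiderivatives give the bound on compact intervals, and Fatou passes to the
    line. It serves for the singularity at 0 and for the decay at infinity. *)
Lemma L1_exhaustion f (a b : nat -> R) (M : R) : measurable_fun setT f ->
  (forall x, 0 <= f x) ->
  (forall x, f x != 0 -> \forall j \near \oo, a j <= x <= b j) ->
  (forall j, (\int[mu]_(x in `[(a j), (b j)]) (f x)%:E <= M%:E)%E) ->
  L1 f.
Proof.
move=> mf f0 ab fM; apply: integrable_absP => //.
have -> : (\int[mu]_x `|f x|%:E = \int[mu]_x (f x)%:E)%E.
  by apply: eq_integral => x _; rewrite ger0_norm.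
apply: (@le_lt_trans _ _ M%:E); last by rewrite ltry.
pose h j x := (f x * \1_(`[(a j), (b j)]%classic) x)%:E.
apply: (@ae_fatou _ h).
- by move=> j; apply/measurable_EFinP; apply: measurable_funM.
- by move=> j x; rewrite lee_fin mulr_ge0// indicE.
- exact/measurable_EFinP.
- apply: aeW => x; apply: cvg_near_cst.
  have [fx0|/ab] := eqVneq (f x) 0; first by apply: nearW => j; rewrite /h fx0 mul0r.
  by apply: filterS => j abj; rewrite /h indicE mem_set ?mulr1//= in_itv/=.
- move=> N; exists N => //; apply: le_trans (fM N).
  rewrite [leRHS]integral_mkcond le_eqVlt; apply/orP; left; apply/eqP.
  apply: eq_integral => x _; rewrite /h patchE indicE.
  by case: ifP => _; rewrite ?mulr1 ?mulr0.
Qed.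

Lemma FTC2_C1 (F f : R -> R) u v : u < v ->
  (forall x, u <= x -> is_derive x 1 F (f x)) ->
  (forall x, u <= x -> {for x, continuous f}) ->
  (\int[mu]_(x in `[u, v]) (f x)%:E = (F v)%:E - (F u)%:E)%E.
Proof.
move=> uv dF cf.
have cF x : u <= x -> {for x, continuous F}.
  move=> ux; apply: differentiable_continuous; apply/derivable1_diffP.
  exact: is_derive_derivable (dF x ux).
apply: continuous_FTC2 => //.
- apply: continuous_in_subspaceT => x /[!inE] /=; rewrite in_itv/= => /andP[ux _].
  exact: cf.
- split.
  + move=> x; rewrite in_itv/= => /andP[ux _].
    exact: is_derive_derivable (dF x (ltW ux)).
  + by apply: cvg_at_right_filter; exact: cF.
  + by apply: cvg_at_left_filter; apply: cF; exact: ltW.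
- move=> x; rewrite in_itv/= => /andP[ux _].
  exact: is_derive_derive1E (dF x (ltW ux)).
Qed.

Lemma continuous_powR c x : 0 < x -> {for x, continuous (fun t : R => t `^ c)}.
Proof.
move=> x0; apply: differentiable_continuous; apply/derivable1_diffP.
exact: is_derive_derivable (is_derive1_powR c x0).
Qed.

Lemma integral_powR c u v : 0 < u -> u < v ->
  (\int[mu]_(t in `[u, v]) (c * t `^ (c - 1))%:E = (v `^ c - u `^ c)%:E)%E.
Proof.
move=> u0 uv; rewrite EFinB.
apply: (@FTC2_C1 (fun t => t `^ c) (fun t => c * t `^ (c - 1)) u v uv).
- by move=> x ux; apply: is_derive1_powR; exact: lt_le_trans ux.
- move=> x ux; apply: cvgMr; apply: continuous_powR.
  exact: lt_le_trans ux.
Qed.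

Variable sigma : R.
Hypothesis sigma01 : 0 <= sigma < 1.

Let s0 : 0 <= sigma. Proof. by case/andP: sigma01. Qed.
Let s1 : 0 < 1 - sigma. Proof. by case/andP: sigma01 => _; rewrite subr_gt0. Qed.

(** The Riemann-Liouville kernel; [sigma] will be the fractional part of the order, and 0 at
    integers. As sigma < 1 the kernel is locally integrable, but not integrable at infinity. *)
Definition frac_kernel t : R := \1_(`]0, +oo[%classic) t * (t `^ sigma)^-1.

(** The factor [t] on ]0, 1] makes the tail continuous: it leaves 0 continuously and takes the value
    1 at t = 1 from both sides, so integration by parts produces no boundary terms. *)
Definition kernel_tail t : R :=
  \1_(`]0, 1]%classic) t * t + \1_(`]1, +oo[%classic) t * t `^ (- sigma).

Definition kernel_head t : R := \1_(`]0, 1]%classic) t * (t `^ (- sigma) - t).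

(** The derivative of the tail off its two corners. The decay t^(-sigma-1) is integrable for sigma >
    0, and the factor [sigma] removes that part when sigma = 0. *)
Definition kernel_tail' t : R :=
  \1_(`]0, 1]%classic) t - \1_(`]1, +oo[%classic) t * (sigma * t `^ (- sigma - 1)).

Let mind (A : set R) : measurable A -> measurable_fun setT (\1_A : R -> R).
Proof. by move=> mA; exact: measurable_indic. Qed.

Let indic_itv (i : interval R) t : \1_([set` i]) t = (t \in i)%:R :> R.
Proof. by rewrite indicE mem_setE. Qed.

Let indic_bound (A : set R) t : `|\1_A t : R| <= 1.
Proof. by rewrite indicE normr_nat lern1; case: (_ \in _). Qed.

Lemma frac_kernelE t : frac_kernel t = kernel_head t + kernel_tail t.
Proof.
rewrite /frac_kernel /kernel_head /kernel_tail !indic_itv !in_itv/= !andbT -powRN.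
have [t0|t0] := leP t 0.
  by rewrite (_ : 1 < t = false) ?mul0r ?addr0//; apply/negbTE; rewrite -leNgt; lra.
by have [t1|t1] := leP t 1; rewrite /= ?mul1r ?mul0r ?addr0 ?add0r// subrK.
Qed.

Let powR_le1 c t : 1 <= t -> 0 <= c -> t `^ (- c) <= 1.
Proof. by move=> t1 c0; rewrite -(powRr0 t); apply: ler_powR => //; rewrite oppr_le0. Qed.

Lemma measurable_kernel_tail : measurable_fun setT kernel_tail.
Proof.
apply: measurable_funD; apply: measurable_funM; try exact: mind; first by [].
exact: measurable_powR.
Qed.

Lemma kernel_tail_bound t : `|kernel_tail t| <= 1.
Proof.
rewrite /kernel_tail !indic_itv !in_itv/= !andbT.
have [t0|t0] := leP t 0.
  rewrite (_ : 1 < t = false) ?mul0r ?addr0 ?normr0//.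
  by apply/negbTE; rewrite -leNgt; lra.
have [t1|t1] := leP t 1; rewrite /= ?mul1r ?mul0r ?addr0 ?add0r ger0_norm//.
- exact: ltW.
- by apply: powR_le1 => //; exact: ltW.
- exact: powR_ge0.
Qed.

Lemma bounded_locally_integrable f M : measurable_fun setT f ->
  (forall x, `|f x| <= M) -> locally_integrable setT f.
Proof.
move=> mf fM; split => //; first exact: openT.
move=> K _ cK; have mK := compact_measurable cK.
apply: (@le_lt_trans _ _ (\int[mu]_(x in K) (cst M%:E x))%E).
  apply: ge0_le_integral => //=.
  - by apply: measurable_funTS; do 2 apply: measurableT_comp => //.
  - by move=> x _; rewrite lee_fin.
rewrite integral_cst// lte_mul_pinfty ?lee_fin//.
  by apply: le_trans (fM 0).
exact: compact_finite_measure.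
Qed.

Lemma kernel_tail_locally_integrable : locally_integrable setT kernel_tail.
Proof. exact: bounded_locally_integrable measurable_kernel_tail kernel_tail_bound. Qed.

Lemma L1Z (c : R) f : L1 f -> L1 (fun x => c * f x).
Proof. exact: integrableZl. Qed.

Lemma L1B f g : L1 f -> L1 g -> L1 (fun x => f x - g x).
Proof. exact: integrableB. Qed.

Lemma kernel_head_L1 : L1 kernel_head.
Proof.
(* The factor 1 - sigma turns this into the derivative of t^(1-sigma), whose increments on [0, 1]
   are at most 1. *)
pose f t : R := \1_(`]0, 1]%classic) t * ((1 - sigma) * t `^ (1 - sigma - 1)).
have f0 t : 0 <= f t by rewrite !mulr_ge0 ?powR_ge0 ?indicE// ltW.
have mf : measurable_fun setT f.
  apply: measurable_funM; first exact: mind.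
  by apply: measurable_funM => //; exact: measurable_powR.
have Lf : L1 f.
  apply: (@L1_exhaustion f (fun j => j.+2%:R^-1) (fun=> 1) 1) => //.
    move=> x; rewrite /f indic_itv in_itv/=; have [|] := leP x 0 => x0; first by rewrite mul0r eqxx.
    have [|] := leP x 1 => x1; last by rewrite mul0r eqxx.
    move=> _; near=> j; rewrite andbT.
    have h : x^-1 <= j.+2%:R.
      apply: (@le_trans _ _ j%:R); first by near: j; exact: nbhs_infty_ger.
      by rewrite ler_nat -addn2 leq_addr.
    by rewrite -[leRHS]invrK lef_pV2 ?posrE ?invr_gt0.
  move=> j; set u : R := j.+2%:R^-1.
  have u0 : 0 < u by rewrite invr_gt0.
  have u1 : u < 1 by rewrite invf_lt1// ltr1n.
  apply: (@le_trans _ _ (\int[mu]_(t in `[u, 1%R]) ((1 - sigma) * t `^ (1 - sigma - 1))%:E)%E).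
    apply: ge0_le_integral => //.
    - by move=> x _; rewrite lee_fin.
    - by apply: measurable_funTS; exact/measurable_EFinP.
    - by apply: measurable_funTS; apply/measurable_EFinP; apply: measurable_funM.
    by move=> x _; rewrite lee_fin ler_piMl ?mulr_ge0 ?powR_ge0 ?(ltW s1)// (le_trans
      (ler_norm _) (indic_bound _ _)).
  by rewrite (integral_powR _ u0 u1) lee_fin powR1 gerBl powR_ge0.
have Lg : L1 (fun t => \1_(`]0, 1]%classic) t * t : R).
  apply: (@bounded_supp_L1 _ _ 2 1).
  - by apply: measurable_funM => //; exact: mind.
  - move=> x x2; rewrite indic_itv in_itv/=.
    case: (boolP (0 < x <= 1)) => [/andP[x0 x1]|]; last by rewrite mul0r.
    by move: x2; rewrite gtr0_norm//; lra.
  - move=> x; rewrite indic_itv in_itv/=.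
    case: (boolP (0 < x <= 1)) => [/andP[x0 x1]|]; last by rewrite mul0r normr0.
    by rewrite mul1r gtr0_norm.
have := L1B (L1Z (1 - sigma)^-1 Lf) Lg; apply: eq_integrable => // t _ /=.
rewrite /kernel_head /f (_ : 1 - sigma - 1 = - sigma); last by ring.
by congr EFin; rewrite mulrCA mulKf ?gt_eqF// mulrBr.
Unshelve. all: by end_near.
Qed.

Lemma kernel_tail'_L1 : L1 kernel_tail'.
Proof.
pose f t : R := \1_(`]1, +oo[%classic) t * (sigma * t `^ (- sigma - 1)).
have f0 t : 0 <= f t by rewrite !mulr_ge0 ?powR_ge0 ?indicE.
have mf : measurable_fun setT f.
  apply: measurable_funM; first exact: mind.
  by apply: measurable_funM => //; exact: measurable_powR.
have Lf : L1 f.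
  apply: (@L1_exhaustion f (fun=> 1) (fun j => j.+2%:R) 1) => //.
    move=> x; rewrite /f indic_itv in_itv/= andbT.
    have [|] := ltP 1 x => x1; last by rewrite mul0r eqxx.
    move=> _; near=> j; rewrite (ltW x1)/=.
    apply: (@le_trans _ _ j%:R); first by near: j; exact: nbhs_infty_ger.
    by rewrite ler_nat -addn2 leq_addr.
  move=> j; set u : R := j.+2%:R.
  have u1 : 1 < u by rewrite ltr1n.
  apply: (@le_trans _ _ (\int[mu]_(t in `[1%R, u]) (sigma * t `^ (- sigma - 1))%:E)%E).
    apply: ge0_le_integral => //.
    - by move=> x _; rewrite lee_fin.
    - by apply: measurable_funTS; exact/measurable_EFinP.
    - by apply: measurable_funTS; apply/measurable_EFinP; apply: measurable_funM.
    by move=> x _; rewrite lee_fin ler_piMl ?mulr_ge0 ?powR_ge0// (le_trans (ler_norm _)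
      (indic_bound _ _)).
  (* Beyond 1 this antiderivative stays between -1 and 0, whence the bound 1, for sigma = 0 as
     well. *)
  have dF (x : R) : 1 <= x -> is_derive x (1 : R) (fun t : R => - t `^ (- sigma))
    (sigma * x `^ (- sigma - 1)).
    move=> x1; have x0 : 0 < x by exact: lt_le_trans x1.
    have := is_deriveN (is_derive1_powR (- sigma) x0).
    by rewrite mulNr opprK.
  have cf (x : R) : 1 <= x -> {for x, continuous (fun t : R => sigma * t `^ (- sigma - 1))}.
    move=> x1; apply: cvgMr; apply: continuous_powR.
    exact: lt_le_trans x1.
  rewrite (FTC2_C1 u1 dF cf).
  by rewrite -EFinB lee_fin opprK powR1 gerDr oppr_le0 powR_ge0.
have Lg : L1 (\1_(`]0, 1]%classic) : R -> R).
  apply: (@bounded_supp_L1 _ _ 2 1).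
  - exact: mind.
  - move=> x x2; rewrite indic_itv in_itv/=.
    case: (boolP (0 < x <= 1)) => [/andP[x0 x1]|//].
    by move: x2; rewrite gtr0_norm//; lra.
  - exact: indic_bound.
exact: L1B Lg Lf.
Unshelve. all: by end_near.
Qed.

(** With the half-open interval written as a factor, adjacent intervals are disjoint and their
    contributions add up inside one integral over the line. *)
Lemma FTC2_indic (F f : R -> R) u v : u < v ->
  (forall x, u <= x -> is_derive x 1 F (f x)) ->
  (forall x, u <= x -> {for x, continuous f}) ->
  L1 (fun t => \1_(`]u, v]%classic) t * f t) /\
  \int[mu]_t (\1_(`]u, v]%classic) t * f t) = F v - F u.
Proof.
move=> uv dF cf.
have If : mu.-integrable `[u, v] (EFin \o f).
  apply: continuous_compact_integrable; first exact: segment_compact.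
  apply: continuous_in_subspaceT => x /[!inE] /=; rewrite in_itv/= => /andP[ux _].
  exact: cf.
have If' : mu.-integrable `]u, v] (EFin \o f).
  apply: integrableS If => //; exact: subset_itv_oc_cc.
have E : (fun t => (\1_(`]u, v]%classic) t * f t)%:E) = (EFin \o f) \_ `]u, v].
  apply/funext => t; rewrite patchE indicE; case: ifP => _; first by rewrite mul1r.
  by rewrite mul0r.
have muv : @measurable _ (measurableTypeR R) `]u, v]%classic by exact: measurable_itv.
split.
  have := (@integrable_mkcond _ _ _ mu _ (EFin \o f) muv).1 If'.
  by rewrite -E.
rewrite /Rintegral E -integral_mkcond integral_itv_obnd_cbnd; last first.
  exact: measurable_int If'.
by rewrite (FTC2_C1 uv dF cf).
Qed.

(** The products t psi(t) on [0, 1] and t^(-sigma) psi(t) on [1, v] are treated separately. The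
    boundary terms at 1 cancel, the one at 0 carries the factor t, and v = B + 1 lies beyond the
    supports of psi and its derivative. *)
Lemma kernel_tail_parts (psi : R -> R) : C0inf psi ->
  \int[mu]_t (kernel_tail t * derive1 psi t) = - \int[mu]_t (kernel_tail' t * psi t).
Proof.
move=> cpsi; have /C0infP[ipsi [B B0 psiB]] := cpsi.
have cpsi' : C0inf (derive1 psi) by exact: (C0inf_derive1n 1 cpsi).
have [ipsi' _] := cpsi'.
have dpsi x : is_derive x (1 : R) psi (derive1 psi x).
  by apply: is_derive_derive1; exact: Cinf_derivable.
have cv x : {for x, continuous psi} by exact: Cinf_continuous.
have cv' x : {for x, continuous (derive1 psi)} by exact: Cinf_continuous.
pose v := B + 1.
have v1 : 1 < v by rewrite /v; lra.
have dF1 x : 0 <= x -> is_derive x 1 (fun t => t * psi t) (psi x + x * derive1 psi x).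
  move=> _; apply: is_derive_eq (is_deriveM (is_derive_id x 1) (dpsi x)) _.
  by rewrite /GRing.scale/= mulr1 addrC.
have cf1 x : 0 <= x -> {for x, continuous (fun t => psi t + t * derive1 psi t)}.
  by move=> _; apply: cvgD; [exact: cv|apply: cvgM; [exact: cvg_id|exact: cv']].
have [L_1 I_1] := FTC2_indic ltr01 dF1 cf1.
have dF2 x : 1 <= x -> is_derive x 1 (fun t => t `^ (- sigma) * psi t)
    (x `^ (- sigma) * derive1 psi x + psi x * (- sigma * x `^ (- sigma - 1))).
  move=> x1; have x0 : 0 < x by exact: lt_le_trans x1.
  exact: (is_deriveM (is_derive1_powR (- sigma) x0) (dpsi x)).
have cf2 x : 1 <= x -> {for x, continuous
    (fun t => t `^ (- sigma) * derive1 psi t + psi t * (- sigma * t `^ (- sigma - 1)))}.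
  move=> x1; have x0 : 0 < x by exact: lt_le_trans x1.
  apply: cvgD; first by apply: cvgM; [exact: continuous_powR|exact: cv'].
  apply: cvgM; first exact: cv.
  by apply: cvgMr; exact: continuous_powR.
have [L_2 I_2] := FTC2_indic v1 dF2 cf2.
have L_3 := locally_integrable_mul_C0inf kernel_tail_locally_integrable cpsi'.
have L_4 : L1 (fun t => kernel_tail' t * psi t).
  apply: locally_integrable_mul_C0inf cpsi.
  exact: (open_integrable_locally openT kernel_tail'_L1).
apply/eqP; rewrite -subr_eq0 opprK -RintegralD//; apply/eqP.
transitivity (\int[mu]_t ((\1_(`]0, 1]%classic) t * (psi t + t * derive1 psi t)) +
  (\1_(`]1, v]%classic) t * (t `^ (- sigma) * derive1 psi t + psi t * (- sigma * t `^
    (- sigma - 1)))))).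
  apply: eq_Rintegral => t _; rewrite /kernel_tail /kernel_tail' !indic_itv !in_itv/= !andbT.
  have [tv|tv] := leP t v; first by rewrite andbT; ring.
  have Bt : B + 1 <= `|t| by rewrite -/v ltW// (lt_le_trans tv)// ler_norm.
  rewrite psiB; last by move: Bt; lra.
  rewrite (supp_bound_derive1 psiB Bt) !mulr0 !mul0r !addr0 mulr0; lra.
have pv : psi v = 0 by apply: psiB; rewrite ger0_norm /v; lra.
rewrite RintegralD// I_1 I_2 pv.
by rewrite mul0r mul1r powR1 mul1r mulr0; lra.
Qed.

Lemma frac_kernel_locally_integrable : locally_integrable setT frac_kernel.
Proof.
rewrite (_ : frac_kernel = kernel_head \+ kernel_tail); last first.
  by apply/funext => t; exact: frac_kernelE.
apply: locally_integrableD; last exact: kernel_tail_locally_integrable.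
exact: (open_integrable_locally openT kernel_head_L1).
Qed.

(** Only the tail is integrated by parts; the head leaves the derivative on [phi], because its
    singularity at 0 is integrable while the derivative of that singularity in general is not. *)
Lemma conv_frac_kernel phi : C0inf phi ->
  conv frac_kernel (derive1 phi) =
  conv kernel_head (derive1 phi) \+ conv kernel_tail' phi.
Proof.
move=> cphi; apply/funext => x; rewrite /conv/=.
have cphi' : C0inf (derive1 phi) by exact: (C0inf_derive1n 1 cphi).
have [iphi _] := cphi.
pose psi t := phi (x - t); have cpsi : C0inf psi by exact: C0inf_reflect.
have psi' : derive1 psi = (fun t => - derive1 phi (x - t)).
  rewrite /psi (_ : (fun t => _) = (fun t => phi (- 1 * t + x))); last first.
    by apply/funext => t; rewrite mulN1r addrC.
  rewrite derive1_affine; last exact: Cinf_derivable.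
  by apply/funext => t; rewrite !mulN1r addrC.
have mphi' := C0inf_measurable (C0inf_reflect x cphi').
have L_1 : L1 (fun t => kernel_head t * derive1 phi (x - t)).
  apply: (locally_integrable_mul_C0inf _ (C0inf_reflect x cphi')).
  exact: (open_integrable_locally openT kernel_head_L1).
have L_2 : L1 (fun t => kernel_tail t * derive1 phi (x - t)).
  exact: (locally_integrable_mul_C0inf kernel_tail_locally_integrable (C0inf_reflect x cphi')).
transitivity (\int[mu]_t (kernel_head t * derive1 phi (x - t)) +
    \int[mu]_t (kernel_tail t * derive1 phi (x - t))).
  by rewrite -RintegralD//; apply: eq_Rintegral => t _; rewrite frac_kernelE mulrDl.
congr (_ + _); have := kernel_tail_parts cpsi; rewrite psi'.
under eq_Rintegral do rewrite mulrN -mulN1r.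
rewrite RintegralMl; last exact: measurable_funM measurable_kernel_tail mphi'.
by rewrite mulN1r => /oppr_inj.
Qed.

End power_kernels.

(** * Fractional derivatives *)

Section frac_derivatives.
Context {R : realType}.
Local Notation mu := (@lebesgue_measure R).
Local Notation L1 k := (mu.-integrable setT (EFin \o k)).
Implicit Types (f g k phi : R -> R) (x t u v c : R) (s : side).

Definition reflect f x : R := f (- x).

(** The right-sided potential is the convolution with the reflected kernel, so the two signs of the
    theorem differ only by [reflect]. *)
Definition orient s f : R -> R := if s is left_side then f else reflect f.

Lemma measurable_reflect f : measurable_fun setT f -> measurable_fun setT (reflect f).
Proof. by move=> mf; exact: (measurableT_comp mf). Qed.

Lemma conv_reflect k f : measurable_fun setT k -> measurable_fun setT f ->
  conv (reflect k) f = reflect (conv k (reflect f)).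
Proof.
move=> mk mf; apply/funext => x; rewrite /reflect /conv.
rewrite -[RHS](Rintegral_reflect 0); last first.
  apply: measurable_funM => //; apply: (measurableT_comp mf).
  by apply: measurableT_comp => //; exact: measurable_funB.
by apply: eq_Rintegral => t _; rewrite sub0r; congr (_ * f _); ring.
Qed.

Lemma reflect_L1 k : L1 k -> L1 (reflect k).
Proof.
move=> Lk; have mk := integrable_measurable Lk.
apply: integrable_absP; first exact: measurable_reflect.
have mk' : measurable_fun setT (fun x => `|k x|%:E).
  by apply/measurable_EFinP; exact: measurableT_comp.
have := integrable_abs_lty Lk; rewrite -(integral_reflect 0 mk').
by under eq_integral do rewrite sub0r.
Qed.

Lemma derive1_reflect f : (forall x, derivable f x 1) ->
  derive1 (reflect f) = (fun x => - reflect (derive1 f) x).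
Proof.
move=> df; rewrite (_ : reflect f = (fun x => f (-1 * x + 0))); last first.
  by apply/funext => x; rewrite mulN1r addr0.
by rewrite derive1_affine//; apply/funext => x; rewrite !mulN1r addr0.
Qed.

Lemma C0inf_reflect0 f : C0inf f -> C0inf (reflect f).
Proof.
rewrite (_ : reflect f = (fun x => f (0 - x))); first exact: C0inf_reflect.
by apply/funext => x; rewrite sub0r.
Qed.

Lemma convZl c k f : measurable_fun setT k -> measurable_fun setT f ->
  conv (fun t => c * k t) f = (fun x => c * conv k f x).
Proof.
move=> mk mf; apply/funext => x; rewrite /conv.
under eq_Rintegral do rewrite -mulrA.
by rewrite RintegralMl//; apply: measurable_funM => //; exact: measurable_slice.
Qed.

Section potential.
Variable sigma : R.
Hypothesis sigma01 : 0 <= sigma < 1.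

Lemma orient_frac_kernel_locally_integrable s :
  locally_integrable setT (orient s (frac_kernel sigma)).
Proof.
have L := kernel_head_L1 sigma01; have s0 : 0 <= sigma by case/andP: sigma01.
case: s => /=; first exact: frac_kernel_locally_integrable.
rewrite (_ : reflect _ = reflect (kernel_head sigma) \+ reflect (kernel_tail sigma)); last first.
  by apply/funext => t; exact: frac_kernelE.
apply: locally_integrableD.
  exact: (open_integrable_locally openT (reflect_L1 L)).
apply: (@bounded_locally_integrable _ _ 1).
  exact: measurable_reflect (measurable_kernel_tail sigma).
by move=> x; exact: kernel_tail_bound.
Qed.

Lemma conv_orient_frac_kernel s : exists2 k1, L1 k1 & exists2 k2, L1 k2 &
  forall phi, C0inf phi ->
    conv (orient s (frac_kernel sigma)) (derive1 phi) =
    conv k1 (derive1 phi) \+ conv k2 phi.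
Proof.
have L := kernel_head_L1 sigma01; have L' := kernel_tail'_L1 sigma01.
have [lf _ _] := frac_kernel_locally_integrable sigma01.
case: s => /=.
  exists (kernel_head sigma) => //; exists (kernel_tail' sigma) => // phi.
  exact: conv_frac_kernel.
exists (reflect (kernel_head sigma)); first exact: reflect_L1.
(* Reflection anticommutes with differentiation: the head term absorbs the sign in [derive1 phi],
   whereas the tail term has lost its derivative and keeps it. *)
exists (fun t => (-1) * reflect (kernel_tail' sigma) t); first exact/L1Z/reflect_L1.
move=> phi cphi; have dphi := Cinf_derivable (C0inf_Cinf cphi).
have cphi' : C0inf (derive1 phi) by exact: (C0inf_derive1n 1 cphi).
have mphi := C0inf_measurable cphi; have mphi' := C0inf_measurable cphi'.
have crphi := C0inf_reflect0 cphi.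
rewrite convZl//; last exact: measurable_reflect (integrable_measurable L').
rewrite !conv_reflect//; try exact: integrable_measurable.
have -> : reflect (derive1 phi) = (fun x => (-1) * derive1 (reflect phi) x).
  by rewrite derive1_reflect//; apply/funext => x; rewrite mulN1r opprK.
have mrphi' : measurable_fun setT (derive1 (reflect phi)).
  exact: C0inf_measurable (C0inf_derive1n 1 crphi).
have mN : measurable_fun setT (fun x => -1 * derive1 (reflect phi) x).
  exact: measurable_funM.
have convN k : measurable_fun setT k -> conv k (fun x => (-1) * derive1 (reflect phi) x) =
    (fun x => (-1) * conv k (derive1 (reflect phi)) x).
  by move=> mk; rewrite convC// convZl// convC.
rewrite !convN//; last exact: integrable_measurable.
rewrite conv_frac_kernel//; apply/funext => x /=.
by rewrite /reflect/= mulrDr.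
Qed.

Lemma measurable_frac_integrand phi c x : measurable_fun setT phi ->
  measurable_fun setT (fun y => phi y / (c * (x - y)) `^ sigma).
Proof.
move=> mphi; apply: measurable_funM => //.
under eq_fun do rewrite -powRN.
apply: (measurableT_comp (measurable_powR _)).
by apply: measurable_funM => //; exact: measurable_funB.
Qed.

Lemma left_potentialE phi x : measurable_fun setT phi ->
  \int[mu]_(y in `]-oo, x]) (phi y / (x - y) `^ sigma) = conv (frac_kernel sigma) phi x.
Proof.
move=> mphi; have [mk _ _] := frac_kernel_locally_integrable sigma01.
rewrite convC// /conv /Rintegral; congr fine.
(* The kernel is supported on an open half-line and the potential integrates up to its endpoint, a
   null set. *)
rewrite -integral_itv_bndo_bndc; last first.
  apply: measurable_funTS; apply/measurable_EFinP.
  by have := measurable_frac_integrand 1 x mphi; under eq_fun do rewrite mul1r.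
rewrite [LHS]integral_mkcond; apply: eq_integral => y _.
rewrite patchE /frac_kernel indicE !mem_setE !in_itv/= andbT subr_gt0.
by case: ifP => _; rewrite ?mul1r// mul0r mulr0.
Qed.

Lemma right_potentialE phi x : measurable_fun setT phi ->
  \int[mu]_(y in `[x, +oo[) (phi y / (y - x) `^ sigma) =
  conv (reflect (frac_kernel sigma)) phi x.
Proof.
move=> mphi; have [mk _ _] := frac_kernel_locally_integrable sigma01.
rewrite convC//; last exact: measurable_reflect.
rewrite /conv /Rintegral; congr fine.
rewrite -integral_itv_obnd_cbnd; last first.
  apply: measurable_funTS; apply/measurable_EFinP.
  by have := measurable_frac_integrand (-1) x mphi; under eq_fun do rewrite mulN1r opprB.
rewrite [LHS]integral_mkcond; apply: eq_integral => y _.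
rewrite patchE /reflect /frac_kernel opprB indicE !mem_setE !in_itv/= !andbT subr_gt0.
by case: ifP => _; rewrite ?mul1r// mul0r mulr0.
Qed.

End potential.

(** All [a] + 1 outer derivatives fall on [phi], since convolution with a locally integrable kernel
    commutes with them. The last one is then spent on the tail of the kernel, and sign and Gamma
    factor are absorbed into [k1] and [k2]. *)
Lemma frac_deriv_conv s (a : R) : 0 < a ->
  exists2 k1, L1 k1 & exists2 k2, L1 k2 & forall phi, C0inf phi ->
    frac_deriv s a phi =
    conv k1 (derive1n (Num.truncn a).+1 phi) \+ conv k2 (derive1n (Num.truncn a) phi).
Proof.
move=> a0; set m := Num.truncn a; set sigma := a - m.+1%:R + 1.
have sigma01 : 0 <= sigma < 1.
  have /andP[] := truncn_itv (ltW a0); rewrite -/m /sigma -natr1; lra.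
have [k1 L_1 [k2 L_2 k12]] := conv_orient_frac_kernel sigma01 s.
pose c : R := (if s is left_side then 1 else (-1) ^+ m.+1) / Gamma_fun (m.+1%:R - a).
exists (fun t => c * k1 t); first exact: L1Z.
exists (fun t => c * k2 t); first exact: L1Z.
move=> phi cphi; have mphi := C0inf_measurable cphi.
have cm := C0inf_derive1n m cphi; have cm1 := C0inf_derive1n m.+1 cphi.
rewrite (convZl c (integrable_measurable L_1) (C0inf_measurable cm1)).
rewrite (convZl c (integrable_measurable L_2) (C0inf_measurable cm)).
have -> : frac_deriv s a phi =
    (fun x => c * derive1n m.+1 (conv (orient s (frac_kernel sigma)) phi) x).
  rewrite /frac_deriv -/m -/sigma /c; case: s {k12 c} => /=; apply/funext => x.
    rewrite mul1r; apply: (congr1 (fun h : R -> R => _ * derive1n m.+1 h x)).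
    by apply/funext => y; exact: left_potentialE.
  apply: (congr1 (fun h : R -> R => _ * derive1n m.+1 h x)).
  by apply/funext => y; exact: right_potentialE.
rewrite derive1n_conv//; last exact: orient_frac_kernel_locally_integrable.
by rewrite derive1nS k12//; apply/funext => x; rewrite /= mulrDr.
Qed.

End frac_derivatives.

(** * Classical and fractional weak derivatives *)

Section weak_derivatives.
Context {R : realType}.
Variable p : R.
Hypothesis p1 : 1 <= p.
Local Notation mu := (@lebesgue_measure R).
Local Notation L1 k := (mu.-integrable setT (EFin \o k)).
Implicit Types (u v w f g k phi : R -> R) (s : side) (a : R).

Lemma C0inf_integral_derive1 g : C0inf g -> \int[mu]_x derive1 g x = 0.
Proof.
move=> cg; have /C0infP[ig [B B0 gB]] := cg.
have [_ ig'] := (CinfS g).1 ig.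
have uv : - (B + 1) < B + 1 by lra.
have dF (x : R) : - (B + 1) <= x -> is_derive x (1 : R) g (derive1 g x).
  by move=> _; apply: is_derive_derive1; exact: Cinf_derivable.
have cf (x : R) : - (B + 1) <= x -> {for x, continuous (derive1 g)}.
  by move=> _; exact: Cinf_continuous.
have [_] := FTC2_indic uv dF cf.
rewrite gB ?gB ?subr0; [|by rewrite normrN ger0_norm; lra|by rewrite ger0_norm; lra].
move=> <-; apply: eq_Rintegral => x _; rewrite indicE mem_setE in_itv/=.
case: (boolP (_ && _)) => [_|xB]; first by rewrite mul1r.
rewrite mul0r; apply: (supp_bound_derive1 gB).
move: xB; rewrite negb_and -leNgt -ltNge => /orP[xB|xB].
  by rewrite ler0_norm; lra.
by rewrite ger0_norm; lra.
Qed.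

Lemma continuous_locally_integrable f : continuous f -> locally_integrable setT f.
Proof.
move=> cf; split; [exact: continuous_measurable_fun|exact: openT|move=> K _ cK].
have /integrableP[_] : mu.-integrable K (EFin \o f).
  by apply: continuous_compact_integrable => //; exact: continuous_subspaceT.
by [].
Qed.

Lemma C0inf_parts w phi : Cinf w -> C0inf phi ->
  \int[mu]_x (derive1 w x * phi x) = - \int[mu]_x (w x * derive1 phi x).
Proof.
move=> iw cphi; have iphi := C0inf_Cinf cphi.
have cphi' : C0inf (derive1 phi) by exact: (C0inf_derive1n 1 cphi).
have [_ iw'] := (CinfS w).1 iw.
have lw := continuous_locally_integrable (Cinf_continuous iw).
have lw' := continuous_locally_integrable (Cinf_continuous iw').
have c : C0inf (w \* phi).
  have -> : w \* phi = phi \* w by apply/funext => x; exact: mulrC.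
  exact: C0infM.
have := C0inf_integral_derive1 c.
rewrite derive1_mul; try exact: Cinf_derivable.
rewrite RintegralD//; last 2 first.
- exact: locally_integrable_mul_C0inf.
- exact: locally_integrable_mul_C0inf.
by move=> /eqP; rewrite addr_eq0 => /eqP.
Qed.

Lemma Cinf_weak_op n w : Cinf w -> weak_op (deriv_op n) w (derive1n n w).
Proof.
move=> iw; split.
  by apply: continuous_locally_integrable; apply: Cinf_continuous; exact: Cinf_derive1n.
have mw := Cinf_measurable iw.
elim: n => [|n ih] phi cphi.
  by apply: eq_Rintegral => x _; rewrite /deriv_op expr0 mul1r.
have cphi' : C0inf (derive1 phi) by exact: (C0inf_derive1n 1 cphi).
rewrite derive1nS (C0inf_parts (Cinf_derive1n iw) cphi) (ih _ cphi') -mulN1r -RintegralMl;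
  last first.
  by apply: measurable_funM => //; apply: measurable_funM => //; apply: C0inf_measurable;
    exact: C0inf_derive1n.
by apply: eq_Rintegral => x _; rewrite /deriv_op derive1Sn exprS; ring.
Qed.

Lemma conv_adjoint k f g : L1 k -> Lp p f -> dual p g ->
  \int[mu]_x (f x * conv k g x) = \int[mu]_x (conv (reflect k) f x * g x).
Proof.
move=> Lk pf dg; have mk := integrable_measurable Lk; have [mg _] := dg.
have mf := Lp_measurable pf.
rewrite (pairing_conv p1 Lk pf dg) (conv_pairing p1 (reflect_L1 Lk) pf dg).
rewrite -[LHS](Rintegral_reflect 0); last first.
  apply: measurable_funM => //; apply: measurable_Rintegral2.
  apply: measurable_funM; first exact: (measurableT_comp mf).
  by apply: (measurableT_comp mg); exact: measurable_funB.
by apply: eq_Rintegral => t _; rewrite sub0r.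
Qed.

Lemma conv_shift k f (t : R) :
  conv k (fun x => f (x - t)) = (fun x => conv k f (x - t)).
Proof.
by apply/funext => x; apply: eq_Rintegral => y _; rewrite addrAC.
Qed.

Definition frac_op s a phi (x : R) : R :=
  (-1) ^+ Num.truncn a * frac_deriv (opposite s) a phi x.

Lemma frac_op_dual s a phi : 0 < a -> C0inf phi -> dual p (frac_op s a phi).
Proof.
move=> a0 cphi; have [k1 L_1 [k2 L_2 k12]] := frac_deriv_conv (opposite s) a0.
apply: dualZ => //; rewrite k12//; apply: dualD => //.
- by apply: dual_conv => //; apply: C0inf_dual => //; exact: C0inf_derive1n.
- by apply: dual_conv => //; apply: C0inf_dual => //; exact: C0inf_derive1n.
Qed.

Lemma frac_op_admissible s a : 0 < a -> admissible p (frac_op s a).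
Proof.
move=> a0; split => [phi|phi t cphi]; first exact: frac_op_dual.
have [k1 L_1 [k2 L_2 k12]] := frac_deriv_conv (opposite s) a0.
have iphi := C0inf_Cinf cphi.
rewrite /frac_op (k12 _ cphi) (k12 _ (C0inf_shift t cphi)).
move: (Num.truncn a) {k12} => m.
rewrite (derive1n_shift m t iphi) (derive1n_shift m.+1 t iphi).
by rewrite (conv_shift k1 (derive1n m.+1 phi) t) (conv_shift k2 (derive1n m phi) t).
Qed.

Lemma is_weak_frac_derivE s a u v : 0 < a -> measurable_fun setT u ->
  is_weak_frac_deriv s a u v <-> weak_op (frac_op s a) u v.
Proof.
move=> a0 mu_; rewrite /is_weak_frac_deriv /weak_op.
have [k1 L_1 [k2 L_2 k12]] := frac_deriv_conv (opposite s) a0.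
have E phi : C0inf phi ->
    (-1) ^+ Num.truncn a * \int[mu]_x (u x * frac_deriv (opposite s) a phi x) =
    \int[mu]_x (u x * frac_op s a phi x).
  move=> cphi; rewrite -RintegralMl.
    by apply: eq_Rintegral => x _; rewrite /frac_op mulrCA.
  apply: measurable_funM => //; rewrite k12//; apply: measurable_funD;
    by apply: measurable_conv; [exact: integrable_measurable|
       apply: C0inf_measurable; exact: C0inf_derive1n].
by split => -[lv uv]; split => // phi cphi; rewrite uv// E.
Qed.

(* By duality, D^a w is a combination of convolutions of L^1 kernels with the
   classical weak derivatives of orders [a] and [a] + 1. *)
Lemma weak_frac_deriv_bound s a : 0 < a -> exists2 C : R, 0 <= C &
  forall w wm wn, Lp p w -> Lp p wm -> Lp p wn ->
    weak_op (deriv_op (Num.truncn a)) w wm ->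
    weak_op (deriv_op (Num.truncn a).+1) w wn ->
    exists v, [/\ weak_op (frac_op s a) w v, Lp p v &
      (Lp_norm p v <= C%:E * (Lp_norm p wm + Lp_norm p wn))%E].
Proof.
move=> a0; set m := Num.truncn a.
have [k1 L_1 [k2 L_2 k12]] := frac_deriv_conv (opposite s) a0.
have rL_1 := reflect_L1 L_1; have rL_2 := reflect_L1 L_2.
exists (L1norm (reflect k1) + L1norm (reflect k2)).
  by rewrite addr_ge0// L1norm_ge0.
move=> w wm wn pw pwm pwn w_m w_n.
have [pv1 nv1] := Lp_conv p1 rL_1 pwn; have [pv2 nv2] := Lp_conv p1 rL_2 pwm.
have pv : Lp p (conv (reflect k2) wm \- conv (reflect k1) wn) by exact: LpB.
(* Moving m derivatives off [phi] cancels the sign (-1)^m of the operator; the additional one in the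
   [k1] term leaves the minus sign. *)
exists (conv (reflect k2) wm \- conv (reflect k1) wn); split => //.
- split; first exact: Lp_locally_integrable pv.
  move=> phi cphi.
  have [_ w1] := weak_op_conv p1 (deriv_op_admissible p1 m.+1) rL_1 pw pwn w_n.
  have [_ w2] := weak_op_conv p1 (deriv_op_admissible p1 m) rL_2 pw pwm w_m.
  have d0 := C0inf_dual p1 cphi.
  have d1 := C0inf_dual p1 (C0inf_derive1n m.+1 cphi).
  have d2 := C0inf_dual p1 (C0inf_derive1n m cphi).
  have dk1 := dual_conv p1 L_1 d1; have dk2 := dual_conv p1 L_2 d2.
  have sg (q : nat) f : dual p (derive1n q phi) -> Lp p f ->
      \int[mu]_x (f x * derive1n q phi x) = (-1) ^+ q * \int[mu]_x (f x * deriv_op q phi x).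
    move=> dq pf; rewrite -RintegralMl; last first.
      apply: measurable_funM; first exact: Lp_measurable pf.
      by apply: measurable_funM => //; case: dq.
    by apply: eq_Rintegral => x _; rewrite /deriv_op [RHS]mulrCA signrMK.
  have [pu1 _] := Lp_conv p1 rL_1 pw; have [pu2 _] := Lp_conv p1 rL_2 pw.
  under eq_Rintegral do rewrite mulrBl.
  rewrite RintegralB//; last 2 first.
  + exact: dual_integrable pv2 d0.
  + exact: dual_integrable pv1 d0.
  transitivity ((-1) ^+ m * (\int[mu]_x (w x * conv k1 (derive1n m.+1 phi) x) +
      \int[mu]_x (w x * conv k2 (derive1n m phi) x))).
    rewrite (conv_adjoint L_1 pw d1) (conv_adjoint L_2 pw d2).
    rewrite (sg m.+1 _ d1 pu1) (sg m _ d2 pu2) -(w1 _ cphi) -(w2 _ cphi).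
    by rewrite exprS mulN1r mulNr mulrDr mulrN !signrMK addrC.
  rewrite -RintegralD//; last 2 first.
  + exact: dual_integrable pw dk1.
  + exact: dual_integrable pw dk2.
  rewrite -RintegralMl; last first.
    have [mk1 _] := dk1; have [mk2 _] := dk2; have mw := Lp_measurable pw.
    by apply: measurable_funD; exact: measurable_funM.
  by apply: eq_Rintegral => x _; rewrite /frac_op k12//=; ring.
- apply: le_trans (Lp_normB p1 (Lp_measurable pv2) (Lp_measurable pv1)) _.
  have [[c1_0 c2_0] [n1_0 n2_0]] := ((L1norm_ge0 (reflect k1), L1norm_ge0 (reflect k2)),
     (Lp_norm_ge0 p wm, Lp_norm_ge0 p wn)).
  rewrite EFinD ge0_muleDl ?lee_fin// addeC; apply: leeD.
    by apply: le_trans nv1 _; apply: lee_wpmul2l; rewrite ?lee_fin// leeDr.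
  by apply: le_trans nv2 _; apply: lee_wpmul2l; rewrite ?lee_fin// leeDl.
Qed.

End weak_derivatives.

(** * Completeness of Lp *)

Section Lp_completeness.
Context {R : realType}.
Variable p : R.
Hypothesis p1 : 1 <= p.
Local Notation mu := (@lebesgue_measure R).
Implicit Types (f : R -> R) (F g : nat -> R -> R).

Let p0 : 0 < p. Proof. exact: lt_le_trans p1. Qed.

Lemma nneseries_le_of_partial (u : nat -> \bar R) (M : \bar R) :
  (forall k, 0 <= u k)%E -> (forall n, \sum_(0 <= k < n) u k <= M)%E ->
  (\sum_(0 <= k <oo) u k <= M)%E.
Proof.
move=> u0 uM; apply: lime_le; first exact: is_cvg_nneseries.
exact: nearW.
Qed.

Lemma sum_geometric_le (C : R) n : 0 <= C ->
  \sum_(0 <= k < n) (C * 2^-1 ^+ k) <= C * 2.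
Proof.
move=> C0; have -> : \sum_(0 <= k < n) (C * 2^-1 ^+ k) = C * (2 - 2 * 2^-1 ^+ n).
  elim: n => [|n ih]; first by rewrite big_geq// expr0 mulr1 subrr mulr0.
  by rewrite big_nat_recr//= ih exprS; lra.
by rewrite ler_wpM2l// gerBl mulr_ge0// exprn_ge0.
Qed.

(** Pairing the increments with the indicator of [-B, B], a member of the dual class, trades L^p for
    L^1: their absolute sum is integrable there, so the telescoping series converges absolutely
    almost everywhere. *)
Lemma ae_cvg_increments g : (forall k, Lp p (g k)) ->
  (forall k, (Lp_norm p (g k.+1 \- g k)%R <= (2^-1 ^+ k)%:E)%E) ->
  {ae mu, forall x, cvgn (g ^~ x)}.
Proof.
move=> pg gk.
have mg k : measurable_fun setT (g k) by exact: Lp_measurable (pg k).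
suff h (B : nat) : {ae mu, forall x, `|x| <= B%:R -> cvgn (g ^~ x)}.
  have := ae_foralln h; apply: ae_imply => x; apply.
  exact: ltW (archi_boundP (normr_ge0 x)).
pose w (x : R) : R := \1_(`[(- B%:R)%R, B%:R]%classic) x.
have w1 x : `|x| <= B%:R -> w x = 1.
  by move=> xB; rewrite /w indicE mem_set//= in_itv/= -ler_norml.
have mw : measurable_fun setT w by exact: measurable_indic.
have [_ [C [C0 wC]]] : dual p w.
  apply: (@bounded_supp_dual _ p w (B%:R + 1) 1) => // x.
    move=> xB; rewrite /w indicE mem_setE in_itv/= -ler_norml.
    by rewrite leNgt (lt_le_trans _ xB) ?ltrDl.
  by rewrite /w indicE normr_nat lern1; case: (_ \in _).
pose h (k : nat) (x : R) : \bar R := `|(g k.+1 x - g k x) * w x|%:E.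
have mh k : measurable_fun setT (h k).
  apply/measurable_EFinP; apply: measurableT_comp => //.
  by apply: measurable_funM => //; exact: measurable_funB.
have h0 k x : (0 <= h k x)%E by rewrite lee_fin.
have hC : (\int[mu]_x (\sum_(0 <= k <oo) h k x) <= (C * 2)%:E)%E.
  rewrite integral_nneseries//.
  apply: nneseries_le_of_partial => [k|n]; first exact: integral_ge0.
  apply: (@le_trans _ _ (\sum_(0 <= k < n) (C * 2^-1 ^+ k)%:E)%E).
    apply: lee_sum => k _; apply: le_trans (wC (g k.+1 \- g k) (LpB p1 (pg _) (pg _))) _.
    by rewrite EFinM; apply: lee_wpmul2l; rewrite ?lee_fin.
  by rewrite sumEFin lee_fin sum_geometric_le.
have Ih : mu.-integrable setT (fun x => \sum_(0 <= k <oo) h k x)%E.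
  apply/integrableP; split; first by apply: (@ge0_emeasurable_sum _ _ R setT h xpredT).
  under eq_integral do rewrite gee0_abs ?nneseries_ge0//.
  by apply: le_lt_trans hC _; rewrite ltry.
apply: ae_imply (integrable_ae measurableT Ih) => x /(_ I) hx xB.
have : cvgn (series (telescope (g ^~ x))).
  apply: normed_cvg; apply: nondecreasing_is_cvgn.
    by apply/nondecreasing_seqP => n; rewrite /normed_series_of [leRHS]big_nat_recr//= lerDl.
  exists (fine (\sum_(0 <= k <oo) h k x)%E) => _ [n _ <-].
  rewrite -lee_fin fineK// /normed_series_of -sumEFin.
  apply: le_trans (@nneseries_lim_ge _ (fun k => h k x) xpredT 0 n _) => //.
  by apply: lee_sum => k _; rewrite lee_fin /telescope/= w1// mulr1.
rewrite telescopeK => /cvg_ex[l gl]; apply/cvg_ex; exists (l + g 0 x).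
have -> : g ^~ x = (fun n => (g n x - g 0 x) + g 0 x) by apply/funext => n; rewrite subrK.
by apply: cvgD => //; exact: cvg_cst.
Qed.

Lemma Lp_complete F : (forall j, Lp p (F j)) ->
  (forall e : R, 0 < e -> exists K, forall j k, (K <= j)%N -> (K <= k)%N ->
    (Lp_norm p (F j \- F k)%R <= e%:E)%E) ->
  exists2 f, Lp p f & Lp_cvg p F f.
Proof.
move=> pF cF.
have /choice[K hK] : forall k, exists K, forall i j, (K <= i)%N -> (K <= j)%N ->
    (Lp_norm p (F i \- F j)%R <= (2^-1 ^+ k)%:E)%E.
  by move=> k; apply: cF; rewrite exprn_gt0.
(* Summing the thresholds makes the indices nondecreasing and at least [K k]; the summand [k] makes
   them unbounded. *)
pose nK k := (\sum_(i < k.+1) K i + k)%N.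
have nKS k : (nK k <= nK k.+1)%N.
  by rewrite /nK [in leqRHS]big_ord_recr/= -addnA leq_add2l addnS leqW// leq_addl.
have KnK k : (K k <= nK k)%N by rewrite /nK big_ord_recr/= addnAC leq_addl.
have knK k : (k <= nK k)%N by rewrite /nK leq_addl.
pose g k := F (nK k).
have pg k : Lp p (g k) by exact: pF.
have gk k : (Lp_norm p (g k.+1 \- g k)%R <= (2^-1 ^+ k)%:E)%E.
  by apply: hK => //; apply: leq_trans (nKS k).
have cg := ae_cvg_increments pg gk.
(* The upper limit is measurable on the whole line and agrees with the limit wherever the
   subsequence converges. *)
pose f x := fine (limn_esup (fun k => (g k x)%:E)).
have mf : measurable_fun setT f.
  apply: (measurableT_comp (fine_measurable measurableT)).
  apply: measurable_fun_limn_esup => k; apply/measurable_EFinP.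
  exact: Lp_measurable (pg k).
have gf : {ae mu, forall x, g k x @[k --> \oo] --> f x}.
  apply: ae_imply cg => x /cvg_ex[l gl].
  have gl' : (fun k => (g k x)%:E) @ \oo --> l%:E by apply: cvg_EFin => //; exact: nearW.
  by rewrite /f (cvg_limn_einf_sup gl').2.
have bound (e : R) : 0 < e -> exists K, forall j, (K <= j)%N ->
    (\int[mu]_x (`|F j x - f x| `^ p)%:E <= (e `^ p)%:E)%E.
  move=> e0; have [M hM] := cF e e0; exists M => j Mj.
  apply: (@ae_fatou _ (fun k x => (`|F j x - g k x| `^ p)%:E)).
  - move=> k; apply: measurable_EFin_powR_abs.
    by apply: measurable_funB; exact: Lp_measurable.
  - by move=> k x; rewrite lee_fin powR_ge0.
  - by apply: measurable_EFin_powR_abs; apply: measurable_funB => //; exact: Lp_measurable.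
  - apply: ae_imply gf => x gx; apply: cvg_EFin; first exact: nearW.
    apply: (continuous_cvg _ (@continuous_powR_norm R p p1 _)).
    by apply: cvgB => //; exact: cvg_cst.
  - move=> N; exists (N + M)%N; first exact: leq_addr.
    rewrite -(@Lp_norm_pow _ p p1 (F j \- g (N + M)%N)) -poweR_EFin.
    apply: gt0_ler_poweR; rewrite ?(ltW p0)//.
    + by rewrite in_itv/= leey Lp_norm_ge0.
    + by rewrite in_itv/= leey lee_fin (ltW e0).
    + by apply: hM => //; apply: leq_trans (knK _); exact: leq_addl.
have pFf (e : R) : 0 < e -> exists K, forall j, (K <= j)%N ->
    (Lp_norm p (F j \- f)%R <= e%:E)%E.
  move=> e0; have [M hM] := bound e e0; exists M => j /hM jM.
  have -> : e%:E = ((e `^ p)%:E `^ p^-1)%E.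
    by rewrite poweR_EFin -powRrM mulfV ?gt_eqF// powRr1// ltW.
  rewrite Lp_normE//; apply: gt0_ler_poweR => //.
  - by rewrite invr_ge0 ltW.
  - by rewrite in_itv/= leey integral_ge0// => x _; rewrite lee_fin powR_ge0.
  - by rewrite in_itv/= leey lee_fin powR_ge0.
exists f => //; have [M hM] := pFf 1 ltr01.
have pd : Lp p (F M \- f).
  apply/LpP; split; first by apply: measurable_funB => //; exact: Lp_measurable (pF M).
  by apply: le_lt_trans (hM M (leqnn M)) _; rewrite ltry.
have -> : f = F M \- (F M \- f) by apply/funext => x /=; rewrite subKr.
exact: LpB.
Qed.

End Lp_completeness.

(** * Completions and graph spaces *)

Section completions.
Context {R : realType}.
Implicit Types (u v w f : R -> R) (F G : nat -> R -> R) (e : R).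

Lemma ereal_cvg0P (a : nat -> \bar R) : (forall k, 0 <= a k)%E ->
  a @ \oo --> 0%E <->
  forall e, 0 < e -> exists K, forall k, (K <= k)%N -> (a k < e%:E)%E.
Proof.
move=> a0; split=> [/fine_cvgP[fa] /cvgrPdist_lt ca e e0|ca].
  have [K _ aK] : \forall k \near \oo, (a k < e%:E)%E.
    near=> k; rewrite -[ltLHS]fineK; last by near: k.
    rewrite lte_fin; have : `|0 - fine (a k)| < e by near: k; exact: ca.
    by rewrite sub0r normrN ger0_norm// fine_ge0.
  by exists K => k Kk; exact: aK.
apply/fine_cvgP; split.
  have [K aK] := ca 1 ltr01; exists K => // k /= Kk.
  by rewrite ge0_fin_numE// (lt_trans (aK _ Kk))// ltry.
apply/cvgrPdist_lt => e e0; have [K aK] := ca _ e0; exists K => // k /= Kk.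
rewrite sub0r normrN ger0_norm ?fine_ge0//.
have ak := aK _ Kk; rewrite -lte_fin fineK//.
by rewrite ge0_fin_numE// (lt_trans ak)// ltry.
Unshelve. all: by end_near.
Qed.

Variables (N : (R -> R) -> \bar R) (X : set (R -> R)).
Hypothesis N_ge0 : forall u v, X u -> X v -> (0 <= N (u \- v)%R)%E.
Hypothesis N_refl : forall u e, X u -> 0 < e -> (N (u \- u)%R < e%:E)%E.
(** A uniform form of the triangle inequality is all that classes of Cauchy sequences require.
    Writing [w \- v] in the second premise lets symmetry follow from this and [N_refl]. *)
Hypothesis N_triangle : forall e, 0 < e -> exists2 d : R, 0 < d &
  forall u v w, X u -> X v -> X w ->
    (N (u \- v)%R < d%:E)%E -> (N (w \- v)%R < d%:E)%E -> (N (u \- w)%R < e%:E)%E.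
Hypothesis N_complete : forall F, cauchy_in N X F -> exists2 u, X u &
  forall e, 0 < e -> exists K, forall k, (K <= k)%N -> (N (F k \- u)%R < e%:E)%E.

Let tends F G := forall e, 0 < e ->
  exists K, forall k, (K <= k)%N -> (N (F k \- G k)%R < e%:E)%E.

Let tends_triangle F G H : (forall k, X (F k)) -> (forall k, X (G k)) ->
  (forall k, X (H k)) -> tends F G -> tends H G -> tends F H.
Proof.
move=> XF XG XH FG HG e /N_triangle[d d0 dN].
have [K1 h1] := FG d d0; have [K2 h2] := HG d d0.
exists (maxn K1 K2) => k; rewrite geq_max => /andP[k1 k2].
by apply: (dN _ (G k)) => //; [exact: h1|exact: h2].
Qed.

Let tends_sym F G : (forall k, X (F k)) -> (forall k, X (G k)) ->
  tends F G -> tends G F.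
Proof.
move=> XF XG FG; apply: (tends_triangle XG XG XF) FG => e e0.
by exists 0%N => k _; exact: N_refl.
Qed.

Let cauchy_classE F : (forall k, X (F k)) ->
  cauchy_class N X F = [set G | cauchy_in N X G /\ tends F G].
Proof.
move=> XF; apply/seteqP; split => G [cG FG]; split => //; have [XG _] := cG.
- by move/ereal_cvg0P : FG; apply => k; exact: N_ge0.
- by apply/ereal_cvg0P => // k; exact: N_ge0.
Qed.

Let cauchy_class_eq F G : (forall k, X (F k)) -> (forall k, X (G k)) ->
  tends F G -> cauchy_class N X F = cauchy_class N X G.
Proof.
move=> XF XG FG; rewrite !cauchy_classE//; apply/seteqP; split => H [cH FH];
  have [XH _] := cH; split => //.
- exact: (tends_triangle XG XF XH (tends_sym XF XG FG) (tends_sym XF XH FH)).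
- exact: (tends_triangle XF XG XH FG (tends_sym XG XH FH)).
Qed.

Lemma completion_sub (S : set (R -> R)) : S `<=` X ->
  completion N X S `<=` canonical_copy N X.
Proof.
move=> SX _ [F [SF cF] <-].
have XF k : X (F k) by exact: SX.
have [u Xu Fu] := N_complete (conj XF cF).
by exists u => //; apply: cauchy_class_eq => //; exact: tends_sym.
Qed.

Lemma completion_mono (S S' : set (R -> R)) : S `<=` S' ->
  completion N X S `<=` completion N X S'.
Proof.
by move=> SS' _ [F [SF cF] <-]; exists F => //; split => // k; exact: SS'.
Qed.

Lemma canonical_copy_sub (S : set (R -> R)) : dense_in N X S ->
  canonical_copy N X `<=` completion N X S.
Proof.
move=> [SX dS] _ [u Xu <-].
have /choice[F hF] : forall k : nat, exists f, S f /\ (N (u \- f)%R < (k.+1%:R^-1)%:E)%E.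
  by move=> k; have [|f Sf uf] := dS u Xu (k.+1%:R^-1); [rewrite invr_gt0|exists f].
have XF k : X (F k) by apply: SX; exact: (hF k).1.
have uF : tends (fun=> u) F.
  move=> e e0; exists (Num.bound e^-1) => k Kk.
  apply: lt_trans (hF k).2 _; rewrite lte_fin -[ltRHS]invrK ltf_pV2 ?posrE ?invr_gt0//.
  apply: (@lt_le_trans _ _ (Num.bound e^-1)%:R).
    by apply: archi_boundP; rewrite invr_ge0 ltW.
  by rewrite ler_nat leqW.
have Fu := tends_sym (fun=> Xu) XF uF.
exists F; last by apply: cauchy_class_eq.
split=> [k|e /N_triangle[d d0 dN]]; first exact: (hF k).1.
have [K hK] := Fu d d0; exists K => j k Kj Kk.
by apply: (dN _ u) => //; exact: hK.
Qed.

(** A cycle of inclusions: density puts the copy of [X] inside the completion of [S0], monotonicity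
    leads to [S1] and [S2], and completeness returns to the copy. *)
Lemma completions_eq (S0 S1 S2 : set (R -> R)) : dense_in N X S0 ->
  S0 `<=` S1 -> S1 `<=` S2 -> S2 `<=` X ->
  completion N X S2 = completion N X S1 /\ completion N X S1 = canonical_copy N X.
Proof.
move=> dS S01 S12 S2X.
have c0 := subset_trans (canonical_copy_sub dS) (completion_mono S01).
have c1 := completion_mono S12; have c2 := completion_sub S2X.
split; apply/seteqP; split => //.
- exact: subset_trans c2 c0.
- exact: subset_trans c1 c2.
Qed.

End completions.

(** * Graph spaces of finitely many weak operators *)

Section graph_space.
Context {R : realType}.
Variables (p : R) (n : nat) (T : nat -> (R -> R) -> R -> R).
Hypotheses (p1 : 1 <= p) (n_gt0 : (0 < n)%N).
Hypothesis T_admissible : forall i, admissible p (T i).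
Hypothesis T0 : forall u, Lp p u -> weak_op (T 0) u u.
Implicit Types (u v w f : R -> R) (F G : nat -> R -> R) (e d : R) (i j : nat).

(** An existential substitute for a maximum norm: a bound may be proved on whichever weak image is
    at hand, and the bounds add up under differences. *)
Definition controlled u e := Lp p u /\ forall i, (i < n)%N ->
  exists v, [/\ weak_op (T i) u v, Lp p v & (Lp_norm p v <= e%:E)%E].

Let T_dual i phi : C0inf phi -> dual p (T i phi).
Proof. by have [+ _] := T_admissible i; apply. Qed.

Lemma controlled_norm u v e i : controlled u e -> (i < n)%N ->
  weak_op (T i) u v -> Lp p v /\ (Lp_norm p v <= e%:E)%E.
Proof.
move=> [_ cu] /cu[v' [uv' pv' v'e]] uv.
have [[mv _ _] _] := uv; have mv' := Lp_measurable pv'.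
have vv' := ae_eq_Lp_norm p1 mv mv' (weak_op_ae_unique uv uv').
rewrite LpP vv'; split => //; split => //.
by have /LpP[] := pv'.
Qed.

Lemma controlledB u v d e : controlled u d -> controlled v e ->
  controlled (u \- v) (d + e).
Proof.
move=> [pu cu] [pv cv]; split; first exact: LpB.
move=> i ni; have [u' [uu' pu' u'd]] := cu i ni; have [v' [vv' pv' v'e]] := cv i ni.
exists (u' \- v'); split; [|exact: LpB|].
  by apply: (weak_opB p1) => // phi; exact: T_dual.
apply: le_trans (Lp_normB p1 (Lp_measurable pu') (Lp_measurable pv')) _.
by rewrite EFinD; exact: leeD.
Qed.

Lemma controlledC u v e : controlled (u \- v) e -> controlled (v \- u) e.
Proof.
have -> : v \- u = (fun x => (-1) * (u \- v) x).
  by apply/funext => x; rewrite mulN1r opprB.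
move=> [pw cw]; split; first exact: LpZ.
move=> i /cw[w [uw pw' we]]; exists (fun x => (-1) * w x); split.
- by apply: (@weak_opZ _ p) => // phi; exact: T_dual.
- exact: LpZ.
- by rewrite Lp_normZ//; [rewrite normrN1 mul1e|exact: Lp_measurable pw'].
Qed.

Definition graph_space : set (R -> R) := [set u | Lp p u /\
  forall i, (i < n)%N -> exists2 v, weak_op (T i) u v & Lp p v].

Lemma controlled_graph_space u e : controlled u e -> graph_space u.
Proof.
by move=> [pu cu]; split => // i /cu[v [uv pv _]]; exists v.
Qed.

Lemma graph_spaceB u v : graph_space u -> graph_space v -> graph_space (u \- v).
Proof.
move=> [pu gu] [pv gv]; split; first exact: LpB.
move=> i ni; have [u' uu' pu'] := gu i ni; have [v' vv' pv'] := gv i ni.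
exists (u' \- v'); last exact: LpB.
by apply: (weak_opB p1) => // phi; exact: T_dual.
Qed.

Lemma finite_eventually (P : nat -> nat -> Prop) :
  (forall i, (i < n)%N -> exists K, forall k, (K <= k)%N -> P i k) ->
  exists K, forall k, (K <= k)%N -> forall i, (i < n)%N -> P i k.
Proof.
move=> h; have /choice[K hK] : forall i, exists K, (i < n)%N -> forall k, (K <= k)%N -> P i k.
  move=> i; case: (ltnP i n) => [/h[K hK]|]; last by exists 0%N.
  by exists K => _.
exists (\sum_(i < n) K i)%N => k Kk i ni; apply: hK => //; apply: leq_trans Kk.
by rewrite (bigD1 (Ordinal ni))//= leq_addr.
Qed.

Lemma graph_space_mollify u d : graph_space u -> 0 < d ->
  exists j, controlled (conv (mollifier j) u \- u) d.
Proof.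
move=> [pu gu] d0.
have [K hK] : exists K, forall j, (K <= j)%N -> forall i, (i < n)%N ->
    exists v, [/\ weak_op (T i) (conv (mollifier j) u \- u) v, Lp p v &
      (Lp_norm p v <= d%:E)%E].
  apply: finite_eventually => i /gu[v uv pv].
  have [K hK] := conv_mollifier_cvg p1 pv d0; exists K => j Kj.
  have [pju _] := Lp_conv_mollifier p1 j pu; have [pjv _] := Lp_conv_mollifier p1 j pv.
  exists (conv (mollifier j) v \- v); split; [|exact: LpB|exact: hK].
  apply: (weak_opB p1) => // [phi|]; first exact: T_dual.
  exact: weak_op_conv (mollifier_L1 j) pu pv uv.
exists K; split; last exact: hK.
by have [pju _] := Lp_conv_mollifier p1 K pu; exact: LpB.
Qed.

(** By [T0] component 0 is the function itself, and its limit is the candidate [u]. The other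
    components converge on their own, and closedness identifies their limits as weak images of
    [u]. *)
Lemma graph_space_complete F : (forall k, graph_space (F k)) ->
  (forall e, 0 < e -> exists K, forall j k, (K <= j)%N -> (K <= k)%N ->
    controlled (F j \- F k) e) ->
  exists2 u, graph_space u &
    forall e, 0 < e -> exists K, forall k, (K <= k)%N -> controlled (F k \- u) e.
Proof.
move=> gF cF; have pF k : Lp p (F k) by have [] := gF k.
have [u pu Fu] : exists2 u, Lp p u & Lp_cvg p F u.
  apply: Lp_complete => // e /cF[K hK]; exists K => j k Kj Kk.
  by have [] := controlled_norm (hK j k Kj Kk) n_gt0 (T0 (LpB p1 (pF j) (pF k))).
have lim i : (i < n)%N -> exists V : nat -> R -> R, exists v,
    [/\ forall k, weak_op (T i) (F k) (V k), forall k, Lp p (V k), Lp p v & Lp_cvg p V v].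
  move=> ni; have /choice[V hV] : forall k, exists v, weak_op (T i) (F k) v /\ Lp p v.
    by move=> k; have [_ /(_ i ni)[v Fv pv]] := gF k; exists v.
  exists V; have [v pv Vv] : exists2 v, Lp p v & Lp_cvg p V v.
    apply: Lp_complete => // [k|e /cF[K hK]]; first by have [] := hV k.
    exists K => j k Kj Kk.
    have [] := @controlled_norm _ (V j \- V k) _ i (hK j k Kj Kk) ni => //.
    apply: (weak_opB p1) => // [phi||]; first exact: T_dual.
    - by have [] := hV j.
    - by have [] := hV k.
  by exists v; split => // k; have [] := hV k.
have wlim i V v : (forall k, weak_op (T i) (F k) (V k)) -> (forall k, Lp p (V k)) ->
    Lp p v -> Lp_cvg p V v -> weak_op (T i) u v.
  move=> FV pV pv Vv; apply: (weak_op_closed p1) FV => // phi; exact: T_dual.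
exists u.
  split => // i /lim[V [v [FV pV pv Vv]]]; exists v => //.
  exact: wlim FV pV pv Vv.
move=> e e0.
have [K hK] : exists K, forall k, (K <= k)%N -> forall i, (i < n)%N ->
    exists v, [/\ weak_op (T i) (F k \- u) v, Lp p v & (Lp_norm p v <= e%:E)%E].
  apply: finite_eventually => i /lim[V [v [FV pV pv Vv]]].
  have [K hK] := Vv e e0; exists K => k Kk.
  exists (V k \- v); split; [|exact: LpB|exact: hK].
  apply: (weak_opB p1) => // [phi|]; first exact: T_dual.
  exact: wlim FV pV pv Vv.
by exists K => k Kk; split; [exact: LpB|exact: hK].
Qed.

Variables (N : (R -> R) -> \bar R) (X : set (R -> R)).
Hypothesis X_graph : X = graph_space.
Hypothesis N_ge0 : forall u, X u -> (0 <= N u)%E.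
Hypothesis N_le : forall u e, 0 <= e -> controlled u e -> (N u <= (n%:R * e)%:E)%E.
Hypothesis le_N : forall u e, X u -> (N u <= e%:E)%E -> controlled u e.

Let nR0 : 0 < n%:R :> R. Proof. by rewrite ltr0n. Qed.

(** Dividing by [n] compensates the constant in [N_le], and the 2 makes the inequality strict. *)
Lemma graph_norm_lt u e : 0 < e -> controlled u (e / (2 * n%:R)) -> (N u < e%:E)%E.
Proof.
move=> e0 cu; have e' : 0 <= e / (2 * n%:R) by rewrite ltW// divr_gt0// mulr_gt0.
apply: le_lt_trans (N_le e' cu) _; rewrite lte_fin.
have -> : n%:R * (e / (2 * n%:R)) = e / 2 by field; rewrite gt_eqF.
by lra.
Qed.

Lemma graph_space_completions (S0 S1 S2 : set (R -> R)) : S0 `<=` S1 -> S1 `<=` S2 ->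
  S2 `<=` X -> (forall u d, X u -> 0 < d -> exists2 f, S0 f & controlled (u \- f) d) ->
  dense_in N X S0 /\ completion N X S2 = completion N X S1 /\
    completion N X S1 = canonical_copy N X.
Proof.
move=> S01 S12 S2X dS.
have XB u v : X u -> X v -> X (u \- v) by rewrite X_graph; exact: graph_spaceB.
have h (e : R) : 0 < e -> 0 < e / (2 * n%:R) by move=> e0; rewrite divr_gt0// mulr_gt0.
have dense : dense_in N X S0.
  split; first by apply: subset_trans S01 _; exact: subset_trans S2X.
  move=> u Xu e e0; have [f Sf uf] := dS u _ Xu (h e e0).
  by exists f => //; exact: graph_norm_lt.
split => //; apply: completions_eq dense S01 S12 S2X.
- by move=> u v Xu Xv; apply: N_ge0; exact: XB.
- move=> u e Xu e0; apply: graph_norm_lt => //.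
  (* The zero function is controlled as the difference of [u \- f] with itself. *)
  have [f _ cf] := dS u _ Xu (divr_gt0 (h e e0) (ltr0Sn _ 1)) .
  have := controlledB cf cf; rewrite -splitr; congr controlled.
  by apply/funext => x /=; rewrite !subrr.
- move=> e e0; exists (e / (2 * n%:R) / 2); first by rewrite divr_gt0// h.
  move=> u v w Xu Xv Xw /ltW uv /ltW wv; apply: graph_norm_lt => //.
  have := controlledB (le_N (XB _ _ Xu Xv) uv) (le_N (XB _ _ Xw Xv) wv).
  rewrite -splitr; congr controlled; apply/funext => x /=; ring.
- move=> F [XF cF]; rewrite X_graph; have XF' := XF; rewrite X_graph in XF'.
  have [u gu Fu] : exists2 u, graph_space u &
      forall e, 0 < e -> exists K, forall k, (K <= k)%N -> controlled (F k \- u) e.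
    apply: graph_space_complete => // e /cF[K hK]; exists K => j k Kj Kk.
    by apply: le_N; [exact: XB|exact/ltW/hK].
  exists u => // e e0; have [K hK] := Fu _ (h e e0); exists K => k Kk.
  by apply: graph_norm_lt => //; exact: hK.
Qed.

End graph_space.

(** * Cutoff and density *)

Section cutoff.
Context {R : realType}.
Variable p : R.
Hypothesis p1 : 1 <= p.
Local Notation mu := (@lebesgue_measure R).
Local Notation L1 k := (mu.-integrable setT (EFin \o k)).
Implicit Types (u v w f g h psi : R -> R) (j k m : nat).

Let p0 : 0 < p. Proof. exact: lt_le_trans p1. Qed.

Lemma C0inf_Lp f : C0inf f -> Lp p f.
Proof.
move=> cf; have [M M0 fM] := C0inf_bounded cf; have /C0infP[_ [B B0 fB]] := cf.
have mf := C0inf_measurable cf.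
apply/(Lp_intP p1); split => //.
have : L1 (fun x => `|f x| `^ p).
  apply: (@bounded_supp_L1 _ _ B (M `^ p)) => [|x /fB ->|x].
  - exact: measurable_powR_abs.
  - by rewrite normr0 powR0// gt_eqF.
  - by rewrite ger0_norm ?powR_ge0// ge0_ler_powR ?(ltW p0) ?nnegrE.
move=> /integrable_abs_lty; under eq_integral do rewrite ger0_norm ?powR_ge0//.
by [].
Qed.

Definition dilate j psi x := psi (j.+1%:R^-1 * x + 0).

Let j0 j : j.+1%:R^-1 != 0 :> R. Proof. by rewrite invr_eq0 pnatr_eq0. Qed.

Lemma C0inf_dilate j psi : C0inf psi -> C0inf (dilate j psi).
Proof. exact: C0inf_affine. Qed.

Lemma derive1_dilate j psi : C0inf psi ->
  derive1 (dilate j psi) = (fun x => j.+1%:R^-1 * dilate j (derive1 psi) x).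
Proof.
by move=> cpsi; apply: derive1_affine; apply: Cinf_derivable; exact: C0inf_Cinf.
Qed.

Lemma LpM_C0inf psi w : C0inf psi -> Lp p w -> exists2 M : R, 0 <= M &
  forall j, Lp p (dilate j psi \* w) /\
    (Lp_norm p (dilate j psi \* w)%R <= M%:E * Lp_norm p w)%E.
Proof.
move=> cpsi pw; have [M M0 psiM] := C0inf_bounded cpsi; exists M => // j.
have mw := Lp_measurable pw.
have mpw : measurable_fun setT (dilate j psi \* w).
  by apply: measurable_funM => //; exact: C0inf_measurable (C0inf_dilate j cpsi).
have le : (Lp_norm p (dilate j psi \* w)%R <= M%:E * Lp_norm p w)%E.
  have -> : (M%:E * Lp_norm p w = Lp_norm p (fun x => M * w x)%R)%E.
    by rewrite Lp_normZ// ger0_norm.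
  apply: le_Lp_norm => // [|x /=]; first exact: measurable_funM.
  by rewrite !normrM (ger0_norm M0); apply: ler_wpM2r => //; exact: psiM.
split => //; apply/LpP; split => //; apply: le_lt_trans le _.
by rewrite lte_mul_pinfty ?lee_fin//; have /LpP[] := pw.
Qed.

(** A commutator estimate: each remaining Leibniz term has at least one derivative on the dilated
    function, which costs a factor 1 / (j + 1). The induction varies [psi] and [h], since a
    derivative may fall on either. *)
Lemma derive1n_dilate_mul k psi h : C0inf psi -> Cinf h ->
  (forall i, Lp p (derive1n i h)) ->
  exists2 C : R, 0 <= C & forall j,
    (Lp_norm p (derive1n k (dilate j psi \* h) \- dilate j psi \* derive1n k h)%R
      <= (C / j.+1%:R)%:E)%E.
Proof.
elim: k psi h => [|k ih] psi h cpsi ih_ ph.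
  exists 0 => // j; rewrite mul0r.
  have -> : derive1n 0 (dilate j psi \* h) \- dilate j psi \* derive1n 0 h = cst 0.
    by apply/funext => x /=; rewrite subrr.
  by rewrite Lp_norm0.
have cpsi' : C0inf (derive1 psi) by exact: (C0inf_derive1n 1 cpsi).
have [dh ch'] := (CinfS h).1 ih_.
have ph' i : Lp p (derive1n i (derive1 h)) by rewrite -derive1Sn.
have [C1 C10 hC1] := ih _ _ cpsi' ih_ ph.
have [C2 C20 hC2] := ih _ _ cpsi ch' ph'.
have [M M0 hM] := LpM_C0inf cpsi' (ph k).
have /LpP[_ fin] := ph k; have n0 := Lp_norm_ge0 p (derive1n k h).
pose H := fine (Lp_norm p (derive1n k h)).
have HE : Lp_norm p (derive1n k h) = H%:E by rewrite fineK// ge0_fin_numE.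
have H0 : 0 <= H by exact: fine_ge0.
exists (C1 + M * H + C2) => [|j]; first by rewrite !addr_ge0// mulr_ge0.
have cj := C0inf_dilate j cpsi; have cj' := C0inf_dilate j cpsi'.
have icj := C0inf_Cinf cj; have icj' := C0inf_Cinf cj'.
set D1 := derive1n k (dilate j (derive1 psi) \* h) \- dilate j (derive1 psi) \* derive1n k h.
set D2 := derive1n k (dilate j psi \* derive1 h) \- dilate j psi \* derive1n k (derive1 h).
have E : derive1n k.+1 (dilate j psi \* h) \- dilate j psi \* derive1n k.+1 h =
    (fun x => j.+1%:R^-1 * (D1 \+ dilate j (derive1 psi) \* derive1n k h) x) \+ D2.
  have -> : derive1n k.+1 (dilate j psi \* h) =
      (fun x => j.+1%:R^-1 * derive1n k (dilate j (derive1 psi) \* h) x) \+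
      derive1n k (dilate j psi \* derive1 h).
    have -> : derive1n k.+1 (dilate j psi \* h) =
        derive1n k ((fun x => j.+1%:R^-1 * (dilate j (derive1 psi) \* h) x) \+
          dilate j psi \* derive1 h).
      rewrite derive1Sn (derive1_mul (Cinf_derivable icj) dh) derive1_dilate//.
      by congr (derive1n k); apply/funext => x /=; rewrite mulrA.
    have c1 := CinfM icj' ih_; have c2 := CinfM icj ch'.
    have c3 : Cinf (fun x => j.+1%:R^-1 * (dilate j (derive1 psi) \* h) x) := CinfZ c1.
    by rewrite (derive1nD k c3 c2) (derive1nZ k _ c1).
  by apply/funext => x; rewrite /D1 /D2 derive1Sn /=; ring.
have mk f : Cinf f -> measurable_fun setT (derive1n k f).
  by move=> cf; apply: Cinf_measurable; exact: Cinf_derive1n.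
have mD1 : measurable_fun setT D1.
  apply: measurable_funB; first by apply: mk; exact: CinfM.
  by apply: measurable_funM; [exact: Cinf_measurable|exact: mk].
have mD2 : measurable_fun setT D2.
  apply: measurable_funB; first by apply: mk; exact: CinfM.
  by apply: measurable_funM; [exact: Cinf_measurable|exact: mk].
have [pj lj] := hM j; have mj := Lp_measurable pj.
have mS : measurable_fun setT (D1 \+ dilate j (derive1 psi) \* derive1n k h).
  exact: measurable_funD.
rewrite E; apply: le_trans (Lp_normD p1 _ mD2) _; first exact: measurable_funM.
rewrite Lp_normZ//.
have ji : `|j.+1%:R^-1| <= 1 :> R by rewrite ger0_norm// invf_le1 ?ler1n.
apply: (@le_trans _ _ ((j.+1%:R^-1)%:E * (C1 + M * H)%:E + (C2 / j.+1%:R)%:E)%E); last first.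
  by rewrite -EFinM -EFinD lee_fin mulrC -mulrDl.
apply: leeD; last exact: hC2.
rewrite ger0_norm//; apply: lee_wpmul2l; first by rewrite lee_fin.
apply: le_trans (Lp_normD p1 mD1 mj) _; rewrite EFinD; apply: leeD.
  apply: le_trans (hC1 j) _; rewrite lee_fin ler_piMr// invf_le1 ?ler1n//.
by rewrite EFinM -HE.
Qed.

Definition cutoff j : R -> R := dilate j (fun x => (bump 0)^-1 * bump x).

Lemma bump0_gt0 : 0 < bump (0 : R).
Proof. by apply: lt_le_trans (bump_lower _); rewrite ?expR_gt0// normr0. Qed.

(** Inside its support [bump x] is e^(-2/(1-x^2)), which is largest at 0. *)
Lemma bump_le_bump0 (x : R) : bump x <= bump 0.
Proof.
rewrite {1}/bump; have [x1|x1] := leP (1 + x) 0.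
  by rewrite flat_le0// mul0r bump_ge0.
have [x2|x2] := leP (1 - x) 0; first by rewrite (flat_le0 _ x2) mulr0 bump_ge0.
rewrite /bump addr0 subr0 /flat x1 x2 ltr01 !hornerC !mul1r -!expRD ler_expR invr1.
suff : 2 <= (1 + x)^-1 + (1 - x)^-1 by lra.
have -> : (1 + x)^-1 + (1 - x)^-1 = 2 / ((1 + x) * (1 - x)).
  by field; rewrite !gt_eqF.
by rewrite ler_pdivlMr ?mulr_gt0//; nra.
Qed.

Lemma C0inf_cutoff j : C0inf (cutoff j).
Proof. by apply: C0inf_dilate; apply: C0infZ; exact: C0inf_bump. Qed.

Lemma cutoff_Lp_cvg w : Lp p w -> Lp_cvg p (fun j => cutoff j \* w) w.
Proof.
move=> pw; have mw := Lp_measurable pw.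
have c01 j x : 0 <= cutoff j x <= 1.
  rewrite /cutoff /dilate mulr_ge0 ?invr_ge0 ?bump_ge0//=.
  by rewrite mulrC ler_pdivrMr ?bump0_gt0// mul1r bump_le_bump0.
have mc j : measurable_fun setT (cutoff j \* w).
  by apply: measurable_funM => //; exact: C0inf_measurable (C0inf_cutoff j).
have le j : (Lp_norm p (cutoff j \* w)%R <= Lp_norm p w)%E.
  apply: le_Lp_norm => // x; have /andP[c0 c1] := c01 j x.
  by rewrite normrM ger0_norm// ler_piMl.
apply: Lp_cvg_ae_contraction => //.
  by move=> j; apply/LpP; split => //; apply: le_lt_trans (le j) _; have /LpP[] := pw.
apply: aeW => x /=.
rewrite -[X in _ --> X]mul1r; apply: cvgM; last exact: cvg_cst.
have cc : {for 0, continuous (fun x : R => (bump 0)^-1 * bump x)}.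
  by apply: Cinf_continuous; apply: CinfZ; exact: Cinf_bump.
have -> : (1 : R) = (bump 0)^-1 * bump (0 : R) by rewrite mulVf// gt_eqF// bump0_gt0.
apply: (continuous_cvg _ cc).
rewrite [X in _ --> X](_ : 0 = 0 * x + 0); last by rewrite mul0r addr0.
apply: cvgD; last exact: cvg_cst.
apply: cvgM; last exact: cvg_cst.
exact: cvg_harmonic.
Qed.

Lemma cutoff_derive1n_cvg k g : Cinf g -> (forall i, Lp p (derive1n i g)) ->
  Lp_cvg p (fun j => derive1n k (cutoff j \* g)) (derive1n k g).
Proof.
move=> ig pg e e0; have e2 : 0 < e / 2 by rewrite divr_gt0.
have cb : C0inf (fun x : R => (bump 0)^-1 * bump x) by apply: C0infZ; exact: C0inf_bump.
have [C C0 hC] := derive1n_dilate_mul k cb ig pg.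
have [K hK] := cutoff_Lp_cvg (pg k) e2.
(* Past [K] the cutoff error is at most e/2; past the second summand so is the commutator bound C /
   (j + 1). *)
exists (K + Num.bound (C / (e / 2)))%N => j Kj.
have ic := C0inf_Cinf (C0inf_cutoff j).
have m1 : measurable_fun setT (derive1n k (cutoff j \* g)).
  by apply: Cinf_measurable; apply: Cinf_derive1n; exact: CinfM.
have m2 := Lp_measurable (pg k).
have m3 : measurable_fun setT (cutoff j \* derive1n k g).
  by apply: measurable_funM => //; exact: Cinf_measurable.
rewrite (_ : _ \- _ = (derive1n k (cutoff j \* g) \- cutoff j \* derive1n k g) \+
  (cutoff j \* derive1n k g \- derive1n k g)); last first.
  by apply/funext => x /=; rewrite addrA subrK.
apply: le_trans (Lp_normD p1 _ _) _; [exact: measurable_funB|exact: measurable_funB|].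
rewrite (splitr e) EFinD; apply: leeD; last first.
  by apply: hK; apply: leq_trans Kj; exact: leq_addr.
apply: le_trans (hC j) _; rewrite lee_fin ler_pdivrMr// mulrC -ler_pdivrMr//.
apply: (@le_trans _ _ (Num.bound (C / (e / 2)))%:R).
  by apply/ltW/archi_boundP; rewrite divr_ge0// ltW.
by rewrite ler_nat; apply: leq_trans (leqnSn _); apply: leq_trans Kj; exact: leq_addl.
Qed.

End cutoff.

(** * The fractional Sobolev spaces *)

Section fractional_spaces.
Context {R : realType}.
Variables (s : side) (a p : R).
Hypotheses (a0 : 0 < a) (p1 : 1 <= p).
Implicit Types (u v w f g : R -> R) (i j k : nat).

Let p0 : 0 < p. Proof. exact: lt_le_trans p1. Qed.
Let m := Num.truncn a.
Let X := frac_Sobolev s a p.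
Let N := frac_Sobolev_norm s a p.

(** Of the m + 2 components used below, 0 to m are classical and index m + 1 is the fractional
    one. *)
Definition sobolev_op i : (R -> R) -> R -> R :=
  if (i <= m)%N then deriv_op i else frac_op s a.

Definition sobolev_deriv i u : R -> R :=
  if (i <= m)%N then weak_deriv i u else weak_frac_deriv s a u.

Lemma sobolev_op_admissible i : admissible p (sobolev_op i).
Proof.
by rewrite /sobolev_op; case: ifP => _;
  [exact: deriv_op_admissible|exact: frac_op_admissible].
Qed.

Lemma sobolev_op0 u : Lp p u -> weak_op (sobolev_op 0) u u.
Proof.
move=> pu; rewrite /sobolev_op leq0n; split; first exact: Lp_locally_integrable pu.
by move=> phi _; apply: eq_Rintegral => x _; rewrite /deriv_op expr0 mul1r.
Qed.

Lemma frac_Sobolev_graph : X = graph_space p m.+2 sobolev_op.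
Proof.
apply/seteqP; split => u.
  move=> [[pu wu] [v uv pv]]; split => // i im; rewrite /sobolev_op.
  have mu_ := Lp_measurable pu.
  case: ifPn => [/wu[w uw pw]|_]; first by exists w => //; apply/is_weak_derivE.
  by exists v => //; apply/is_weak_frac_derivE.
move=> [pu gu]; have mu_ := Lp_measurable pu; split; last first.
  have [v + pv] := gu m.+1 (leqnn _); rewrite /sobolev_op ltnn => uv.
  by exists v => //; apply/is_weak_frac_derivE.
split => // k km; have [|v + pv] := gu k; first by rewrite ltnS leqW.
by rewrite /sobolev_op km => uv; exists v => //; apply/is_weak_derivE.
Qed.

Lemma sobolev_derivP u i : X u -> (i < m.+2)%N -> weak_op (sobolev_op i) u (sobolev_deriv i u).
Proof.
move=> [[pu wu] [v uv pv]] im; have mu_ := Lp_measurable pu.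
rewrite /sobolev_op /sobolev_deriv; case: ifPn => [/wu[w uw pw]|_].
  apply/is_weak_derivE => //; rewrite /weak_deriv.
  exact: (@xgetPex _ (cst 0) [set v | is_weak_deriv i u v] (ex_intro _ w uw)).
apply/is_weak_frac_derivE => //; rewrite /weak_frac_deriv.
exact: (@xgetPex _ (cst 0) [set v | is_weak_frac_deriv s a u v] (ex_intro _ v uv)).
Qed.

Let npow u i := (Lp_norm p (sobolev_deriv i u) `^ p)%E.

Let npow_ge0 u i : (0 <= npow u i)%E.
Proof. exact: poweR_ge0. Qed.

(** The inner root cancels against the power [p], which leaves a single p-sum over all
    components. *)
Lemma frac_Sobolev_normE u : N u = ((\sum_(i < m.+2) npow u i) `^ p^-1)%E.
Proof.
rewrite /N /frac_Sobolev_norm /Sobolev_norm [in RHS]big_ord_recr/=; congr (_ `^ _)%E.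
rewrite -poweRrM mulVf ?gt_eqF// poweRe1 ?sume_ge0//.
rewrite /npow /sobolev_deriv ltnn; congr (_ + _)%E.
  by apply: eq_bigr => i _; rewrite -ltnS ltn_ord.
by move=> i _; exact: poweR_ge0.
Qed.

Lemma frac_Sobolev_norm_ge0 u : (0 <= N u)%E.
Proof. exact: poweR_ge0. Qed.

Lemma frac_Sobolev_norm_le u (e : R) : 0 <= e -> controlled p m.+2 sobolev_op u e ->
  (N u <= (m.+2%:R * e)%:E)%E.
Proof.
move=> e0 cu; have Xu : X u by rewrite frac_Sobolev_graph; exact: controlled_graph_space cu.
have n1 : 1 <= m.+2%:R :> R by rewrite ler1n.
have ne0 : 0 <= m.+2%:R * e by rewrite mulr_ge0.
have -> : (m.+2%:R * e)%:E = (((m.+2%:R * e) `^ p)%:E `^ p^-1)%E.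
  by rewrite poweR_EFin -powRrM mulfV ?gt_eqF// powRr1.
rewrite frac_Sobolev_normE; apply: gt0_ler_poweR.
- by rewrite invr_ge0 ltW.
- by rewrite in_itv/= leey sume_ge0.
- by rewrite in_itv/= leey lee_fin powR_ge0.
apply: (@le_trans _ _ (\sum_(i < m.+2) (e `^ p)%:E)%E).
  apply: lee_sum => i _; have [_ ie] := controlled_norm p1 cu (ltn_ord i) (sobolev_derivP Xu
    (ltn_ord i)).
  rewrite -poweR_EFin; apply: gt0_ler_poweR; rewrite ?(ltW p0)//.
  - by rewrite in_itv/= leey Lp_norm_ge0.
  - by rewrite in_itv/= leey lee_fin e0.
(* The number of components is at least 1 and p >= 1, so it is at most its own p-th power. *)
rewrite sumEFin lee_fin sumr_const card_ord -[leLHS]mulr_natl powRM//.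
rewrite ler_wpM2r ?powR_ge0//.
by rewrite -[leLHS]powRr1 ?(ltW (lt_le_trans ltr01 n1))// ler_powR.
Qed.

Lemma le_frac_Sobolev_norm u (e : R) : X u -> (N u <= e%:E)%E ->
  controlled p m.+2 sobolev_op u e.
Proof.
move=> Xu ue; have : graph_space p m.+2 sobolev_op u by rewrite -frac_Sobolev_graph.
move=> [pu gu]; split => // i im; have uv := sobolev_derivP Xu im.
exists (sobolev_deriv i u); split => //.
  have [v' uv' pv'] := gu i im.
  have [[mv _ _] _] := uv; have mv' := Lp_measurable pv'.
  apply/LpP; split => //.
  rewrite (ae_eq_Lp_norm p1 mv mv' (weak_op_ae_unique uv uv')).
  by have /LpP[] := pv'.
apply: le_trans ue; rewrite frac_Sobolev_normE.
rewrite -[leLHS]poweRe1 ?Lp_norm_ge0// -(@mulfV _ p) ?gt_eqF// poweRrM.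
apply: gt0_ler_poweR.
- by rewrite invr_ge0 ltW.
- by rewrite in_itv/= leey poweR_ge0.
- by rewrite in_itv/= leey sume_ge0.
by rewrite (bigD1 (Ordinal im))//= leeDl// sume_ge0.
Qed.

(** The bounds at orders m and m + 1 together control the fractional component, hence a factor 2;
    adding 1 makes the constant at least 1, as the classical components require. *)
Lemma smooth_controlled : exists2 C : R, 0 < C & forall w (d : nat -> R -> R) (e : R), 0 <= e ->
  Lp p w -> (forall k, (k < m.+2)%N -> [/\ weak_op (deriv_op k) w (d k), Lp p (d k) &
    (Lp_norm p (d k) <= e%:E)%E]) -> controlled p m.+2 sobolev_op w (C * e).
Proof.
have [C C0 hC] := weak_frac_deriv_bound p1 s a0.
have C2 : 0 <= C * 2 by rewrite mulr_ge0.
exists (C * 2 + 1) => [|w d e e0 pw wd]; first by rewrite ltr_wpDl.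
split => // i im; rewrite /sobolev_op; case: ifPn => [iM|_].
  have [wi pi ie] := wd i im; exists (d i); split => //.
  by apply: le_trans ie _; rewrite lee_fin ler_peMl// lerDr.
have [w1 q1 e1] := wd m (leqW (leqnn _)); have [w2 q2 e2] := wd m.+1 (leqnn _).
have [v [wv pv ve]] := hC w _ _ pw q1 q2 w1 w2.
exists v; split => //; apply: le_trans ve _.
apply: (@le_trans _ _ (C%:E * (e%:E + e%:E))%E).
  by apply: lee_wpmul2l; [rewrite lee_fin|exact: leeD].
by rewrite -EFinD -EFinM lee_fin; lra.
Qed.

Lemma C0inf_frac_Sobolev f : C0inf f -> X f.
Proof.
move=> cf; have [C C0 hC] := smooth_controlled.
have pf k : Lp p (derive1n k f) by apply: C0inf_Lp => //; exact: C0inf_derive1n.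
pose b k := fine (Lp_norm p (derive1n k f)).
have bE k : Lp_norm p (derive1n k f) = (b k)%:E.
  by rewrite fineK// ge0_fin_numE ?Lp_norm_ge0//; have /LpP[] := pf k.
have b0 k : 0 <= b k by rewrite fine_ge0// Lp_norm_ge0.
pose e := \sum_(i < m.+2) b i.
have e0 : 0 <= e by exact: sumr_ge0.
rewrite frac_Sobolev_graph; apply: (@controlled_graph_space _ _ _ _ _ (C * e)).
apply: (hC _ (fun k => derive1n k f)) => // [|k km]; first exact: (pf 0%N).
split => //; first by apply: Cinf_weak_op; exact: C0inf_Cinf.
by rewrite bE lee_fin /e (bigD1 (Ordinal km))//= lerDl sumr_ge0.
Qed.

(** All derivatives fall on the mollifier, and Young's inequality puts each of them in L^p whatever
    the regularity of [u]. *)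
Lemma mollify_smooth u j : Lp p u ->
  Cinf (conv (mollifier j) u) /\ forall k, Lp p (derive1n k (conv (mollifier j) u)).
Proof.
move=> pu; have lu := Lp_locally_integrable p1 pu; have mu_ := Lp_measurable pu.
have cm := C0inf_mollifier (R := R) j.
have mm := C0inf_measurable cm.
rewrite convC//; split; first exact: Cinf_conv.
move=> k; rewrite derive1n_conv//.
have ck := C0inf_derive1n k cm; rewrite convC//; last exact: C0inf_measurable.
by have [] := Lp_conv p1 (C0inf_L1 ck) pu.
Qed.

(** Half of [d] goes to the mollification, half to the cutoff. The second error is measured through
    derivatives up to order m + 1, which the mollified function has even if [u] does not. *)
Lemma C0inf_approx u (d : R) : X u -> 0 < d ->
  exists2 f, C0inf f & controlled p m.+2 sobolev_op (u \- f) d.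
Proof.
move=> Xu d0; have gu : graph_space p m.+2 sobolev_op u by rewrite -frac_Sobolev_graph.
have d2 : 0 < d / 2 by rewrite divr_gt0.
have [j uj] := graph_space_mollify p1 sobolev_op_admissible gu d2.
have [pu _] := gu; set g := conv (mollifier j) u in uj.
have [ig pg] := mollify_smooth j pu; rewrite -/g in ig pg.
have [C C0 hC] := smooth_controlled.
have dC : 0 < d / 2 / C by rewrite divr_gt0.
have [K hK] := @finite_eventually m.+2
  (fun k j => (Lp_norm p (derive1n k (cutoff j \* g) \- derive1n k g)%R <= (d / 2 / C)%:E)%E)
  (fun k _ => cutoff_derive1n_cvg p1 k ig pg dC).
pose f := cutoff K \* g.
have cf : C0inf f := C0infM (C0inf_cutoff K) ig.
have pf k : Lp p (derive1n k f) := C0inf_Lp p1 (C0inf_derive1n k cf).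
exists f => //.
have fg : controlled p m.+2 sobolev_op (f \- g) (d / 2).
  rewrite (_ : d / 2 = C * (d / 2 / C)); last by field; rewrite gt_eqF.
  apply: (hC _ (fun k => derive1n k f \- derive1n k g)); first exact: ltW.
    by apply: LpB => //; [exact: (pf 0%N)|exact: (pg 0%N)].
  move=> k km; split; [|exact: LpB|exact: hK].
  apply: (weak_opB p1).
  - by have [+ _] := deriv_op_admissible p1 k.
  - exact: (pf 0%N).
  - exact: (pg 0%N).
  - by apply: Cinf_weak_op; exact: C0inf_Cinf.
  - exact: Cinf_weak_op.
have := controlledB p1 sobolev_op_admissible
  (controlledC p1 sobolev_op_admissible uj) fg.
rewrite -splitr; congr controlled; apply/funext => x /=; ring.
Qed.

End fractional_spaces.

Theorem theorem4p5 (R : realType) (s : side) (a p : R)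
    (ha : 0 < a) (hp : 1 <= p) :
  dense_in (frac_Sobolev_norm s a p) (frac_Sobolev s a p) C0inf /\
  (frac_Sobolev_bar s a p = frac_Sobolev_bar0 s a p /\
   frac_Sobolev_bar0 s a p =
     canonical_copy (frac_Sobolev_norm s a p) (frac_Sobolev s a p)).
Proof.
apply: (graph_space_completions hp (ltn0Sn (Num.truncn a).+1)
  (sobolev_op_admissible s ha hp) (sobolev_op0 s a hp) (frac_Sobolev_graph s p ha)).
- by move=> u _; exact: frac_Sobolev_norm_ge0.
- by move=> u e; exact: frac_Sobolev_norm_le.
- by move=> u e; exact: le_frac_Sobolev_norm.
(* A test function vanishes far out on both sides, so it belongs to the one-sided class of either
   sign. *)
- move=> f cf; split; last exact: C0inf_frac_Sobolev.
  have /C0infP[ic [B B0 fB]] := cf; split => //.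
  case: s; [exists B|exists (- B)] => x xB; apply: fB.
    by rewrite (le_trans (ltW xB))// ler_norm.
  by rewrite ler_normr; apply/orP; right; lra.
- by move=> f [[ic _] Xf].
- by move=> f [].
- by move=> u d Xu d0; exact: C0inf_approx.
Qed.
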